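(* Let $u$ be the solution of the problem $(\mathcal N)$ described in the context, and let $u_h\in C^1([0,T];S_h)$ be its semidiscrete approximation, i.e. $u_h(0,\cdot)=R_hu_0$ and, for all $\phi\in S_h$ and all $t\in[0,T]$, $$(\partial_t u_h(t,\cdot),\phi)=\mathrm{i}\,a(t)\mu(t)\big[S(t)\,\partial_tu_h(t,1)+G(t)\,u_h(t,1)\big]\overline{\phi(1)}-\mathrm{i}\,a(t)\,\mathcal B(u_h(t,\cdot),\phi)+\mathrm{i}\,(\beta(t,\cdot)u_h(t,\cdot),\phi)+(f(t,\cdot),\phi).$$ Assume that $\mu(t)\le 0$ and $S(t)>0$ for $t\in[0,T]$. Then there is a constant $C$, independent of $h$ and $t$, such that $$\|u_h(t,\cdot)-u(t,\cdot)\|+h\,\|u_h(t,\cdot)-u(t,\cdot)\|_1\le C\,h^{r+1}\Big(\|u(t,\cdot)\|_{r+1}^2+\int_0^t\Gamma_{\mathcal N}(\tau)\,d\tau\Big)^{1/2}\qquad\forall\,t\in[0,T],\ \forall\,h\in(0,h_\star],$$ where $$\Gamma_{\mathcal N}(\tau):=\|u(\tau,\cdot)\|_{r+1}^2+\|\partial_tu(\tau,\cdot)\|_{r+1}^2+\sum_{\ell=0}^2\int_0^\tau\|\partial_t^\ell u(s,\cdot)\|_{r+1}^2\,ds .$$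
   Context: Function spaces: $D=(0,1)$; functions are complex-valued; $(f_1,f_2)=\int_D f_1\overline{f_2}\,dx$ and $\|\cdot\|$ is the $L^2(D)$ norm; $\|f\|_s=\big(\sum_{\ell=0}^s\|\partial_x^\ell f\|^2\big)^{1/2}$ is the norm of $H^s(D)$; $|v|_1=\|v'\|$; $\mathbb H^1(D)=\{v\in H^1(D):v(0)=0\}$, $\mathbb H^s(D)=H^s(D)\cap\mathbb H^1(D)$ for $s\ge2$; $\mathcal B(v,w)=(v',w')$. Finite elements: $r\in\mathbb N$, $h_\star>0$ are fixed. For each $h\in(0,h_\star]$, $S_h$ is a finite-dimensional subspace of $\mathbb H^1(D)$ consisting of complex-valued functions that are polynomials of degree at most $r$ on each interval of a (non-uniform) partition of $D$ with maximum length $h$ (in particular the function $x\mapsto x$ is in $S_h$). With constants independent of $h$, one has the approximation property $\inf_{\chi\in S_h}\{\|v-\chi\|+h\|v-\chi\|_1\}\le C h^{s+1}\|v\|_{s+1}$ for $v\in\mathbb H^{s+1}(D)$, $s=0,\dots,r$, and it is assumed that the inverse inequality $|\phi|_1\le C h^{-1}\|\phi\|$ holds for all $\phi\in S_h$. The elliptic projection $R_h:H^1(D)\to S_h$ is defined by $\mathcal B(R_hv,\phi)=\mathcal B(v,\phi)$ for all $\phi\in S_h$. Problem $(\mathcal N)$: given $T>0$, $a:[0,T]\to\mathbb R\setminus\{0\}$, $\beta,f:[0,T]\times\overline D\to\mathbb C$, $u_0:\overline D\to\mathbb C$, $\mu,S:[0,T]\to\mathbb R$, $G:[0,T]\to\mathbb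 C$, find $u:[0,T]\times\overline D\to\mathbb C$ with $u_t=\mathrm{i}\,a(t)u_{xx}+\mathrm{i}\,\beta(t,x)u+f(t,x)$ on $[0,T]\times\overline D$; $u(t,0)=0$ and $u_x(t,1)=\mu(t)\,[S(t)u_t(t,1)+G(t)u(t,1)]$ for $t\in[0,T]$; $u(0,x)=u_0(x)$ for $x\in\overline D$. It is assumed that $u$ exists uniquely and that the data and $u$ are sufficiently smooth for the stated estimate. *)

(* Defs.v *)
From HB Require Import structures.
From mathcomp Require Import all_boot all_order all_algebra.
From mathcomp Require Import complex.
From mathcomp Require Import all_classical all_reals all_analysis.

Set Implicit Arguments.
Unset Strict Implicit.
Unset Printing Implicit Defensive.

Import Order.TTheory GRing.Theory Num.Theory.
Import numFieldNormedType.Exports.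

Local Open Scope classical_set_scope.
Local Open Scope ring_scope.

(* Functions on [0, 1], [0, T] or [0, T] x [0, 1] are represented by total
   functions on R or R * R; every notion below only looks at the values taken
   on the relevant closed interval or rectangle. *)

Section complex_valued.
Context {R : realType}.
Local Notation C := R[i].
Local Notation leb := (@lebesgue_measure R).

Definition continuous_on {X : topologicalType} (A : set X) (f : X -> C) :=
  {within A, continuous (fun x => complex.Re (f x))} /\
  {within A, continuous (fun x => complex.Im (f x))}.

Definition cintegral (A : set R) (f : R -> C) : C :=
  Complex (\int[leb]_(x in A) complex.Re (f x))
          (\int[leb]_(x in A) complex.Im (f x)).

(* Classical derivatives relative to the closed interval [a, b]: they are
   one-sided at the end points. *)

Definition diff_quot (f : R -> R) (x y : R) : R := (f y - f x) / (y - x).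

Definition derivable_at (a b : R) (f : R -> R) (x : R) : Prop :=
  cvg (diff_quot f x @ within `[a, b]%classic x^').

Definition der (a b : R) (f : R -> R) (x : R) : R :=
  lim (diff_quot f x @ within `[a, b]%classic x^').

Definition C1_on (a b : R) (f : R -> R) : Prop :=
  (forall x : R, a <= x <= b -> derivable_at a b f x) /\
  {within `[a, b], continuous (der a b f)}.

Definition cderivable_at (a b : R) (f : R -> C) (x : R) : Prop :=
  derivable_at a b (fun y => complex.Re (f y)) x /\
  derivable_at a b (fun y => complex.Im (f y)) x.

Definition cder (a b : R) (f : R -> C) (x : R) : C :=
  Complex (der a b (fun y => complex.Re (f y)) x)
          (der a b (fun y => complex.Im (f y)) x).

Definition Dt (T : R) (v : R -> R -> C) : R -> R -> C :=
  fun t x => cder 0 T (fun s => v s x) t.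

Definition Dx (v : R -> R -> C) : R -> R -> C := fun t x => cder 0 1 (v t) x.

(* C^k([0, T] x [0, 1]): all partial derivatives of order at most k, taken in
   any order, exist and are continuous on the closed rectangle. *)
Fixpoint Ck_rect (T : R) (k : nat) (v : R -> R -> C) : Prop :=
  continuous_on (`[0, T]%classic `*` `[0, 1]%classic : set (R * R))
                (fun p => v p.1 p.2) /\
  if k is k'.+1 then
    [/\ forall t x : R, 0 <= t <= T -> 0 <= x <= 1 ->
          cderivable_at 0 T (fun s => v s x) t /\ cderivable_at 0 1 (v t) x,
        Ck_rect T k' (Dt T v) & Ck_rect T k' (Dx v)]
  else True.

Definition Dom : set R := `]0, 1[%classic.

Definition L2 (f : R -> C) : Prop :=
  [/\ measurable_fun Dom (fun x => complex.Re (f x)),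
      measurable_fun Dom (fun x => complex.Im (f x)) &
      leb.-integrable Dom
        (fun x : R => (complex.Re (f x) ^+ 2 + complex.Im (f x) ^+ 2)%:E)].

Definition inner (f g : R -> C) : C :=
  cintegral Dom (fun x => f x * (g x)^*%C).

Definition norm2 (f : R -> C) : R := Num.sqrt (complex.Re (inner f f)).

(* C_c^1(D), extended by 0: by mollification it yields the same weak
   derivatives as C_c^infty(D). Real test functions suffice, by linearity. *)
Definition test_fun (phi : R -> R) : Prop :=
  [/\ forall x : R, derivable phi x 1, continuous (derive1 phi) &
      exists a b : R,
        [/\ 0 < a, b < 1 & forall x : R, ~~ (a <= x <= b) -> phi x = 0]].

Definition is_wderiv (v w : R -> C) : Prop :=
  L2 w /\
  forall phi, test_fun phi ->
    cintegral Dom (fun x => v x * (derive1 phi x)%:C%C) =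
    - cintegral Dom (fun x => w x * (phi x)%:C%C).

(* a representative of the (a.e. unique) weak derivative, when it exists *)
Definition wderiv (v : R -> C) : R -> C :=
  xget (fun=> 0) [set w | is_wderiv v w].

Fixpoint Hs (s : nat) (v : R -> C) : Prop :=
  L2 v /\ if s is s'.+1 then exists2 w, is_wderiv v w & Hs s' w else True.

Definition sob_norm (s : nat) (v : R -> C) : R :=
  Num.sqrt (\sum_(l < s.+1) norm2 (iter l wderiv v) ^+ 2).

(* H^s(D) with v(0) = 0, for s >= 1: the elements of H^s(D) are taken to be
   their continuous representatives on [0, 1], so that point values make
   sense. *)
Definition Hs0 (s : nat) (v : R -> C) : Prop :=
  [/\ Hs s v, continuous_on (`[0, 1]%classic : set R) v & v 0 = 0].

Definition Bform (v w : R -> C) : C := inner (wderiv v) (wderiv w).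

(* 0 :: s lists the nodes of a partition of (0, 1) with maximum length h, and
   v coincides on each of its intervals with a polynomial of degree <= r. *)
Definition partition_of_size (h : R) (s : seq R) : Prop :=
  itv_partition 0 1 s /\
  \big[Num.max/0]_(j < size s) (nth 0 (0 :: s) j.+1 - nth 0 (0 :: s) j) = h.

Definition piecewise_poly (r : nat) (s : seq R) (v : R -> C) : Prop :=
  forall j, (j < size s)%N ->
    exists2 p : {poly C}, (size p <= r.+1)%N &
      forall x : R, nth 0 (0 :: s) j <= x <= nth 0 (0 :: s) j.+1 ->
        v x = p.[x%:C%C].

(* The first clause says that V is a set of functions on [0, 1]. *)
Record fe_space (r : nat) (h : R) (V : set (R -> C)) : Prop := {
  fe_ext : forall v w : R -> C, V v -> (forall x : R, 0 <= x <= 1 -> v x = w x) -> V w ;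
  fe_lin : forall (c : C) v w, V v -> V w -> V (fun x => c * v x + w x) ;
  fe_fin : exists n (b : 'I_n -> R -> C), forall v, V v ->
    exists c : 'I_n -> C, forall x : R, 0 <= x <= 1 ->
      v x = \sum_(i < n) c i * b i x ;
  fe_H1 : forall v, V v -> Hs0 1 v ;
  fe_poly : exists2 s, partition_of_size h s &
    forall v, V v -> piecewise_poly r s v ;
  fe_id : V (fun x => x%:C%C)
}.

Definition approx_property (hstar : R) (r : nat) (Sh : R -> set (R -> C)) :=
  exists K : R, forall h : R, 0 < h <= hstar ->
    forall s, (s <= r)%N -> forall v, Hs0 s.+1 v ->
      inf ((fun chi => norm2 (fun x => v x - chi x) +
                       h * sob_norm 1 (fun x => v x - chi x)) @` Sh h) <=
      K * h ^+ s.+1 * sob_norm s.+1 v.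

Definition inverse_inequality (hstar : R) (Sh : R -> set (R -> C)) :=
  exists K : R, forall h : R, 0 < h <= hstar ->
    forall phi, Sh h phi -> norm2 (wderiv phi) <= K * h^-1 * norm2 phi.

Definition elliptic_proj (V : set (R -> C)) (v w : R -> C) : Prop :=
  V w /\ forall phi, V phi -> Bform w phi = Bform v phi.

Definition solves_N (T : R) (r : nat) (a : R -> R) (beta f : R -> R -> C)
    (u0 : R -> C) (mu S : R -> R) (G : R -> C) (u : R -> R -> C) : Prop :=
  [/\ Ck_rect T r.+3 u,
      forall t x : R, 0 <= t <= T -> 0 <= x <= 1 ->
        Dt T u t x = 'i%C * (a t)%:C%C * Dx (Dx u) t x
                     + 'i%C * beta t x * u t x + f t x,
      forall t : R, 0 <= t <= T -> u t 0 = 0,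
      forall t : R, 0 <= t <= T ->
        Dx u t 1 = (mu t)%:C%C * ((S t)%:C%C * Dt T u t 1 + G t * u t 1) &
      forall x : R, 0 <= x <= 1 -> u 0 x = u0 x].

Definition unique_solution_N (T : R) (r : nat) (a : R -> R)
    (beta f : R -> R -> C) (u0 : R -> C) (mu S : R -> R) (G : R -> C)
    (u : R -> R -> C) : Prop :=
  solves_N T r a beta f u0 mu S G u /\
  forall v, solves_N T r a beta f u0 mu S G v ->
    forall t x : R, 0 <= t <= T -> 0 <= x <= 1 -> v t x = u t x.

(* w belongs to C^1([0, T]; V), with derivative dw; V carries the L^2 norm. *)
Definition C1_into (T : R) (V : set (R -> C)) (w dw : R -> R -> C) : Prop :=
  forall t : R, 0 <= t <= T ->
    [/\ V (w t), V (dw t),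
        norm2 (fun x => ((s - t)^-1)%:C%C * (w s x - w t x) - dw t x)
          @[s --> within `[0, T]%classic t^'] --> (0 : R) &
        norm2 (fun x => dw s x - dw t x)
          @[s --> within `[0, T]%classic t^'] --> (0 : R)].

Definition semidiscrete (T : R) (a : R -> R) (beta f : R -> R -> C)
    (u0 : R -> C) (mu S : R -> R) (G : R -> C) (V : set (R -> C))
    (uh : R -> R -> C) : Prop :=
  exists duh : R -> R -> C,
  [/\ C1_into T V uh duh,
      elliptic_proj V u0 (uh 0) &
      forall phi (t : R), V phi -> 0 <= t <= T ->
        inner (duh t) phi =
          'i%C * (a t)%:C%C * (mu t)%:C%C
            * ((S t)%:C%C * duh t 1 + G t * uh t 1) * (phi 1)^*%C
          - 'i%C * (a t)%:C%C * Bform (uh t) phi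
          + 'i%C * inner (fun x => beta t x * uh t x) phi
          + inner (f t) phi].

Definition GammaN (T : R) (r : nat) (u : R -> R -> C) (tau : R) : R :=
  sob_norm r.+1 (u tau) ^+ 2 + sob_norm r.+1 (Dt T u tau) ^+ 2 +
  \sum_(l < 3)
    \int[leb]_(s in `[0, tau]) (sob_norm r.+1 (iter l (Dt T) u s) ^+ 2).

End complex_valued.

(* Main.v *)
Require Import Defs.
From HB Require Import structures.
From mathcomp Require Import all_boot all_order all_algebra.
From mathcomp Require Import complex.
From mathcomp Require Import all_classical all_reals all_analysis.
From mathcomp Require Import measurable_realfun.
From mathcomp Require Import ring lra.

Set Implicit Arguments.
Unset Strict Implicit.
Unset Printing Implicit Defensive.

Import Order.TTheory GRing.Theory Num.Theory.
Import numFieldNormedType.Exports.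

(** Let W be the elliptic projection of u and write uh - u = th + rho with
    th = uh - W in the finite element space and rho = W - u. The error rho is
    O(h^(r+1)) in L2 and O(h^r) in H1 by best approximation (elliptic_best) and
    duality (nitsche), and so are its time derivatives, because projecting
    commutes with differentiating in time (elliptic_curve_der). The identity
    function belongs to the finite element space, whence W(1) = u(1)
    (elliptic_at1), and th satisfies (error_equation)

      (dth, phi) = i a mu [S dth(1) + G th(1)] conj(phi(1)) - i a B(th, phi)
                   + i (beta th, phi) + (F, phi),    F = i beta rho - d_t rho,

    where dth is the time derivative of th. What must be shown is that the L2
    norm of th is controlled by time integrals of F and of d_t F as they occur in
    GammaN; the H1 norm then follows from the inverse inequality.

    The difficulty is the boundary term with dth(1), which no norm of th
    dominates. Put X = |th|_1^2 / 2 and q = |mu| S |dth(1)|^2. The choice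
    phi = th gives, for the real part (first_test),

      (|th|^2 / 2)' <= C (sqrt(q X) + X + |F| |th|).

    The choice phi = i dth removes the left hand side (rotated_test). Since
    mu <= 0 < S, the boundary term is now the dissipation - q. The term (F, dth)
    is removed by passing from X to Z = X - Im (F, th) / a. The term
    (beta th, dth) equals (chi, dth) for the L2 projection chi of beta th, and the
    error equation with phi = chi bounds it; this needs the stability of the L2
    projection in H1 (L2_projection_stable). The result (second_test) is

      Z' <= - q / 2 + C X + C k |th|,    k >= |F|, |d_t F|.

    The two inequalities are combined in energy_gronwall. With M the maximum of
    |th| over [0, t], the second one yields X <= C M (|F(0)| + int k). In the
    first one sqrt(q X) <= (lam q + X / lam) / 2 with lam = sqrt(t - s), and
    lam q is compensated by adding a multiple of lam Z to |th|^2 / 2. The factor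
    1 / lam is integrable, and the weight lam vanishes at s = t, so Z(t) does not
    enter. This gives

      M^2 <= C (t |F(0)|^2 + int_0^t (t - s) k(s)^2 ds),

    and t |F(0)|^2 is bounded by the integral of |F|^2 plus the last term. Both
    are at most C h^(2 r + 2) times the integral of GammaN (data_le_Gamma): the
    weight t - s corresponds to the double integral in GammaN.

    Functional analysis enters through weak derivatives on an interval: a
    continuous function is the integral of its weak derivative (weak_FTC), from
    which Poincare's inequality (poincare), the bound on point values (H1_sup) and
    integration by parts (ibp_H1) follow. *)

Local Open Scope classical_set_scope.
Local Open Scope ring_scope.

Local Notation re := complex.Re.
Local Notation im := complex.Im.
Local Notation normc := Normc.normc.

(** * Complex numbers and the space L2(0, 1) *)

Section complex_parts.
Context {R : rcfType}.
Implicit Types x y : R[i].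

Lemma re_add x y : re (x + y) = re x + re y. Proof. by case: x y => ? ? []. Qed.
Lemma im_add x y : im (x + y) = im x + im y. Proof. by case: x y => ? ? []. Qed.
Lemma re_opp x : re (- x) = - re x. Proof. by case: x. Qed.
Lemma im_opp x : im (- x) = - im x. Proof. by case: x. Qed.
Lemma re_mul x y : re (x * y) = re x * re y - im x * im y.
Proof. by case: x y => ? ? []. Qed.
Lemma im_mul x y : im (x * y) = re x * im y + im x * re y.
Proof. by case: x y => ? ? []. Qed.
Lemma re_conj x : re x^*%C = re x. Proof. by case: x. Qed.
Lemma im_conj x : im x^*%C = - im x. Proof. by case: x. Qed.
Lemma re_i : re ('i%C : R[i]) = 0. Proof. by []. Qed.
Lemma im_i : im ('i%C : R[i]) = 1. Proof. by []. Qed.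
Lemma re_real (a : R) : re (a%:C%C) = a. Proof. by []. Qed.
Lemma im_real (a : R) : im (a%:C%C) = 0. Proof. by []. Qed.
Lemma re_0 : re (0 : R[i]) = 0. Proof. by []. Qed.
Lemma im_0 : im (0 : R[i]) = 0. Proof. by []. Qed.

Definition reimE := (re_mul, im_mul, re_add, im_add, re_opp, im_opp, re_conj,
  im_conj, re_i, im_i, re_real, im_real, re_0, im_0).

Lemma complex_ext x y : re x = re y -> im x = im y -> x = y.
Proof. by case: x y => a b [c d] /= -> ->. Qed.

End complex_parts.

Section L2.
Context {R : realType}.
Local Notation C := R[i].
Local Notation leb := (@lebesgue_measure R).
Local Notation D := (@Dom R).
Implicit Types (f g h : R -> C) (p q : R -> R).

Lemma measurable_Dom : measurable (D : set (measurableTypeR R)). Proof. exact: measurable_itv. Qed.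
#[local] Hint Resolve measurable_Dom : core.

Lemma DomE (x : R) : D x = (0 < x < 1) :> Prop.
Proof. by rewrite /Dom /= in_itv. Qed.

Definition int_on_D p := leb.-integrable D (EFin \o p).

Lemma int_on_DD p q : int_on_D p -> int_on_D q -> int_on_D (fun x => p x + q x).
Proof.
move=> ip iq; have := integrableD measurable_Dom ip iq.
by apply: eq_integrable => // x _.
Qed.

Lemma int_on_DZ (c : R) p : int_on_D p -> int_on_D (fun x => c * p x).
Proof.
move=> ip; have := integrableZl measurable_Dom c ip.
by apply: eq_integrable => // x _.
Qed.

Lemma int_on_DB p q : int_on_D p -> int_on_D q -> int_on_D (fun x => p x - q x).
Proof.
move=> ip iq; have := integrableB measurable_Dom ip iq.
by apply: eq_integrable => // x _.
Qed.

Definition square_int p := measurable_fun D p /\ int_on_D (fun x => p x ^+ 2).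

Lemma square_int_mul p q :
  square_int p -> square_int q -> int_on_D (fun x => p x * q x).
Proof.
move=> [mp ip] [mq iq].
apply: (le_integrable _ _ _ (int_on_DD ip iq)) => //.
  exact/measurable_EFinP/measurable_funM.
move=> x _ /=; rewrite lee_fin.
rewrite [leRHS]ger0_norm ?addr_ge0 ?sqr_ge0// normrM.
rewrite -(real_normK (num_real (p x))) -(real_normK (num_real (q x))).
have := sqr_ge0 (`|p x| - `|q x|).
have := mulr_ge0 (normr_ge0 (p x)) (normr_ge0 (q x)).
nra.
Qed.

Lemma square_intDZ (c : R) p q :
  square_int p -> square_int q -> square_int (fun x => c * p x + q x).
Proof.
move=> sp sq; have [mp ip] := sp; have [mq iq] := sq.
split; first by apply: measurable_funD => //; apply: measurable_funM.
have := int_on_DD (int_on_DZ (c ^+ 2) ip)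
  (int_on_DD (int_on_DZ (c * 2) (square_int_mul sp sq)) iq).
by apply: eq_integrable => // x _; rewrite /=; congr EFin; ring.
Qed.

Lemma L2P f :
  L2 f <-> square_int (fun x => re (f x)) /\ square_int (fun x => im (f x)).
Proof.
split=> [[mr mi s]|[[mr sr] [mi si]]]; last first.
  by split => //; exact: (int_on_DD sr si).
by split; split => //; apply: (le_integrable _ _ _ s) => //;
  rewrite ?[X in measurable_fun _ X](_ : _ = EFin \o _)//;
  (try by apply/measurable_EFinP; exact: measurable_funX) => x _ /=;
  rewrite lee_fin !ger0_norm ?addr_ge0 ?sqr_ge0// ?lerDl ?lerDr sqr_ge0.
Qed.

Lemma L2_lin (c : C) f g : L2 f -> L2 g -> L2 (fun x => c * f x + g x).
Proof.
move=> /L2P[fr fi] /L2P[gr gi]; apply/L2P; split.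
  have := square_intDZ (re c) fr (square_intDZ (- im c) fi gr).
  by congr square_int; apply/funext => x; rewrite !reimE; ring.
have := square_intDZ (re c) fi (square_intDZ (im c) fr gi).
by congr square_int; apply/funext => x; rewrite !reimE; ring.
Qed.

Lemma square_int0 : square_int (fun=> 0).
Proof.
split; first exact: measurable_cst.
rewrite /int_on_D (_ : _ \o _ = cst 0%E); first exact: integrable0.
by apply/funext => x /=; rewrite expr0n.
Qed.

Lemma L2_0 : L2 (fun=> 0 : C).
Proof. by apply/L2P; split; exact: square_int0. Qed.

Lemma L2D f g : L2 f -> L2 g -> L2 (fun x => f x + g x).
Proof.
by move=> Lf Lg; have := L2_lin 1 Lf Lg; congr L2; apply/funext => x; ring.
Qed.

Lemma L2B f g : L2 f -> L2 g -> L2 (fun x => f x - g x).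
Proof.
by move=> Lf Lg; have := L2_lin (-1) Lg Lf; congr L2; apply/funext => x; ring.
Qed.

Lemma L2Z c f : L2 f -> L2 (fun x => c * f x).
Proof.
by move=> Lf; have := L2_lin c Lf L2_0; congr L2; apply/funext => x; ring.
Qed.

(** The real part of the inner product makes the complex L2 space a real
    Euclidean space; every estimate below is carried out there, the imaginary
    part of an inner product being recovered from multiplication by i. *)
Definition rip f g : R :=
  \int[leb]_(x in D) (re (f x) * re (g x) + im (f x) * im (g x)).

Lemma ripE f g : rip f g =
  \int[leb]_(x in D) (re (f x) * re (g x) + im (f x) * im (g x)).
Proof. by []. Qed.

Lemma rip_int f g : L2 f -> L2 g ->
  int_on_D (fun x => re (f x) * re (g x) + im (f x) * im (g x)).
Proof.
by move=> /L2P[fr fi] /L2P[gr gi]; apply: int_on_DD; exact: square_int_mul.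
Qed.

Lemma re_inner f g : re (inner f g) = rip f g.
Proof.
by rewrite /inner /cintegral /=; apply: eq_Rintegral => x _; rewrite !reimE; ring.
Qed.

Lemma im_inner f g : im (inner f g) = rip f (fun x => 'i%C * g x).
Proof.
by rewrite /inner /cintegral /=; apply: eq_Rintegral => x _; rewrite !reimE; ring.
Qed.

Lemma ripC f g : rip f g = rip g f.
Proof. by apply: eq_Rintegral => x _; ring. Qed.

Lemma rip_linl (c : R) f g h : L2 f -> L2 g -> L2 h ->
  rip (fun x => c%:C%C * f x + g x) h = c * rip f h + rip g h.
Proof.
move=> Lf Lg Lh; rewrite /rip.
rewrite -RintegralZl//; last exact: rip_int.
rewrite -RintegralD//; [|exact/int_on_DZ/rip_int|exact: rip_int].
by apply: eq_Rintegral => x _; rewrite !reimE; ring.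
Qed.

Lemma ripDl f g h : L2 f -> L2 g -> L2 h ->
  rip (fun x => f x + g x) h = rip f h + rip g h.
Proof.
move=> Lf Lg Lh; rewrite -[rip f h]mul1r -rip_linl//.
by congr rip; apply/funext => x; rewrite mul1r.
Qed.

Lemma ripBl f g h : L2 f -> L2 g -> L2 h ->
  rip (fun x => f x - g x) h = rip f h - rip g h.
Proof.
move=> Lf Lg Lh; rewrite addrC -mulN1r -rip_linl//; congr rip; apply/funext => x.
by apply: complex_ext; rewrite !reimE; ring.
Qed.

Lemma rip0l h : rip (fun=> 0) h = 0.
Proof.
rewrite /rip (_ : (fun x => _) = cst 0) ?Rintegral_cst ?mul0r//.
by apply/funext => x; rewrite !reimE !mul0r addr0.
Qed.

Lemma ripZl (c : R) f h : L2 f -> L2 h ->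
  rip (fun x => c%:C%C * f x) h = c * rip f h.
Proof.
move=> Lf Lh; have := rip_linl c Lf L2_0 Lh; rewrite rip0l addr0 => <-.
by congr rip; apply/funext => x; rewrite addr0.
Qed.

Lemma ripZr (c : R) f h : L2 f -> L2 h ->
  rip h (fun x => c%:C%C * f x) = c * rip h f.
Proof. by move=> Lf Lh; rewrite ripC ripZl// ripC. Qed.

Lemma ripDr f g h : L2 f -> L2 g -> L2 h ->
  rip h (fun x => f x + g x) = rip h f + rip h g.
Proof. by move=> *; rewrite ripC ripDl// ![rip _ h]ripC. Qed.

Lemma ripBr f g h : L2 f -> L2 g -> L2 h ->
  rip h (fun x => f x - g x) = rip h f - rip h g.
Proof. by move=> *; rewrite ripC ripBl// ![rip _ h]ripC. Qed.

Lemma rip_il f g : L2 f -> L2 g ->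
  rip (fun x => 'i%C * f x) g = - rip f (fun x => 'i%C * g x).
Proof.
move=> Lf Lg; rewrite -mulN1r -ripZr//; last exact: L2Z.
by apply: eq_Rintegral => x _; rewrite !reimE; ring.
Qed.

Lemma rip_ge0 f : 0 <= rip f f.
Proof. by apply: Rintegral_ge0 => x _; rewrite addr_ge0// -expr2 sqr_ge0. Qed.

Lemma norm2E f : norm2 f = Num.sqrt (rip f f).
Proof. by rewrite /norm2 re_inner. Qed.

Lemma norm2_sqr f : norm2 f ^+ 2 = rip f f.
Proof. by rewrite norm2E sqr_sqrtr// rip_ge0. Qed.

Lemma norm2_ge0 f : 0 <= norm2 f.
Proof. by rewrite norm2E sqrtr_ge0. Qed.

Lemma norm2_le f (c : R) : 0 <= c -> rip f f <= c ^+ 2 -> norm2 f <= c.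
Proof. by move=> c0 fc; rewrite norm2E -[c]ger0_norm// -sqrtr_sqr ler_wsqrtr. Qed.

Lemma rip_CS_sqr f g : L2 f -> L2 g -> rip f g ^+ 2 <= rip f f * rip g g.
Proof.
move=> Lf Lg.
have quad c : 0 <= c ^+ 2 * rip f f + 2 * c * rip f g + rip g g.
  have Lc : L2 (fun x => c%:C%C * f x + g x) by exact: L2_lin.
  have := rip_ge0 (fun x => c%:C%C * f x + g x).
  rewrite rip_linl// (ripC f) (ripC g) !rip_linl// (ripC g f).
  set A := rip f f; set B := rip f g; set E := rip g g.
  by have -> : c * (c * A + B) + (c * B + E) = c ^+ 2 * A + 2 * c * B + E by ring.
have [f0|fn0] := eqVneq (rip f f) 0.
  have [->|fg0] := eqVneq (rip f g) 0; first by rewrite expr0n mulr_ge0 ?rip_ge0.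
  have := quad (- (rip g g + 1) / (2 * rip f g)).
  rewrite f0 mulr0 add0r.
  have -> : 2 * (- (rip g g + 1) / (2 * rip f g)) * rip f g = - (rip g g + 1).
    by field.
  by lra.
have fp : 0 < rip f f by rewrite lt_neqAle eq_sym fn0 rip_ge0.
have := quad (- rip f g / rip f f).
have -> : (- rip f g / rip f f) ^+ 2 * rip f f +
   2 * (- rip f g / rip f f) * rip f g + rip g g =
   (rip f f * rip g g - rip f g ^+ 2) / rip f f by field.
by rewrite pmulr_lge0 ?invr_gt0// subr_ge0.
Qed.

Lemma rip_CS f g : L2 f -> L2 g -> `|rip f g| <= norm2 f * norm2 g.
Proof.
move=> Lf Lg; rewrite !norm2E -sqrtrM ?rip_ge0// -sqrtr_sqr ler_wsqrtr//.
exact: rip_CS_sqr.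
Qed.

Lemma rip_le f g : L2 f -> L2 g -> rip f g <= norm2 f * norm2 g.
Proof. by move=> Lf Lg; rewrite (le_trans (ler_norm _))// rip_CS. Qed.

Lemma norm2D f g : L2 f -> L2 g -> norm2 (fun x => f x + g x) <= norm2 f + norm2 g.
Proof.
move=> Lf Lg; apply: norm2_le; first by rewrite addr_ge0 ?norm2_ge0.
rewrite ripDl ?ripDr//; try exact: L2D.
rewrite sqrrD !norm2_sqr [rip g f]ripC.
by have := rip_le Lf Lg; lra.
Qed.

Lemma norm2Z (c : C) f : L2 f ->
  norm2 (fun x => c * f x) = Num.sqrt (re c ^+ 2 + im c ^+ 2) * norm2 f.
Proof.
move=> Lf; rewrite !norm2E -sqrtrM ?addr_ge0 ?sqr_ge0//; congr Num.sqrt.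
rewrite /rip -RintegralZl//; last exact: rip_int.
by apply: eq_Rintegral => x _; rewrite !reimE; ring.
Qed.

Lemma norm2_real (c : R) f : L2 f -> norm2 (fun x => c%:C%C * f x) = `|c| * norm2 f.
Proof. by move=> Lf; rewrite norm2Z// !reimE expr0n addr0 sqrtr_sqr. Qed.

Lemma norm2_i f : L2 f -> norm2 (fun x => 'i%C * f x) = norm2 f.
Proof. by move=> Lf; rewrite norm2Z// !reimE expr0n expr1n add0r sqrtr1 mul1r. Qed.

Lemma norm2N f : norm2 (fun x => - f x) = norm2 f.
Proof.
rewrite !norm2E; congr Num.sqrt; apply: eq_Rintegral => x _.
by rewrite !reimE; ring.
Qed.

Lemma L2N f : L2 f -> L2 (fun x => - f x).
Proof.
by move=> /(L2Z (-1)); congr L2; apply/funext => x; rewrite mulN1r.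
Qed.

Lemma norm2B f g : L2 f -> L2 g -> norm2 (fun x => f x - g x) <= norm2 f + norm2 g.
Proof.
by move=> Lf Lg; rewrite -(norm2N g); apply: norm2D => //; exact: L2N.
Qed.

Lemma norm2_distC f g : norm2 (fun x => f x - g x) = norm2 (fun x => g x - f x).
Proof. by rewrite -norm2N; congr norm2; apply/funext => x; rewrite opprB. Qed.

Lemma norm2_le_dist f g : L2 f -> L2 g ->
  norm2 f <= norm2 (fun x => f x - g x) + norm2 g.
Proof.
move=> Lf Lg; rewrite [in leLHS](_ : f = fun x => (f x - g x) + g x).
  by apply: norm2D => //; exact: L2B.
by apply/funext => x; rewrite subrK.
Qed.

Lemma norm2_dist f g : L2 f -> L2 g ->
  `|norm2 f - norm2 g| <= norm2 (fun x => f x - g x).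
Proof.
move=> Lf Lg; have := norm2_le_dist Lf Lg; have := norm2_le_dist Lg Lf.
by rewrite ler_norml (norm2_distC g f); lra.
Qed.

(** The weak derivative is a representative chosen in its class, so it is known
    only up to this relation. *)
Definition ae_eqD f g := {ae leb, forall x, D x -> f x = g x}.

Lemma ae_eqD_part f g (P : C -> C -> R) h : ae_eqD f g ->
  measurable_fun D (fun x => P (f x) (h x)) -> measurable_fun D (fun x => P (g x) (h x)) ->
  \int[leb]_(x in D) P (f x) (h x) = \int[leb]_(x in D) P (g x) (h x).
Proof.
move=> fg mf mg; congr fine; apply: ae_eq_integral => //.
- exact/measurable_EFinP.
- exact/measurable_EFinP.
- move: fg; apply: filterS; first exact: (ae_filter_ringOfSetsType leb).
  by move=> x /= H Dx; rewrite H.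
Qed.

Lemma rip_ae f g h : L2 f -> L2 g -> L2 h -> ae_eqD f g -> rip f h = rip g h.
Proof.
move=> Lf Lg Lh fg.
apply: (ae_eqD_part (P := fun a b => re a * re b + im a * im b) fg);
  by apply/measurable_EFinP; apply: (measurable_int leb); apply: rip_int.
Qed.

Lemma norm2_ae f g : L2 f -> L2 g -> ae_eqD f g -> norm2 f = norm2 g.
Proof.
move=> Lf Lg fg; rewrite !norm2E (rip_ae Lf Lg Lf fg) ripC.
by rewrite (rip_ae Lf Lg Lg fg).
Qed.

Lemma eqD_ae f g : (forall x, 0 < x < 1 -> f x = g x) -> ae_eqD f g.
Proof. by move=> fg; apply: aeW => x /=; rewrite DomE => /fg. Qed.

Lemma eq_rip f g h : (forall x, 0 < x < 1 -> f x = g x) -> rip f h = rip g h.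
Proof.
by move=> fg; apply: eq_Rintegral => x; rewrite inE DomE => /fg ->.
Qed.

Lemma eq_norm2 f g : (forall x, 0 < x < 1 -> f x = g x) -> norm2 f = norm2 g.
Proof. by move=> fg; rewrite !norm2E (eq_rip _ fg) ripC (eq_rip _ fg). Qed.

Lemma eq_L2 f g : (forall x, 0 < x < 1 -> f x = g x) -> L2 f -> L2 g.
Proof.
move=> fg [mr mi s].
have E P : {in D, (fun x => P (f x)) =1 (fun x => P (g x) : R)}.
  by move=> x; rewrite inE DomE => /fg ->.
split.
- by apply: eq_measurable_fun mr; exact: E.
- by apply: eq_measurable_fun mi; exact: E.
- by apply: eq_integrable s => // x xD; rewrite (E (fun z => re z ^+ 2 + im z ^+ 2)).
Qed.

End L2.

(** * Derivatives relative to a closed interval *)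

Section calculus.
Context {R : realType}.
Implicit Types (a b : R) (f g : R -> R).

Lemma within_continuousP {X : pseudoMetricType R} (A : set X) (f : X -> R) :
  {within A, continuous f} <->
  forall x, A x -> forall e, 0 < e ->
    exists2 d, 0 < d & forall y, A y -> ball x d y -> `|f y - f x| <= e.
Proof.
rewrite subspace_continuousP; split => H x Ax.
  move=> e e0; have /cvgrPdist_le/(_ e e0) := H x Ax.
  rewrite near_withinE => /nbhs_ballP[d /= d0 sub]; exists d => // y Ay bxy.
  by rewrite distrC; exact: sub.
apply/cvgrPdist_le => e e0; have [d d0 sub] := H x Ax e e0.
rewrite near_withinE; apply/nbhs_ballP; exists d => // y bxy Ay.
by rewrite distrC; exact: sub.
Qed.

Lemma within_itv_continuousP a b f :
  {within `[a, b], continuous f} <->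
  forall x : R, a <= x <= b -> forall e, 0 < e ->
    exists2 d, 0 < d & forall y, a <= y <= b -> `|y - x| < d -> `|f y - f x| <= e.
Proof.
rewrite within_continuousP; split=> H x xab e e0.
  have [|d d0 Hd] := H x _ e e0; first by rewrite /= in_itv.
  exists d => // y yab yx; apply: Hd; first by rewrite /= in_itv.
  by rewrite /ball /= distrC.
have [|d d0 Hd] := H x _ e e0; first by move: xab; rewrite /= in_itv.
exists d => // y; rewrite /= in_itv /= => yab yx; apply: Hd => //.
by rewrite distrC.
Qed.

Lemma near_dnbhs_itvP a b x (P : set R) :
  (\forall y \near within `[a, b] x^', P y) <->
  exists2 d, 0 < d &
    forall y, a <= y <= b -> y != x -> `|y - x| < d -> P y.
Proof.
rewrite near_withinE near_withinE; split.
  move=> /nbhs_ballP[d /= d0 sub]; exists d => // y yab yx xy.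
  by apply: sub => //=; rewrite ?in_itv //= /ball /= distrC.
move=> [d d0 H]; apply/nbhs_ballP; exists d => // y bxy yx.
by rewrite /= in_itv /= => yab; apply: H => //; rewrite distrC.
Qed.

(** A Frechet form of the derivative, free of quotients: it makes sense at the
    end points of the interval and at y = x. *)
Definition has_der a b f x d := forall e, 0 < e -> exists2 r, 0 < r &
  forall y, a <= y <= b -> `|y - x| < r ->
    `|f y - f x - (y - x) * d| <= e * `|y - x|.

Lemma derivable_has_der a b f x :
  derivable_at a b f x -> has_der a b f x (der a b f x).
Proof.
move=> df e e0; have /cvgrPdist_le/(_ e e0) : diff_quot f x y @[y --> within `[a, b] x^'] --> der a b f x.
  exact: df.
move=> /near_dnbhs_itvP[d d0 H]; exists d => // y yab yx.
have [->|nyx] := eqVneq y x; first by rewrite !subrr mul0r subr0 normr0 mulr0.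
have := H y yab nyx yx; rewrite /diff_quot => {}H.
have yx0 : y - x != 0 by rewrite subr_eq0.
have -> : f y - f x - (y - x) * der a b f x =
   - (der a b f x - (f y - f x) / (y - x)) * (y - x) by field.
by rewrite normrM normrN ler_wpM2r.
Qed.

Lemma has_der_derivable a b f x d : has_der a b f x d ->
  diff_quot f x y @[y --> within `[a, b] x^'] --> d.
Proof.
move=> df; apply/cvgrPdist_le => e e0; apply/near_dnbhs_itvP.
have [r r0 H] := df e e0; exists r => // y yab nyx yx.
have yx0 : y - x != 0 by rewrite subr_eq0.
have := H y yab yx; rewrite /diff_quot.
have -> : f y - f x - (y - x) * d = (f y - f x) / (y - x) * (y - x) - d * (y - x) by field.
by rewrite -mulrBl normrM ler_pM2r ?normr_gt0// distrC.
Qed.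

Lemma dnbhs_itv_proper a b x : a < b -> a <= x <= b ->
  ProperFilter (within `[a, b] x^').
Proof.
move=> ab /andP[ax xb]; split; last exact: within_filter.
move=> /near_dnbhs_itvP[d d0 H].
have [xb'|bx] := ltP x b.
  pose m := Num.min (d / 2) ((b - x)).
  have m0 : 0 < m by rewrite lt_min divr_gt0//= subr_gt0.
  have md : m <= d / 2 by rewrite ge_min lexx.
  have mb : m <= b - x by rewrite ge_min lexx orbT.
  by apply: (H (x + m)); [lra|rewrite gt_eqF// ltrDl|rewrite ger0_norm; lra].
pose m := Num.min (d / 2) ((x - a)).
have m0 : 0 < m by rewrite lt_min divr_gt0//= subr_gt0; lra.
have md : m <= d / 2 by rewrite ge_min lexx.
have mb : m <= x - a by rewrite ge_min lexx orbT.
apply: (H (x - m)); [lra|by rewrite lt_eqF// gtrBl|].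
by rewrite distrC ger0_norm; lra.
Qed.

Lemma has_der_der a b f x d : a < b -> a <= x <= b -> has_der a b f x d ->
  derivable_at a b f x /\ der a b f x = d.
Proof.
move=> ab xab /has_der_derivable H; have P := dnbhs_itv_proper ab xab.
by split; [apply/cvg_ex; exists d|exact/cvg_lim].
Qed.

Lemma has_der_is_derive a b f x d : a < x < b -> has_der a b f x d ->
  is_derive x 1 f d.
Proof.
move=> /andP[ax xb] H.
suff : h^-1 *: (f (h *: 1 + x) - f x) @[h --> 0^'] --> d.
  by move=> cv; split; [apply/cvg_ex; exists d|exact/cvg_lim].
apply/cvgrPdist_le => e e0; have [r r0 {}H] := H e e0.
rewrite near_withinE; apply/nbhs_ballP.
exists (Num.min r (Num.min (x - a) (b - x))) => /=.
  by rewrite !lt_min r0 !subr_gt0 ax.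
move=> h; rewrite /ball /= sub0r normrN !lt_min => /and3P[hr ha hb] h0.
have := H (h + x); rewrite addrK; have := ler_norm h; have := ler_norm (- h).
rewrite normrN => h1 h2 /(_ ltac:(lra) hr); rewrite [h *: 1]mulr1 => H'.
have -> : d - h^-1 *: (f (h + x) - f x) = - (f (h + x) - f x - h * d) / h.
  by rewrite /GRing.scale /=; field.
by rewrite normrM normrN normfV ler_pdivrMr ?normr_gt0.
Qed.

Lemma has_der_continuous a b f x d : has_der a b f x d ->
  forall e, 0 < e -> exists2 r, 0 < r & forall y, a <= y <= b -> `|y - x| < r ->
    `|f y - f x| <= e.
Proof.
move=> H e e0; have [r r0 {}H] := H 1 ltr01.
have K0 : 0 < 1 + `|d| by rewrite ltr_pwDl.
exists (Num.min r (e / (1 + `|d|))); first by rewrite lt_min r0 divr_gt0.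
move=> y yab; rewrite lt_min => /andP[yr ye].
have -> : f y - f x = (f y - f x - (y - x) * d) + (y - x) * d by ring.
rewrite (le_trans (ler_normD _ _))// normrM.
rewrite (le_trans (lerD (H y yab yr) (lexx _)))//.
by rewrite mulrC -mulrDr; move: ye; rewrite ltr_pdivlMr// => /ltW.
Qed.

Lemma has_der_within a b f df : (forall x, a <= x <= b -> has_der a b f x (df x)) ->
  {within `[a, b], continuous f}.
Proof.
by move=> H; apply/within_itv_continuousP => x xab; exact: has_der_continuous (H x xab).
Qed.

Lemma eq_has_der a b f g x d : a <= x <= b ->
  (forall y, a <= y <= b -> f y = g y) -> has_der a b f x d -> has_der a b g x d.
Proof.
move=> xab fg H e e0; have [r r0 {}H] := H e e0; exists r => // y yab yx.
by rewrite -!fg//; exact: H.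
Qed.

(** Differentiability is asked inside the interval only: the weight sqrt(t - s)
    of the energy argument is not differentiable at s = t. *)
Lemma nonincreasing_between f (df : R -> R) a b : a <= b ->
  (forall x, a < x < b -> is_derive x 1 f (df x)) ->
  (forall x, a < x < b -> df x <= 0) ->
  {within `[a, b], continuous f} -> f b <= f a.
Proof.
move=> ab D N c; apply: (@ler0_derive1_nincr _ f a b) => // x; rewrite in_itv /= => xab.
  by have [] := D x xab.
by have dx := D x xab; rewrite derive1E derive_val N.
Qed.

Lemma has_der_MVT f (df : R -> R) a b x y :
  a <= x <= b -> a <= y <= b -> 
  (forall z, a <= z <= b -> has_der a b f z (df z)) ->
  exists2 z, Num.min x y <= z <= Num.max x y & f y - f x = df z * (y - x).
Proof.
wlog xy : x y / x <= y.
  move=> H xab yab D; have [xy|/ltW yx] := leP x y.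
    by have [z Hz E] := H x y xy xab yab D; exists z => //; rewrite min_l ?max_r in Hz *.
  have [z Hz E] := H y x yx yab xab D; exists z; last by rewrite -opprB E; ring.
  by rewrite min_l // max_r // in Hz.
move=> xab yab D.
have D' z : z \in `]x, y[ -> is_derive z 1 f (df z).
  by rewrite in_itv /= => zxy; apply: (@has_der_is_derive a b); [lra|apply: D; lra].
have c : {within `[x, y], continuous f}.
  apply: continuous_subspaceW (has_der_within D) => z /=; rewrite !in_itv /=; lra.
have [z] := MVT_segment xy D' c.
by rewrite in_itv /= => zxy E; exists z => //; rewrite min_l // max_r.
Qed.

Lemma bounded_within a b f : a <= b -> {within `[a, b], continuous f} ->
  exists2 K, 0 <= K & forall x, a <= x <= b -> `|f x| <= K.
Proof.
move=> ab cf; have cn : {within `[a, b], continuous (fun x => `|f x|)}.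
  apply/within_itv_continuousP => x xab e e0.
  have [d d0 H] := (within_itv_continuousP a b f).1 cf x xab e e0.
  by exists d => // y yab yx; rewrite (le_trans (ler_dist_dist _ _))// H.
by have [c _ Hc] := EVT_max ab cn; exists `|f c|.
Qed.

End calculus.

(** * Weak derivatives of real functions *)

Section unit_interval_integrals.
Context {R : realType}.
Local Notation C := R[i].
Local Notation leb := (@lebesgue_measure R).
Local Notation D := (@Dom R).
Implicit Types (p q v w f : R -> R).
#[local] Hint Resolve measurable_Dom : core.

Lemma within_int p : {within `[0, 1], continuous p} ->
  leb.-integrable `[0, 1] (EFin \o p).
Proof. by move=> cp; apply: continuous_compact_integrable => //; exact: segment_compact. Qed.

Lemma Dom_sub : D `<=` `[0, 1].
Proof. by move=> x; rewrite DomE /= in_itv /=; lra. Qed.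

Lemma within_int_on_D p : {within `[0, 1], continuous p} -> int_on_D p.
Proof.
by move=> /within_int; apply: integrableS => //; exact: Dom_sub.
Qed.

Lemma within_mul p q (A : set R) : {within A, continuous p} ->
  {within A, continuous q} -> {within A, continuous (fun x => p x * q x)}.
Proof. by move=> cp cq x; apply: cvgM; [exact: cp|exact: cq]. Qed.

Lemma within_add p q (A : set R) : {within A, continuous p} ->
  {within A, continuous q} -> {within A, continuous (fun x => p x + q x)}.
Proof. by move=> cp cq x; apply: cvgD; [exact: cp|exact: cq]. Qed.

Lemma within_square_int p : {within `[0, 1], continuous p} -> square_int p.
Proof.
move=> cp; split.
  apply/measurable_EFinP; apply: (measurable_int leb); exact: within_int_on_D.
by apply: (@within_int_on_D (fun x => p x * p x)); exact: within_mul.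
Qed.

Lemma Rint_Dcc p : leb.-integrable `[0, 1] (EFin \o p) ->
  \int[leb]_(x in D) p x = \int[leb]_(x in `[0, 1]) p x.
Proof.
move=> ip; rewrite /Dom Rintegral_itv_obnd_cbnd.
  rewrite Rintegral_itv_bndo_bndc//.
  by apply: integrableS ip => // x; rewrite /= !in_itv /=; lra.
by apply: integrableS ip => // x; rewrite /= !in_itv /=; lra.
Qed.

Lemma has_der_LR (a b : R) f (df : R -> R) : a < b ->
  (forall x, a <= x <= b -> has_der a b f x (df x)) ->
  derivable_oo_LRcontinuous f a b /\ {in `]a, b[, derive1 f =1 df}.
Proof.
move=> ab H.
have H' x : x \in `]a, b[ -> is_derive x 1 f (df x).
  by rewrite in_itv /= => xab; apply: (@has_der_is_derive _ a b) => //; apply: H; lra.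
have [_ ca cb] := (continuous_within_itvP f ab).1 (has_der_within H).
split; first by split => // x /H' [].
by move=> x /H' [_ <-]; rewrite derive1E.
Qed.

Lemma int_by_parts f (df : R -> R) g (dg : R -> R) :
  (forall x, 0 <= x <= 1 -> has_der 0 1 f x (df x)) -> {within `[0, 1], continuous df} ->
  (forall x, 0 <= x <= 1 -> has_der 0 1 g x (dg x)) -> {within `[0, 1], continuous dg} ->
  \int[leb]_(x in D) (f x * dg x) =
  f 1 * g 1 - f 0 * g 0 - \int[leb]_(x in D) (df x * g x).
Proof.
move=> Hf cf Hg cg.
have [f1 f2] := has_der_LR ltr01 Hf; have [g1 g2] := has_der_LR ltr01 Hg.
rewrite Rint_Dcc; last exact/within_int/within_mul/cg/has_der_within/Hf.
rewrite (Rintegration_by_parts ltr01 cf f1 f2 cg g1 g2) [in RHS]Rint_Dcc//.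
by apply: within_int; apply: within_mul => //; exact: has_der_within Hg.
Qed.

Lemma is_derive_has_der (a b : R) f (x d : R) : is_derive x 1 f d -> has_der a b f x d.
Proof.
move=> [df dE] e e0.
have : h^-1 *: (f (h *: 1 + x) - f x) @[h --> 0^'] --> d by rewrite -dE; exact: df.
move/cvgrPdist_le/(_ e e0); rewrite near_withinE => /nbhs_ballP[r /= r0 H].
exists r => // y yab yx; have [->|nyx] := eqVneq y x.
  by rewrite !subrr mul0r subr0 normr0 mulr0.
have yx0 : y - x != 0 by rewrite subr_eq0.
have := H (y - x); rewrite /ball /= sub0r normrN [(y - x) *: 1]mulr1 subrK.
move=> /(_ yx yx0) {}H.
have -> : f y - f x - (y - x) * d = - (d - (y - x)^-1 *: (f y - f x)) * (y - x).
  by rewrite /GRing.scale /=; field.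
by rewrite normrM normrN ler_wpM2r.
Qed.

Lemma FTC_unit f (df : R -> R) :
  (forall x, 0 <= x <= 1 -> has_der 0 1 f x (df x)) -> {within `[0, 1], continuous df} ->
  \int[leb]_(x in D) df x = f 1 - f 0.
Proof.
move=> Hf cf; have [f1 f2] := has_der_LR ltr01 Hf.
rewrite Rint_Dcc; last exact: within_int.
by rewrite /Rintegral (continuous_FTC2 ltr01 cf f1 f2) -EFinB.
Qed.

End unit_interval_integrals.

Section weak_derivative.
Context {R : realType}.
Local Notation C := R[i].
Local Notation leb := (@lebesgue_measure R).
Local Notation D := (@Dom R).
Implicit Types (p q v w f : R -> R) (phi : R -> R).
#[local] Hint Resolve measurable_Dom : core.

(** Complex weak derivatives are pairs of these, because test functions are
    real; so the analysis of weak derivatives is done for real functions. *)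
Definition rweak v w := forall phi, test_fun phi ->
  \int[leb]_(x in D) (v x * derive1 phi x) = - \int[leb]_(x in D) (w x * phi x).

Lemma test_fun_der phi (x : R) : test_fun phi -> is_derive x 1 phi (derive1 phi x).
Proof. by move=> [d _ _]; rewrite derive1E; exact: derivableP. Qed.

Lemma test_fun_has_der phi (x : R) : test_fun phi -> has_der 0 1 phi x (derive1 phi x).
Proof. by move=> t; exact/is_derive_has_der/test_fun_der. Qed.

Lemma test_fun_square_int phi : test_fun phi ->
  square_int phi /\ square_int (derive1 phi).
Proof.
move=> t; split; apply: within_square_int.
  by apply: has_der_within => x _; exact: test_fun_has_der.
by apply: continuous_subspaceT; case: t.
Qed.

Lemma test_fun_ends phi : test_fun phi -> phi 0 = 0 /\ phi 1 = 0.
Proof. by move=> [_ _ [a [b [a0 b1 z]]]]; split; apply: z; apply/negP; lra. Qed.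

Lemma classical_rweak f (df : R -> R) :
  (forall x, 0 <= x <= 1 -> has_der 0 1 f x (df x)) ->
  {within `[0, 1], continuous df} -> rweak f df.
Proof.
move=> Hf cf phi t; rewrite (int_by_parts (df := df) (g := phi) (dg := derive1 phi))//.
- by have [-> ->] := test_fun_ends t; ring.
- by move=> x _; exact: test_fun_has_der.
- by apply: continuous_subspaceT; case: t.
Qed.

Lemma rweakDZ (c : R) v1 w1 v2 w2 : square_int v1 -> square_int w1 ->
  square_int v2 -> square_int w2 -> rweak v1 w1 -> rweak v2 w2 ->
  rweak (fun x => c * v1 x + v2 x) (fun x => c * w1 x + w2 x).
Proof.
move=> sv1 sw1 sv2 sw2 H1 H2 phi t; have [sp sd] := test_fun_square_int t.
transitivity (c * \int[leb]_(x in D) (v1 x * derive1 phi x) +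
  \int[leb]_(x in D) (v2 x * derive1 phi x)).
  rewrite -RintegralZl//; last exact: square_int_mul.
  rewrite -RintegralD//; [|exact/int_on_DZ/square_int_mul|exact: square_int_mul].
  by apply: eq_Rintegral => x _; ring.
rewrite H1// H2// mulrN -opprD; congr (- _).
rewrite -RintegralZl//; last exact: square_int_mul.
rewrite -RintegralD//; [|exact/int_on_DZ/square_int_mul|exact: square_int_mul].
by apply: eq_Rintegral => x _; ring.
Qed.

(** Test functions vanish near the end points of [0, 1], so the product is C1 on
    the whole line. *)
Lemma test_fun_mul p (dp : R -> R) phi :
  (forall x, 0 <= x <= 1 -> has_der 0 1 p x (dp x)) ->
  {within `[0, 1], continuous dp} -> test_fun phi ->
  test_fun (fun x => p x * phi x) /\
  derive1 (fun x => p x * phi x) = fun x => dp x * phi x + p x * derive1 phi x.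
Proof.
move=> Hp cdp t; have [d c [a [b [a0 b1 z]]]] := t.
have out x : ~~ (a <= x <= b) -> \forall y \near x, ~~ (a <= y <= b).
  move=> xab; have [xa|ax] := ltP x a.
    by apply: filterS (lt_nbhsl xa) => y ya; apply/negP; lra.
  have bx : b < x by move: xab; rewrite ax /= -ltNge.
  by apply: filterS (lt_nbhsr bx) => y ya; apply/negP; lra.
have outz x : ~~ (a <= x <= b) -> \forall y \near x, phi y = 0.
  by move=> /out; apply: filterS => y; exact: z.
have zero x : ~~ (a <= x <= b) -> dp x * phi x + p x * derive1 phi x = 0.
  move=> xab; rewrite z// mulr0 add0r; suff -> : derive1 phi x = 0 by rewrite mulr0.
  by rewrite derive1E (near_eq_derive (g := cst 0) _ (outz x xab)) ?derive_cst ?oner_eq0.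
have D1 (x : R) : is_derive x 1 (fun x => p x * phi x) (dp x * phi x + p x * derive1 phi x).
  have [xab|xab] := boolP (a <= x <= b).
    have px : is_derive x 1 p (dp x).
      by apply: (@has_der_is_derive _ 0 1); [lra|apply: Hp; lra].
    have phix := test_fun_der x t.
    have := is_deriveM px phix; rewrite /GRing.scale /= addrC.
    by rewrite [phi x * dp x]mulrC.
  rewrite zero//; apply: (near_eq_is_derive (f := cst 0)) => //.
  by apply: filterS (outz x xab) => y ->; rewrite mulr0.
have E : derive1 (fun x => p x * phi x) = fun x => dp x * phi x + p x * derive1 phi x.
  by apply/funext => x; have Dx := D1 x; rewrite derive1E derive_val.
split; last exact: E.
split.
- by move=> x; have [] := D1 x.
- rewrite E => x; have [xab|xab] := boolP (a <= x <= b).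
    have px : {for x, continuous p}.
      apply/differentiable_continuous/derivable1_diffP.
      by have [] : is_derive (x : R) 1 p (dp x);
        [apply: (@has_der_is_derive _ 0 1); [lra|apply: Hp; lra]|].
    have dpx : {for x, continuous dp}.
      have [+ _ _] := (continuous_within_itvP dp ltr01).1 cdp.
      by apply; rewrite in_itv /=; lra.
    have phix : {for x, continuous phi}.
      by apply/differentiable_continuous/derivable1_diffP; exact: d.
    by apply: cvgD; apply: cvgM => //; exact: c.
  rewrite /continuous_at zero//; apply/cvgrPdist_le => e e0.
  by apply: filterS (out x xab) => y oy; rewrite zero// subrr normr0 ltW.
- by exists a, b; split => // x /z ->; rewrite mulr0.
Qed.

(** The factor p is moved onto the test function by test_fun_mul. *)
Lemma rweak_mul p (dp : R -> R) v w :
  (forall x, 0 <= x <= 1 -> has_der 0 1 p x (dp x)) ->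
  {within `[0, 1], continuous dp} -> square_int v -> square_int w -> rweak v w ->
  rweak (fun x => p x * v x) (fun x => dp x * v x + p x * w x).
Proof.
move=> Hp cdp sv sw H phi t; have [t' E] := test_fun_mul Hp cdp t.
have := H _ t'; rewrite E.
have [sp sd] := test_fun_square_int t.
have cp := has_der_within Hp.
have s1 : square_int (fun x => dp x * phi x).
  apply: within_square_int; apply: within_mul => //.
  by apply: has_der_within => x _; exact: test_fun_has_der.
have s2 : square_int (fun x => p x * derive1 phi x).
  apply: within_square_int; apply: within_mul => //.
  by apply: continuous_subspaceT; case: t.
have s3 : square_int (fun x => p x * phi x).
  by have [] := test_fun_square_int t'.
have -> : \int[leb]_(x in D) (v x * (dp x * phi x + p x * derive1 phi x)) =
   \int[leb]_(x in D) (v x * (dp x * phi x)) +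
   \int[leb]_(x in D) (v x * (p x * derive1 phi x)).
  rewrite -RintegralD//; [|exact: square_int_mul..].
  by apply: eq_Rintegral => x _; ring.
have -> : \int[leb]_(x in D) ((dp x * v x + p x * w x) * phi x) =
   \int[leb]_(x in D) (v x * (dp x * phi x)) +
   \int[leb]_(x in D) (w x * (p x * phi x)).
  rewrite -RintegralD//; [|exact: square_int_mul..].
  by apply: eq_Rintegral => x _; ring.
have -> : \int[leb]_(x in D) (p x * v x * derive1 phi x) =
   \int[leb]_(x in D) (v x * (p x * derive1 phi x)).
  by apply: eq_Rintegral => x _; ring.
by move=> h; rewrite opprD -h; ring.
Qed.

End weak_derivative.

(** * The fundamental theorem of calculus for weak derivatives *)

Section smooth_steps.
Context {R : realType}.
Local Notation leb := (@lebesgue_measure R).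
Local Notation D := (@Dom R).
#[local] Hint Resolve measurable_Dom : core.

Definition pos_part (y : R) := Num.max 0 y.

Lemma pos_sq_der (y : R) : is_derive y 1 (fun y => pos_part y ^+ 2) (2 * pos_part y).
Proof.
apply: (@has_der_is_derive _ (y - 1) (y + 1)); first by lra.
move=> e e0; exists e => // z _ zy.
have -> : pos_part z ^+ 2 - pos_part y ^+ 2 - (z - y) * (2 * pos_part y) =
   (pos_part z - pos_part y) ^+ 2 + 2 * pos_part y * (pos_part z - z - (pos_part y - y)).
  by ring.
suff H : `|(pos_part z - pos_part y) ^+ 2 + 2 * pos_part y * (pos_part z - z - (pos_part y - y))| <= `|z - y| ^+ 2.
  by apply: (le_trans H); rewrite expr2 ler_wpM2r// ltW.
rewrite real_normK ?num_real// ger0_norm /pos_part.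
  have h1 := sqr_ge0 z; have h2 := sqr_ge0 y; have h3 := sqr_ge0 (z - y).
  case: (leP 0 z) => ?; case: (leP 0 y) => ?; [nra|nra| |nra].
  by rewrite -subr_ge0 [leRHS](_ : _ = z ^+ 2); [|ring].
have h1 := sqr_ge0 z; have h2 := sqr_ge0 y; have h3 := sqr_ge0 (z - y).
case: (leP 0 z) => ?; case: (leP 0 y) => ?; [nra|nra| |nra].
have : 0 <= y * - z by rewrite mulr_ge0// oppr_ge0 ltW.
nra.
Qed.

(** A C1 quadratic spline rising from 0 at y = 0 to 1 at y = 2. *)
Definition step (y : R) :=
  2^-1 * (pos_part y ^+ 2 - 2 * pos_part (y - 1) ^+ 2 + pos_part (y - 2) ^+ 2).
Definition dstep (y : R) := pos_part y - 2 * pos_part (y - 1) + pos_part (y - 2).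

Lemma is_derive_affine (f : R -> R) (df c d x : R) : is_derive (c * x + d) 1 f df ->
  is_derive x 1 (fun x => f (c * x + d)) (c * df).
Proof.
move=> H.
have H1 : is_derive x 1 (fun x : R => c * x + d) c.
  by apply: is_derive_eq; rewrite /GRing.scale /=; ring.
have H2 := @is_derive1_comp _ f (fun x : R => c * x + d) x df c H H1.
by apply: is_derive_eq; rewrite mulrC.
Qed.

Lemma step_der (y : R) : is_derive y 1 step (dstep y).
Proof.
have H (c : R) : is_derive y 1 (fun y => pos_part (y - c) ^+ 2) (2 * pos_part (y - c)).
  have := @is_derive_affine (fun y => pos_part y ^+ 2) (2 * pos_part (y - c)) 1 (- c) y.
  rewrite !mul1r => /(_ (pos_sq_der _)).
  by under [X in is_derive _ _ X _]eq_fun do rewrite mul1r.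
have H0 := pos_sq_der y; have H1 := H 1; have H2 := H 2.
by rewrite /step; apply: is_derive_eq; rewrite /dstep /GRing.scale /=; field.
Qed.

Lemma step_le0 (y : R) : y <= 0 -> step y = 0.
Proof.
by move=> y0; rewrite /step /pos_part !max_l; [ring|lra..].
Qed.

Lemma step_ge2 (y : R) : 2 <= y -> step y = 1.
Proof.
by move=> y0; rewrite /step /pos_part !max_r; [field|lra..].
Qed.

Lemma step_itv (y : R) : 0 <= step y <= 1.
Proof.
rewrite /step /pos_part.
by case: (leP 0 y) => ?; case: (leP 0 (y - 1)) => ?; case: (leP 0 (y - 2)) => ?;
  apply/andP; split; nra.
Qed.

Lemma dstep_ge0 (y : R) : 0 <= dstep y.
Proof.
rewrite /dstep /pos_part.
by case: (leP 0 y) => ?; case: (leP 0 (y - 1)) => ?; case: (leP 0 (y - 2)) => ?; lra.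
Qed.

Lemma dstep_out (y : R) : ~~ (0 <= y <= 2) -> dstep y = 0.
Proof.
rewrite negb_and -!ltNge /dstep /pos_part => /orP[] ?.
  by rewrite !max_l; lra.
by rewrite !max_r; lra.
Qed.

Lemma pos_part_cont : continuous pos_part.
Proof.
move=> y; apply/cvgrPdist_le => e e0; near=> z.
have zy : `|y - z| <= e by near: z; exact: cvgr_dist_le.
apply: le_trans zy; rewrite /pos_part.
by case: (leP 0 z) => ?; case: (leP 0 y) => ?; rewrite ler_norml;
  have := ler_norm (y - z); have := ler_norm (z - y); rewrite (distrC z); lra.
Unshelve. all: by end_near. Qed.

Lemma dstep_cont : continuous dstep.
Proof.
move=> y; have H (c : R) : pos_part (z - c) @[z --> y] --> pos_part (y - c).
  apply: (@continuous_comp _ _ _ (fun z => z - c) pos_part); last exact: pos_part_cont.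
  by apply: cvgB; [exact: cvg_id|exact: cvg_cst].
apply: cvgD; last exact: H.
apply: cvgB; first exact: pos_part_cont.
by apply: cvgM; [exact: cvg_cst|exact: H].
Qed.

Variables (x0 e : R).
Hypothesis e_gt0 : 0 < e.

(** The step rises over [x0, x0 + 2 e]; as e tends to 0 its derivative becomes
    an approximate identity on the right of x0. *)
Definition ustep (x : R) := step (e^-1 * x + - (e^-1 * x0)).
Definition dustep (x : R) := e^-1 * dstep (e^-1 * x + - (e^-1 * x0)).

Lemma ustep_argE x : e^-1 * x + - (e^-1 * x0) = (x - x0) / e.
Proof. by ring. Qed.

Lemma ustep_der (x : R) : is_derive x 1 ustep (dustep x).
Proof. exact: is_derive_affine (step_der _). Qed.

Lemma dustep_cont : continuous dustep.
Proof.
move=> x; apply: cvgM; first exact: cvg_cst.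
apply: (@continuous_comp _ _ _ (fun x => e^-1 * x + - (e^-1 * x0)) dstep); last exact: dstep_cont.
by apply: cvgD; [apply: cvgM; [exact: cvg_cst|exact: cvg_id]|exact: cvg_cst].
Qed.

Lemma ustep_le x : x <= x0 -> ustep x = 0.
Proof.
by move=> h; rewrite /ustep ustep_argE step_le0// pmulr_lle0 ?invr_gt0// subr_le0.
Qed.

Lemma ustep_ge x : x0 + 2 * e <= x -> ustep x = 1.
Proof. by move=> h; rewrite /ustep ustep_argE step_ge2// ler_pdivlMr//; lra. Qed.

Lemma dustep_ge0 x : 0 <= dustep x.
Proof. by rewrite mulr_ge0 ?dstep_ge0// invr_ge0 ltW. Qed.

Lemma dustep_out x : ~~ (x0 <= x <= x0 + 2 * e) -> dustep x = 0.
Proof.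
move=> h; rewrite /dustep ustep_argE dstep_out ?mulr0//; apply: contra h.
by rewrite ler_pdivrMr// ler_pdivlMr//; lra.
Qed.

Lemma dustep_int : 0 < x0 -> x0 + 2 * e < 1 -> \int[leb]_(x in D) dustep x = 1.
Proof.
move=> h0 h1; rewrite (FTC_unit (f := ustep)).
- by rewrite ustep_ge ?(ltW h1)// ustep_le ?(ltW h0)// subr0.
- by move=> x _; exact/is_derive_has_der/ustep_der.
- exact/continuous_subspaceT/dustep_cont.
Qed.

End smooth_steps.

Section weak_FTC.
Context {R : realType}.
Local Notation C := R[i].
Local Notation leb := (@lebesgue_measure R).
Local Notation D := (@Dom R).
Implicit Types (v w : R -> R).
#[local] Hint Resolve measurable_Dom : core.

Lemma dustep_square_int (x0 e : R) : 0 < e -> square_int (dustep x0 e).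
Proof. by move=> e0; apply/within_square_int/continuous_subspaceT/dustep_cont. Qed.

(** The derivative of the step is nonnegative, has integral 1 and is supported in
    [x0, x0 + 2 e], where v is close to v x0. *)
Lemma bump_average v (x0 : R) : {within `[0, 1], continuous v} -> 0 < x0 < 1 ->
  forall eta, 0 < eta -> exists2 d, 0 < d & forall e, 0 < e < d -> x0 + 2 * e < 1 ->
    `|\int[leb]_(x in D) (v x * dustep x0 e x) - v x0| <= eta.
Proof.
move=> cv /andP[x00 x01] eta eta0.
have [|d d0 H] := (within_itv_continuousP 0 1 v).1 cv x0 _ eta eta0; first by lra.
exists (d / 2); first by rewrite divr_gt0.
move=> e /andP[e0 ed] xe1.
have sv := within_square_int cv.
have sk := dustep_square_int x0 e0.
have ik : int_on_D (dustep x0 e).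
  by apply/within_int_on_D/continuous_subspaceT/dustep_cont.
have -> : v x0 = v x0 * \int[leb]_(x in D) dustep x0 e x.
  by rewrite dustep_int// mulr1.
rewrite -RintegralZl// -RintegralB//; [|exact: square_int_mul|exact: int_on_DZ].
have iB : int_on_D (fun x => v x * dustep x0 e x - v x0 * dustep x0 e x).
  by apply: int_on_DB; [exact: square_int_mul|exact: int_on_DZ].
apply: (le_trans (le_normr_Rintegral _ iB)) => //.
have -> : eta = \int[leb]_(x in D) (eta * dustep x0 e x).
  by rewrite RintegralZl// dustep_int// mulr1.
apply: le_Rintegral => //; [exact: integrable_norm|exact: int_on_DZ|].
move=> x; rewrite DomE => x01'.
rewrite -mulrBl normrM (ger0_norm (dustep_ge0 _ _ _))//.
have [xin|xout] := boolP (x0 <= x <= x0 + 2 * e); last by rewrite dustep_out// !mulr0.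
rewrite ler_wpM2r ?dustep_ge0//; apply: H; first by lra.
by rewrite ger0_norm; lra.
Qed.

Definition ind_le (z y : R) : R := (y <= z)%R%:R.

Lemma measurable_ind_le (z : R) : measurable_fun D (ind_le z).
Proof.
have -> : ind_le z = \1_`]-oo, z].
  by apply/funext => y; rewrite /ind_le indicE; congr (_%:R); rewrite mem_setE in_itv.
exact: measurable_indic.
Qed.

(** Test with the difference of the steps at x0 and at x1. Its derivative
    averages v near these points, while the test function itself tends to the
    indicator function of the interval between them. *)
Lemma weak_FTC_interior v w (x0 x1 : R) : {within `[0, 1], continuous v} ->
  int_on_D w -> rweak v w -> 0 < x0 -> x0 < x1 -> x1 < 1 ->
  v x1 - v x0 = \int[leb]_(y in D) (w y * (ind_le x1 y - ind_le x0 y)).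
Proof.
move=> cv iw H x00 x0x1 x11.
(* Widths at most c keep the support of the test function inside (0, 1). *)
pose c := (1 - x1) / 4.
have c0 : 0 < c by rewrite divr_gt0// subr_gt0.
pose e (n : nat) : R := c * n.+1%:R^-1.
have e0 n : 0 < e n by rewrite mulr_gt0// invr_gt0.
have ec n : e n <= c by rewrite ger_pMr// invf_le1// ler1n.
have e_cvg : e n @[n --> \oo] --> (0 : R).
  by rewrite -[X in _ --> X](mulr0 c); apply: cvgM; [exact: cvg_cst|exact: cvg_harmonic].
have x1e n : x1 + 2 * e n < 1.
  by have := ec n; rewrite /c; lra.
have x0e n : x0 + 2 * e n < 1 by have := x1e n; lra.
pose phi n x := ustep x0 (e n) x - ustep x1 (e n) x.
have phiD n (x : R) : is_derive x 1 (phi n) (dustep x0 (e n) x - dustep x1 (e n) x).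
  by apply: is_deriveB; exact: ustep_der.
have phiE n : derive1 (phi n) = fun x => dustep x0 (e n) x - dustep x1 (e n) x.
  by apply/funext => x; have Dx := phiD n x; rewrite derive1E derive_val.
have test n : test_fun (phi n).
  split.
  - by move=> x; have [] := phiD n x.
  - by rewrite phiE => x; apply: cvgB; exact: dustep_cont.
  - exists x0, (x1 + 2 * e n); split => // x.
    rewrite negb_and -!ltNge => /orP[xx0|xx1]; rewrite /phi.
      by rewrite (ustep_le (e0 n) (ltW xx0)) (ustep_le (e0 n) (ltW (lt_trans xx0 x0x1))) subrr.
    by rewrite (ustep_ge (e0 n)) ?(ustep_ge (e0 n)) ?subrr//; lra.
have sv := within_square_int cv.
have A n : \int[leb]_(x in D) (v x * derive1 (phi n) x) =
    \int[leb]_(x in D) (v x * dustep x0 (e n) x) -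
    \int[leb]_(x in D) (v x * dustep x1 (e n) x).
  rewrite -RintegralB//; [|exact/square_int_mul/dustep_square_int..].
  by apply: eq_Rintegral => x _; rewrite phiE; ring.
have lim1 z : 0 < z < 1 -> (forall n, z + 2 * e n < 1) ->
    \int[leb]_(x in D) (v x * dustep z (e n) x) @[n --> \oo] --> v z.
  move=> z01 ze; apply/cvgrPdist_le => eta eta0.
  have [d d0 Hd] := bump_average cv z01 eta0.
  have /cvgrPdist_lt/(_ d d0) := e_cvg.
  apply: filterS => n; rewrite sub0r normrN ger0_norm ?(ltW (e0 n))// => end_.
  by rewrite distrC; apply: Hd => //; rewrite e0.
have LA : \int[leb]_(x in D) (v x * derive1 (phi n) x) @[n --> \oo] --> v x0 - v x1.
  rewrite (_ : (fun n => _) = fun n => \int[leb]_(x in D) (v x * dustep x0 (e n) x) -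
    \int[leb]_(x in D) (v x * dustep x1 (e n) x)); last exact/funext.
  by apply: cvgB; apply: lim1 => //; lra.
have step_cvg z y : ustep z (e n) y @[n --> \oo] --> (1 - ind_le z y : R).
  rewrite /ind_le; have [yz|zy] := leP y z.
    rewrite subrr (_ : (fun n => _) = fun=> 0); first exact: cvg_cst.
    by apply/funext => n; rewrite ustep_le.
  rewrite subr0; apply/cvgrPdist_le => eta eta0.
  have yz2 : 0 < (y - z) / 2 by rewrite divr_gt0// subr_gt0.
  have /cvgrPdist_lt/(_ _ yz2) := e_cvg.
  apply: filterS => n; rewrite sub0r normrN ger0_norm ?(ltW (e0 n))// => en.
  by rewrite (ustep_ge (e0 n)) ?subrr ?normr0 ?(ltW eta0)//; lra.
have mw : measurable_fun D w by apply/measurable_EFinP; exact: (measurable_int leb iw).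
have [|||||] := @dominated_convergence _ _ R leb D (measurable_Dom)
    (fun n => EFin \o (fun x => w x * phi n x))
    (EFin \o (fun x => w x * (ind_le x1 x - ind_le x0 x)))
    (EFin \o (fun x => `|w x|)).
- move=> n; apply/measurable_EFinP; apply: measurable_funM => //.
  by have [[]] := test_fun_square_int (test n).
- apply/measurable_EFinP; apply: measurable_funM => //.
  by apply: measurable_funB; exact: measurable_ind_le.
- apply: aeW => x _ /=; apply: cvg_EFin; first by apply: nearW.
  apply: cvgM; first exact: cvg_cst.
  rewrite (_ : _ - _ = (1 - ind_le x0 x) - (1 - ind_le x1 x)); last by ring.
  by apply: cvgB; exact: step_cvg.
- exact: integrable_norm iw.
- apply: aeW => x n _ /=; rewrite lee_fin normrM ler_piMr// /phi.
  have := step_itv ((e n)^-1 * x + - ((e n)^-1 * x0)).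
  have := step_itv ((e n)^-1 * x + - ((e n)^-1 * x1)).
  by rewrite /ustep /= ler_norml; lra.
move=> iW _ LB.
have {}LB : \int[leb]_(x in D) (w x * phi n x) @[n --> \oo] -->
   \int[leb]_(x in D) (w x * (ind_le x1 x - ind_le x0 x)).
  apply: fine_cvg; rewrite /Rintegral fineK; first exact: LB.
  exact: integrable_fin_num.
have LA' : \int[leb]_(x in D) (v x * derive1 (phi n) x) @[n --> \oo] -->
   - \int[leb]_(x in D) (w x * (ind_le x1 x - ind_le x0 x)).
  rewrite (_ : (fun n => _) = fun n => - \int[leb]_(x in D) (w x * phi n x)).
    exact: cvgN.
  by apply/funext => n; exact: H.
have E := cvg_unique (@Rhausdorff R) LA LA'.
by rewrite -opprB E opprK.
Qed.

Lemma int_ind_leE w (x : R) :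
  \int[leb]_(y in D) (w y * ind_le x y) = \int[leb]_(y in `[0, x]) (w \_ D) y.
Proof.
rewrite Rintegral_mkcond [RHS]Rintegral_mkcond; apply: eq_Rintegral => y _.
have yxE : (y \in (`[0, x]%classic : set R)) = (0 <= y <= x) by rewrite mem_setE in_itv.
rewrite !patchE yxE /ind_le; case: (boolP (y \in D)) => [|_]; last by case: ifP.
rewrite inE DomE => /andP[/ltW -> _] /=.
by case: (leP y x); rewrite ?mulr1 ?mulr0.
Qed.

Lemma int_on_D_patch w (A : set R) : measurable (A : set (measurableTypeR R)) ->
  int_on_D w -> leb.-integrable A (EFin \o (w \_ D)).
Proof.
move=> mA iw; apply: (@integrableS _ _ _ leb setT) => //.
by rewrite -restrict_EFin; apply/(integrable_mkcond _ measurable_Dom).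
Qed.

Lemma int_ind_le_cont w : int_on_D w ->
  {within `[0, 1], continuous (fun x => \int[leb]_(y in D) (w y * ind_le x y))}.
Proof.
move=> iw; under [X in continuous X]eq_fun do rewrite int_ind_leE.
by apply: parameterized_integral_continuous => //; exact: int_on_D_patch.
Qed.

Lemma const_closure (g : R -> R) (c : R) : {within `[0, 1], continuous g} ->
  (forall x, 0 < x < 1 -> g x = c) -> forall x, 0 <= x <= 1 -> g x = c.
Proof.
move=> cg gc x x01; apply/eqP; rewrite -subr_eq0 -normr_eq0.
rewrite eq_le normr_ge0 andbT; apply/ler_addgt0Pr => e e0; rewrite add0r.
have [d d0 H] := (within_itv_continuousP 0 1 g).1 cg x x01 e e0.
pose m := Num.min (d / 2) (1 / 2).
have m0 : 0 < m by rewrite lt_min !divr_gt0.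
have md : m <= d / 2 by rewrite ge_min lexx.
have mh : m <= 1 / 2 by rewrite ge_min lexx orbT.
pose y := if x <= 1 / 2 then x + m / 2 else x - m / 2.
have y01 : 0 < y < 1 by rewrite /y; case: (leP x (1 / 2)) => ?; lra.
have yx : `|y - x| < d.
  by rewrite /y; case: (leP x (1 / 2)) => ?; rewrite addrAC subrr add0r ?normrN ger0_norm; lra.
rewrite distrC -(gc y y01); apply: H => //; lra.
Qed.

(** The lemma of du Bois-Reymond in integrated form. Both sides are continuous in
    x, so weak_FTC_interior extends to the end points. *)
Lemma weak_FTC v w : {within `[0, 1], continuous v} -> int_on_D w -> rweak v w ->
  forall x, 0 <= x <= 1 -> v x - v 0 = \int[leb]_(y in D) (w y * ind_le x y).
Proof.
move=> cv iw H.
pose W x := \int[leb]_(y in D) (w y * ind_le x y).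
have cW : {within `[0, 1], continuous W} := int_ind_le_cont iw.
have iwx x : int_on_D (fun y => w y * ind_le x y).
  apply: (le_integrable _ _ _ iw) => //.
    apply/measurable_EFinP/measurable_funM; last exact: measurable_ind_le.
    by apply/measurable_EFinP; exact: (measurable_int leb iw).
  move=> y _ /=; rewrite lee_fin normrM ler_piMr// /ind_le.
  by case: (y <= x)%R; rewrite ?normr1 ?normr0.
have diff x0 x1 : 0 < x0 -> x0 < x1 -> x1 < 1 -> v x1 - W x1 = v x0 - W x0.
  move=> h1 h2 h3; have := weak_FTC_interior cv iw H h1 h2 h3.
  under eq_Rintegral do rewrite mulrBr.
  rewrite RintegralB//; [|exact: iwx..].
  by rewrite -/(W x1) -/(W x0); lra.
have cst x : 0 < x < 1 -> v x - W x = v 2^-1 - W 2^-1.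
  move=> /andP[x0 x1].
  by have [xh|hx|->//] := ltgtP x 2^-1; [rewrite -(diff x 2^-1)//|apply: diff => //]; lra.
have cg : {within `[0, 1], continuous (fun x => v x - W x)}.
  by move=> x; apply: cvgB; [exact: cv|exact: cW].
have all := const_closure cg cst.
have W0 : W 0 = 0.
  rewrite /W (eq_Rintegral _ (g := fun=> 0)) ?Rintegral_cst ?mul0r//.
  by move=> y; rewrite inE DomE /ind_le => /andP[y0 _]; rewrite leNgt y0 mulr0.
move=> x x01; rewrite -/(W x).
have := all x x01; have := all 0 ltac:(by rewrite lexx ler01); rewrite W0; lra.
Qed.

(** Such a w is a weak derivative of the zero function. By weak_FTC its primitive
    vanishes, and almost everywhere w is the derivative of its primitive. *)
Lemma weak_zero_ae w : int_on_D w ->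
  (forall phi, test_fun phi -> \int[leb]_(x in D) (w x * phi x) = 0) ->
  {ae leb, forall x, D x -> w x = 0}.
Proof.
move=> iw H.
have rw : rweak (fun=> 0) w.
  move=> phi t; rewrite H// oppr0 (eq_Rintegral _ (g := fun=> 0)) ?Rintegral_cst ?mul0r//.
  by move=> x _; rewrite mul0r.
have c0 : {within `[0, 1], continuous (cst 0 : R -> R)}.
  by move=> x; exact: cvg_cst.
have W0 x : 0 <= x <= 1 -> \int[leb]_(y in `[0, x]) (w \_ D) y = 0.
  by move=> x01; rewrite -int_ind_leE -(weak_FTC c0 iw rw x01) subrr.
have := @FTC1 R (w \_ D) (BLeft 0) (fun y => int_on_D_patch _ iw)
  (integrable_locally_restrict measurable_Dom iw).
move=> /(_ (fun=> measurable_itv _)).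
apply: filterS; first exact: (ae_filter_ringOfSetsType leb).
move=> x Hx Dx; have := Dx; rewrite DomE => /andP[x0 x1].
have [|_] := Hx; first by rewrite lte_fin.

rewrite patchE mem_set// => <-.
rewrite derive1E (near_eq_derive (g := cst 0)) ?derive_cst ?oner_eq0//.
near=> y; apply: W0; apply/andP; split; apply: ltW.
  by near: y; exact: lt_nbhsr.
by near: y; exact: lt_nbhsl.
Unshelve. all: by end_near. Qed.

End weak_FTC.

(** * The Sobolev space H1(0, 1) *)

Section sobolev.
Context {R : realType}.
Local Notation C := R[i].
Local Notation leb := (@lebesgue_measure R).
Local Notation D := (@Dom R).
Implicit Types (f g v w : R -> C).
#[local] Hint Resolve measurable_Dom : core.

Lemma square_int_int (p : R -> R) : square_int p -> int_on_D p.
Proof.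
move=> sp; have s1 : square_int (cst 1 : R -> R).
  by apply: within_square_int; move=> x; exact: cvg_cst.
by have := square_int_mul s1 sp; apply: eq_integrable => // x _ /=; rewrite mul1r.
Qed.

Lemma is_wderivP v w : is_wderiv v w <->
  [/\ L2 w, rweak (fun x => re (v x)) (fun x => re (w x)) &
      rweak (fun x => im (v x)) (fun x => im (w x))].
Proof.
have E (z : R -> C) (p : R -> R) : cintegral D (fun x => z x * (p x)%:C%C) =
    Complex (\int[leb]_(x in D) (re (z x) * p x)) (\int[leb]_(x in D) (im (z x) * p x)).
  by rewrite /cintegral; congr Complex; apply: eq_Rintegral => x _; rewrite !reimE; ring.
split=> [[Lw H]|[Lw Hr Hi]].
  by split => // phi t; have := H phi t; rewrite !E => -[].
by split => // phi t; rewrite !E Hr// Hi.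
Qed.

Lemma ae_andD (P Q : R -> Prop) : {ae leb, forall x, D x -> P x} ->
  {ae leb, forall x, D x -> Q x} -> {ae leb, forall x, D x -> P x /\ Q x}.
Proof.
move=> p q; have F := ae_filter_ringOfSetsType leb.
exact: (@filterS2 _ _ F _ _ _ (fun x hp hq Dx => conj (hp Dx) (hq Dx)) p q).
Qed.

Lemma ae_impl (P Q : R -> Prop) : (forall x, P x -> Q x) ->
  {ae leb, forall x, D x -> P x} -> {ae leb, forall x, D x -> Q x}.
Proof.
move=> PQ p; have F := ae_filter_ringOfSetsType leb.
by apply: (filterS _ p) => x hp /hp /PQ.
Qed.

Lemma rweak_unique (v w1 w2 : R -> R) : square_int w1 -> square_int w2 ->
  rweak v w1 -> rweak v w2 -> {ae leb, forall x, D x -> w1 x = w2 x}.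
Proof.
move=> s1 s2 H1 H2.
have iw : int_on_D (fun x => w1 x - w2 x).
  by apply: int_on_DB; exact: square_int_int.
have := weak_zero_ae iw; move=> /(_ _)/(ae_impl (fun x => @subr0_eq _ (w1 x) (w2 x))).
apply=> phi t; have [sp _] := test_fun_square_int t.
under eq_Rintegral do rewrite mulrBl.
rewrite RintegralB//; [|exact: square_int_mul..].
by apply/eqP; rewrite subr_eq0 -eqr_opp -H1// -H2.
Qed.

Lemma is_wderiv_unique v w1 w2 : is_wderiv v w1 -> is_wderiv v w2 -> ae_eqD w1 w2.
Proof.
move=> /is_wderivP[/L2P[r1 i1] R1 I1] /is_wderivP[/L2P[r2 i2] R2 I2].
have := ae_andD (rweak_unique r1 r2 R1 R2) (rweak_unique i1 i2 I1 I2).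
by apply: ae_impl => x [? ?]; exact: complex_ext.
Qed.

Lemma wderivP v w : is_wderiv v w -> is_wderiv v (wderiv v).
Proof. by move=> H; apply: (@xgetPex _ _ [set w | is_wderiv v w]); exists w. Qed.

Lemma wderiv_ae v w : is_wderiv v w -> ae_eqD (wderiv v) w.
Proof. by move=> H; exact: is_wderiv_unique (wderivP H) H. Qed.

Lemma is_wderiv_L2 v w : is_wderiv v w -> L2 w.
Proof. by case. Qed.

Lemma norm2_wderiv v w : is_wderiv v w -> norm2 (wderiv v) = norm2 w.
Proof.
move=> H; apply: norm2_ae (wderiv_ae H); [exact/is_wderiv_L2/wderivP/H|exact: is_wderiv_L2 H].
Qed.

Lemma is_wderiv_ext f g w : L2 f -> L2 g -> ae_eqD f g -> is_wderiv f w -> is_wderiv g w.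
Proof.
move=> Lf Lg fg /is_wderivP[Lw Hr Hi]; apply/is_wderivP.
have [fr fi] := (L2P f).1 Lf; have [gr gi] := (L2P g).1 Lg.
split => // phi t; have [_ sd] := test_fun_square_int t.
  rewrite -Hr//; symmetry.
  apply: (ae_eqD_part (P := fun a b => re a * re b) (h := fun x => (derive1 phi x)%:C%C) fg).
    by apply/measurable_EFinP; apply: (measurable_int leb); exact: square_int_mul fr sd.
  by apply/measurable_EFinP; apply: (measurable_int leb); exact: square_int_mul gr sd.
rewrite -Hi//; symmetry.
apply: (ae_eqD_part (P := fun a b => im a * re b) (h := fun x => (derive1 phi x)%:C%C) fg).
  by apply/measurable_EFinP; apply: (measurable_int leb); exact: square_int_mul fi sd.
by apply/measurable_EFinP; apply: (measurable_int leb); exact: square_int_mul gi sd.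
Qed.

Lemma ae_eqD_sym f g : ae_eqD f g -> ae_eqD g f.
Proof. by apply: ae_impl => x. Qed.

(** The same set of weak derivatives is given to the choice operator, so the
    results are equal, not only almost everywhere; weak derivatives can thus be
    iterated after replacing a function by another representative. *)
Lemma wderiv_ext f g : L2 f -> L2 g -> ae_eqD f g -> wderiv f = wderiv g.
Proof.
move=> Lf Lg fg; rewrite /wderiv; congr xget; apply/seteqP; split => w /=.
  exact: is_wderiv_ext.
by apply: is_wderiv_ext => //; exact: ae_eqD_sym.
Qed.

Lemma is_wderiv_lin (c : C) f f' g g' : L2 f -> L2 g ->
  is_wderiv f f' -> is_wderiv g g' ->
  is_wderiv (fun x => c * f x + g x) (fun x => c * f' x + g' x).
Proof.
move=> Lf Lg /is_wderivP[Lf' Rf If] /is_wderivP[Lg' Rg Ig].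
have [fr fi] := (L2P f).1 Lf; have [gr gi] := (L2P g).1 Lg.
have [fr' fi'] := (L2P f').1 Lf'; have [gr' gi'] := (L2P g').1 Lg'.
apply/is_wderivP; split; first exact: L2_lin.
- have := rweakDZ (re c) fr fr' (square_intDZ (- im c) fi gr)
    (square_intDZ (- im c) fi' gr') Rf (rweakDZ (- im c) fi fi' gr gr' If Rg).
  by congr rweak; apply/funext => x; rewrite !reimE; ring.
- have := rweakDZ (re c) fi fi' (square_intDZ (im c) fr gi)
    (square_intDZ (im c) fr' gi') If (rweakDZ (im c) fr fr' gi gi' Rf Ig).
  by congr rweak; apply/funext => x; rewrite !reimE; ring.
Qed.

Definition cont01 f := continuous_on (`[0, 1]%classic : set R) f.

Lemma cont01_L2 f : cont01 f -> L2 f.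
Proof. by move=> [cr ci]; apply/L2P; split; exact: within_square_int. Qed.

Definition has_cder (a b : R) f x (d : C) :=
  has_der a b (fun y => re (f y)) x (re d) /\ has_der a b (fun y => im (f y)) x (im d).

Lemma has_cder_cont01 f (df : R -> C) :
  (forall x, 0 <= x <= 1 -> has_cder 0 1 f x (df x)) -> cont01 f.
Proof.
move=> H; split.
  by apply: (@has_der_within _ _ _ _ (fun x => re (df x))) => x /H [].
by apply: (@has_der_within _ _ _ _ (fun x => im (df x))) => x /H [].
Qed.

Lemma classical_wderiv f (df : R -> C) :
  (forall x, 0 <= x <= 1 -> has_cder 0 1 f x (df x)) -> cont01 df ->
  is_wderiv f df.
Proof.
move=> H cdf; have [cr ci] := cdf; apply/is_wderivP; split; first exact: cont01_L2.
- by apply: classical_rweak => // x /H [].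
- by apply: classical_rweak => // x /H [].
Qed.

Lemma square_int_mul_cont (q z : R -> R) : {within `[0, 1], continuous q} ->
  square_int z -> square_int (fun x => q x * z x).
Proof.
move=> cq [mz iz]; have [K K0 HK] := bounded_within ler01 cq.
have mq : measurable_fun D q.
  by apply/measurable_EFinP; apply: (measurable_int leb); exact: within_int_on_D.
split; first exact: measurable_funM.
apply: (le_integrable _ _ _ (int_on_DZ (K ^+ 2) iz)) => //.
  by apply/measurable_EFinP/measurable_funX/measurable_funM.
move=> x Dx /=; rewrite lee_fin.
have -> : `|(q x * z x) ^+ 2| = `|q x| ^+ 2 * z x ^+ 2.
  by rewrite normrX normrM exprMn (real_normK (num_real (z x))).
have -> : `|K ^+ 2 * z x ^+ 2| = K ^+ 2 * z x ^+ 2.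
  by rewrite ger0_norm// mulr_ge0// sqr_ge0.
rewrite ler_wpM2r ?sqr_ge0// lerXn2r ?nnegrE ?normr_ge0// HK//.
by move: Dx; rewrite DomE; lra.
Qed.

Lemma is_wderiv_mul p (dp : R -> C) v w :
  (forall x, 0 <= x <= 1 -> has_cder 0 1 p x (dp x)) -> cont01 dp ->
  L2 v -> is_wderiv v w ->
  is_wderiv (fun x => p x * v x) (fun x => dp x * v x + p x * w x).
Proof.
move=> H [cr ci] Lv /is_wderivP[Lw Rv Iv].
have [vr vi] := (L2P v).1 Lv; have [wr wi] := (L2P w).1 Lw.
have Hr x : 0 <= x <= 1 -> has_der 0 1 (fun y => re (p y)) x (re (dp x)) by move=> /H[].
have Hi x : 0 <= x <= 1 -> has_der 0 1 (fun y => im (p y)) x (im (dp x)) by move=> /H[].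
have bd (q z : R -> R) := @square_int_mul_cont q z.
have cpr : {within `[0, 1], continuous (fun x => re (p x))} by exact: has_der_within Hr.
have cpi : {within `[0, 1], continuous (fun x => im (p x))} by exact: has_der_within Hi.
have sum2 (a b : R -> R) : square_int a -> square_int b -> square_int (fun x => a x + b x).
  move=> sa sb; have := square_intDZ 1 sa sb.
  by congr square_int; apply/funext => x; rewrite mul1r.
have N (a : R -> R) : square_int a -> square_int (fun x => -1 * a x).
  move=> sa; have := square_intDZ (-1) sa (square_int0 (R := R)).
  by congr square_int; apply/funext => x; rewrite addr0.
have A1 := rweak_mul Hr cr vr wr Rv.
have A2 := rweak_mul Hi ci vi wi Iv.
have A3 := rweak_mul Hr cr vi wi Iv.
have A4 := rweak_mul Hi ci vr wr Rv.
apply/is_wderivP; split.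
- apply/L2P; split.
    have := sum2 _ _ (sum2 _ _ (bd _ _ cr vr) (N _ (bd _ _ ci vi)))
      (sum2 _ _ (bd _ _ cpr wr) (N _ (bd _ _ cpi wi))).
    by congr square_int; apply/funext => x; rewrite !reimE; ring.
  have := sum2 _ _ (sum2 _ _ (bd _ _ cr vi) (bd _ _ ci vr))
    (sum2 _ _ (bd _ _ cpr wi) (bd _ _ cpi wr)).
  by congr square_int; apply/funext => x; rewrite !reimE; ring.
- have := rweakDZ (-1) (bd _ _ cpi vi) (sum2 _ _ (bd _ _ ci vi) (bd _ _ cpi wi))
    (bd _ _ cpr vr) (sum2 _ _ (bd _ _ cr vr) (bd _ _ cpr wr)) A2 A1.
  by congr rweak; apply/funext => x; rewrite !reimE; ring.
- have := rweakDZ 1 (bd _ _ cpr vi) (sum2 _ _ (bd _ _ cr vi) (bd _ _ cpr wi))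
    (bd _ _ cpi vr) (sum2 _ _ (bd _ _ ci vr) (bd _ _ cpi wr)) A3 A4.
  by congr rweak; apply/funext => x; rewrite !reimE; ring.
Qed.

End sobolev.

Section H1_functions.
Context {R : realType}.
Local Notation C := R[i].
Local Notation leb := (@lebesgue_measure R).
Local Notation D := (@Dom R).
Implicit Types (f g v w : R -> C).
#[local] Hint Resolve measurable_Dom : core.

Lemma normc_reim (z : C) : normc z = Num.sqrt (re z ^+ 2 + im z ^+ 2).
Proof. by case: z. Qed.

Lemma normc_sqr (z : C) : normc z ^+ 2 = re z ^+ 2 + im z ^+ 2.
Proof. by rewrite normc_reim sqr_sqrtr// addr_ge0// sqr_ge0. Qed.

Lemma normc_ge0 (z : C) : 0 <= normc z.
Proof. by rewrite normc_reim sqrtr_ge0. Qed.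

Lemma normc_le (z : C) (c : R) : 0 <= c -> re z ^+ 2 + im z ^+ 2 <= c ^+ 2 -> normc z <= c.
Proof. by move=> c0 H; rewrite normc_reim -[c]ger0_norm// -sqrtr_sqr ler_wsqrtr. Qed.

Lemma normc_conj (z : C) : normc z^*%C = normc z.
Proof. by rewrite !normc_reim !reimE sqrrN. Qed.

Lemma normc_real (a : R) : normc (a%:C%C) = `|a|.
Proof. by rewrite normc_reim !reimE expr0n addr0 sqrtr_sqr. Qed.

Lemma re_le_normc (z : C) : `|re z| <= normc z.
Proof. by rewrite normc_reim -sqrtr_sqr ler_wsqrtr// lerDl sqr_ge0. Qed.

Lemma im_le_normc (z : C) : `|im z| <= normc z.
Proof. by rewrite normc_reim -sqrtr_sqr ler_wsqrtr// lerDr sqr_ge0. Qed.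

Lemma normcD (x y : C) : normc (x + y) <= normc x + normc y.
Proof. exact: le_normcD. Qed.

Lemma Hs1P v : Hs 1 v <-> L2 v /\ is_wderiv v (wderiv v).
Proof.
split=> [[Lv [w Hw _]]|[Lv H]]; first by split => //; exact: wderivP Hw.
by split => //; exists (wderiv v) => //; split => //; exact: is_wderiv_L2 H.
Qed.

Lemma Hs0S s v : Hs0 s.+1 v -> Hs0 1 v.
Proof.
move=> [[Lv [w Hw _]] c z]; split => //.
by split => //; exists w => //; split => //; exact: is_wderiv_L2 Hw.
Qed.

Lemma H1_L2 v : Hs0 1 v -> L2 v. Proof. by move=> [/Hs1P[]]. Qed.
Lemma H1_wd v : Hs0 1 v -> is_wderiv v (wderiv v). Proof. by move=> [/Hs1P[]]. Qed.
Lemma H1_L2w v : Hs0 1 v -> L2 (wderiv v).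
Proof. by move=> /H1_wd/is_wderiv_L2. Qed.
Lemma H1_cont v : Hs0 1 v -> cont01 v. Proof. by case. Qed.

Lemma cont01_lin (c : C) f g : cont01 f -> cont01 g -> cont01 (fun x => c * f x + g x).
Proof.
move=> [fr fi] [gr gi]; have K (a : R) (p : R -> R) : {within `[0, 1], continuous p} ->
    {within `[0, 1], continuous (fun x => a * p x)}.
  by move=> cp x; apply: cvgM; [exact: cvg_cst|exact: cp].
split.
  rewrite (_ : (fun x => _) = fun x => re c * re (f x) + ((- im c) * im (f x) + re (g x))).
    by apply: within_add; [exact: K|apply: within_add => //; exact: K].
  by apply/funext => x; rewrite !reimE; ring.
rewrite (_ : (fun x => _) = fun x => re c * im (f x) + (im c * re (f x) + im (g x))).
  by apply: within_add; [exact: K|apply: within_add => //; exact: K].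
by apply/funext => x; rewrite !reimE; ring.
Qed.

Lemma H1_lin (c : C) v w : Hs0 1 v -> Hs0 1 w -> Hs0 1 (fun x => c * v x + w x).
Proof.
move=> Hv Hw; split.
- apply/Hs1P; split; first by apply: L2_lin; exact: H1_L2.
  exact: wderivP (is_wderiv_lin c (H1_L2 Hv) (H1_L2 Hw) (H1_wd Hv) (H1_wd Hw)).
- by apply: cont01_lin; exact: H1_cont.
- by case: Hv => _ _ ->; case: Hw => _ _ ->; rewrite mulr0 addr0.
Qed.

Lemma H1Z (c : C) v : Hs0 1 v -> Hs0 1 (fun x => c * v x).
Proof.
move=> Hv; have := H1_lin (c - 1) Hv Hv; congr Hs0; apply/funext => x; ring.
Qed.

Lemma H1B v w : Hs0 1 v -> Hs0 1 w -> Hs0 1 (fun x => v x - w x).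
Proof.
by move=> Hv Hw; have := H1_lin (-1) Hw Hv; congr Hs0; apply/funext => x; ring.
Qed.

Lemma wderiv_lin_ae (c : C) v w : Hs0 1 v -> Hs0 1 w ->
  ae_eqD (wderiv (fun x => c * v x + w x)) (fun x => c * wderiv v x + wderiv w x).
Proof.
move=> Hv Hw; apply: wderiv_ae.
exact: is_wderiv_lin (H1_L2 Hv) (H1_L2 Hw) (H1_wd Hv) (H1_wd Hw).
Qed.

Lemma rip_wderiv_lin (c : C) v w g : Hs0 1 v -> Hs0 1 w -> L2 g ->
  rip (wderiv (fun x => c * v x + w x)) g =
  rip (fun x => c * wderiv v x + wderiv w x) g.
Proof.
move=> Hv Hw Lg; apply: rip_ae => //; last exact: wderiv_lin_ae.
  by apply: H1_L2w; exact: H1_lin.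
by apply: L2_lin; exact: H1_L2w.
Qed.

Lemma norm2_wderiv_lin (c : C) v w : Hs0 1 v -> Hs0 1 w ->
  norm2 (wderiv (fun x => c * v x + w x)) =
  norm2 (fun x => c * wderiv v x + wderiv w x).
Proof.
move=> Hv Hw; apply: norm2_ae; last exact: wderiv_lin_ae.
  by apply: H1_L2w; exact: H1_lin.
by apply: L2_lin; exact: H1_L2w.
Qed.

(** The real part of the form B. It determines B on a finite element space,
    which is stable under multiplication by i. *)
Definition eip v w := rip (wderiv v) (wderiv w).

Lemma eipE v w : eip v w = rip (wderiv v) (wderiv w). Proof. by []. Qed.

Lemma eipC v w : eip v w = eip w v. Proof. exact: ripC. Qed.

Lemma eip_linl (c : R) u v w : Hs0 1 u -> Hs0 1 v -> Hs0 1 w ->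
  eip (fun x => c%:C%C * u x + v x) w = c * eip u w + eip v w.
Proof.
move=> Hu Hv Hw; rewrite /eip rip_wderiv_lin//; last exact: H1_L2w.
by rewrite rip_linl//; exact: H1_L2w.
Qed.

Lemma eipBl u v w : Hs0 1 u -> Hs0 1 v -> Hs0 1 w ->
  eip (fun x => u x - v x) w = eip u w - eip v w.
Proof.
move=> Hu Hv Hw; have := eip_linl (-1) Hv Hu Hw; rewrite mulN1r addrC => <-.
have -> // : (fun x => u x - v x) = fun x => (-1)%:C%C * v x + u x.
by apply/funext => x; apply: complex_ext; rewrite !reimE; ring.
Qed.

Lemma is_wderivZ (c : C) v w : L2 v -> is_wderiv v w ->
  is_wderiv (fun x => c * v x) (fun x => c * w x).
Proof.
move=> Lv Hv; have := is_wderiv_lin (c - 1) Lv Lv Hv Hv.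
by congr is_wderiv; apply/funext => x; ring.
Qed.

Lemma eip_i u v : Hs0 1 u -> Hs0 1 v ->
  eip u (fun x => 'i%C * v x) = rip (wderiv u) (fun x => 'i%C * wderiv v x).
Proof.
move=> Hu Hv; rewrite eipC /eip [RHS]ripC; apply: rip_ae.
- by apply: H1_L2w; exact: H1Z.
- by apply: L2Z; exact: H1_L2w.
- exact: H1_L2w.
- by apply: wderiv_ae; apply: is_wderivZ; [exact: H1_L2|exact: H1_wd].
Qed.

Lemma re_Bform u v : re (Bform u v) = eip u v.
Proof. exact: re_inner. Qed.

Lemma im_Bform u v : Hs0 1 u -> Hs0 1 v ->
  im (Bform u v) = eip u (fun x => 'i%C * v x).
Proof. by move=> Hu Hv; rewrite eip_i// -im_inner. Qed.

Lemma int_cst (c : R) : \int[leb]_(y in D) c = c.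
Proof.
have D1 : leb D = 1%:E.
  by rewrite /Dom lebesgue_measure_itv /= lte_fin ltr01 oppr0 adde0.
transitivity (c * fine (leb D)); first exact: Rintegral_cst.
by rewrite [X in fine X]D1 mulr1.
Qed.

Lemma square_int_ind_le (x : R) : square_int (ind_le x).
Proof.
split; first exact: measurable_ind_le.
have i1 : int_on_D (cst 1 : R -> R).
  by apply: within_int_on_D; move=> y; exact: cvg_cst.
apply: (le_integrable _ _ _ i1) => //.
  by apply/measurable_EFinP/measurable_funX; exact: measurable_ind_le.
move=> y _ /=; rewrite lee_fin normr1 /ind_le.
by case: (y <= x)%R; rewrite ?expr1n ?expr0n ?normr1 ?normr0.
Qed.

Lemma H1_FTC v x : Hs0 1 v -> 0 <= x <= 1 ->
  v x = Complex (\int[leb]_(y in D) (re (wderiv v y) * ind_le x y))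
                (\int[leb]_(y in D) (im (wderiv v y) * ind_le x y)).
Proof.
move=> Hv x01; have [_ [cr ci] v0] := Hv.
have /is_wderivP[/L2P[Lr Li] Rr Ri] := H1_wd Hv.
have := weak_FTC cr (square_int_int Lr) Rr x01.
have := weak_FTC ci (square_int_int Li) Ri x01.
rewrite v0 /= !subr0 => <- <-.
by case: (v x).
Qed.

Lemma rip_indE v x : Hs0 1 v -> 0 <= x <= 1 ->
  normc (v x) ^+ 2 = rip (wderiv v) (fun y => v x * (ind_le x y)%:C%C).
Proof.
move=> Hv x01; rewrite normc_sqr /rip.
have vE := H1_FTC Hv x01.
have rE : re (v x) = \int[leb]_(y in D) (re (wderiv v y) * ind_le x y) by rewrite vE.
have iE : im (v x) = \int[leb]_(y in D) (im (wderiv v y) * ind_le x y) by rewrite vE.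
have /L2P[sr si] := H1_L2w Hv; have s1 := square_int_ind_le x.
rewrite !expr2; transitivity (re (v x) * \int[leb]_(y in D) (re (wderiv v y) * ind_le x y)
  + im (v x) * \int[leb]_(y in D) (im (wderiv v y) * ind_le x y)).
  by rewrite -rE -iE.
rewrite -!RintegralZl//; try exact: square_int_mul.
rewrite -RintegralD//; try exact/int_on_DZ/square_int_mul.
by apply: eq_Rintegral => y _; rewrite !reimE; ring.
Qed.

(** As v 0 = 0, v x is the integral of v' over (0, x): pair v' with v x times the
    indicator function of this interval. *)
Lemma H1_sup v x : Hs0 1 v -> 0 <= x <= 1 -> normc (v x) <= norm2 (wderiv v).
Proof.
move=> Hv x01; have [->|vn0] := eqVneq (normc (v x)) 0; first exact: norm2_ge0.
have v0 : 0 < normc (v x) by rewrite lt_neqAle eq_sym vn0 normc_ge0.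
have Lw := H1_L2w Hv.
have Li : L2 (fun y => (ind_le x y)%:C%C : C).
  by apply/L2P; split; [exact: square_int_ind_le|exact: square_int0].
have := rip_le Lw (L2Z (v x) Li); rewrite -rip_indE// norm2Z// -normc_reim.
rewrite expr2 mulrCA ler_pM2l//; move=> /le_trans; apply.
rewrite ler_piMr ?norm2_ge0//; apply: norm2_le => //; rewrite expr1n.
apply: (@le_trans _ _ (\int[leb]_(y in D) (1 : R))).
  apply: le_Rintegral => //; first exact: rip_int.
    by apply: within_int_on_D; move=> y; exact: cvg_cst.
  by move=> y _; rewrite !reimE /ind_le; case: (y <= x)%R; rewrite ?mulr1 ?mulr0 ?addr0.
by rewrite int_cst.
Qed.

Lemma norm2_le_sup f (c : R) : cont01 f -> 0 <= c ->
  (forall x, 0 < x < 1 -> normc (f x) <= c) -> norm2 f <= c.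
Proof.
move=> cf c0 H; apply: norm2_le => //.
apply: (@le_trans _ _ (\int[leb]_(y in D) (c ^+ 2))).
  apply: le_Rintegral => //; first by apply: rip_int; exact: cont01_L2.
    by apply: within_int_on_D; move=> y; exact: cvg_cst.
  move=> y; rewrite DomE => y01.
  by rewrite -!expr2 -normc_sqr lerXn2r ?nnegrE ?normc_ge0// H.
by rewrite int_cst.
Qed.

Lemma poincare v : Hs0 1 v -> norm2 v <= norm2 (wderiv v).
Proof.
move=> Hv; apply: norm2_le_sup; [exact: H1_cont|exact: norm2_ge0|].
by move=> x x01; apply: H1_sup => //; lra.
Qed.

(** The product of p and the conjugate of v has a weak derivative by rweak_mul
    and vanishes at 0, so weak_FTC at x = 1 produces the boundary term. *)
Lemma ibp_H1 p (dp : R -> C) v :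
  (forall x, 0 <= x <= 1 -> has_cder 0 1 p x (dp x)) -> cont01 dp -> Hs0 1 v ->
  rip dp v + rip p (wderiv v) = re (p 1 * (v 1)^*%C).
Proof.
move=> H cdp Hv; have [cr ci] := cdp; have [_ [vr vi] v0] := Hv.
have cp := has_cder_cont01 H; have [cpr cpi] := cp.
have /is_wderivP[Lw Rr Ri] := H1_wd Hv; have /L2P[wr wi] := Lw.
have part (q dq a b : R -> R) : (forall x, 0 <= x <= 1 -> has_der 0 1 q x (dq x)) ->
    {within `[0, 1], continuous dq} -> {within `[0, 1], continuous a} -> square_int b ->
    rweak a b -> a 0 = 0 ->
    \int[leb]_(x in D) (dq x * a x + q x * b x) = q 1 * a 1.
  move=> Hq cdq ca sb W a0; have cq := has_der_within Hq.
  have W' := rweak_mul Hq cdq (within_square_int ca) sb W.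
  have iI : int_on_D (fun x => dq x * a x + q x * b x).
    by apply: int_on_DD; apply: square_int_mul => //; exact: within_square_int.
  have := weak_FTC (within_mul cq ca) iI W' (x := 1); rewrite lexx ler01 => /(_ isT).
  rewrite a0 mulr0 subr0 => ->; apply: eq_Rintegral => x.
  by rewrite inE DomE /ind_le => /andP[_ /ltW ->]; rewrite mulr1.
have Pr := part _ _ _ _ (fun x hx => (H x hx).1) cr vr wr Rr (f_equal _ v0).
have Pi := part _ _ _ _ (fun x hx => (H x hx).2) ci vi wi Ri (f_equal _ v0).
rewrite !reimE mulrN opprK -Pr -Pi /rip.
have s := @square_int_mul R.
have sp := within_square_int cpr; have sq := within_square_int cpi.
have sdp := within_square_int cr; have sdq := within_square_int ci.
have sv := within_square_int vr; have sv' := within_square_int vi.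
rewrite -!RintegralD//; try (by repeat (apply: int_on_DD); exact: s).
by apply: eq_Rintegral => x _; ring.
Qed.

End H1_functions.

(** * Projections onto finite element spaces *)

Section projection.
Context {R : realType}.
Local Notation C := R[i].
Variables (V W : set (R -> C)) (ip : (R -> C) -> (R -> C) -> R).
Hypothesis VW : V `<=` W.
Hypothesis V0 : V (fun=> 0).
Hypothesis V_lin : forall (c : R) v w, V v -> V w -> V (fun x => c%:C%C * v x + w x).
Hypothesis W_lin : forall (c : R) v w, W v -> W w -> W (fun x => c%:C%C * v x + w x).
Hypothesis ip_sym : forall v w, ip v w = ip w v.
Hypothesis ip_lin : forall (c : R) u v w, W u -> W v -> W w ->
  ip (fun x => c%:C%C * u x + v x) w = c * ip u w + ip v w.
Hypothesis ip_ge0 : forall v, 0 <= ip v v.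
Hypothesis ip_null : forall v w, V v -> (forall x, 0 <= x <= 1 -> v x = 0) -> W w -> ip v w = 0.

Definition comb (k : nat) (d : nat -> R) (e : nat -> R -> C) : R -> C :=
  fun x => \sum_(i < k) (d i)%:C%C * e i x.

Lemma combS k d e : comb k.+1 d e = fun x => (d k)%:C%C * e k x + comb k d e x.
Proof. by apply/funext => x; rewrite /comb big_ord_recr /= addrC. Qed.

Lemma comb0 d e : comb 0 d e = fun=> 0.
Proof. by apply/funext => x; rewrite /comb big_ord0. Qed.

Lemma V_comb k d e : (forall i, (i < k)%N -> V (e i)) -> V (comb k d e).
Proof.
elim: k => [|k IH] He; first by rewrite comb0.
rewrite combS; apply: V_lin; first exact: He.
by apply: IH => i ik; apply: He; exact: ltnW.
Qed.

Lemma ip_comb k d e w : (forall i, (i < k)%N -> V (e i)) -> W w ->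
  ip (comb k d e) w = \sum_(i < k) d i * ip (e i) w.
Proof.
move=> + Ww; elim: k => [|k IH] He.
  by rewrite big_ord0 comb0 ip_null.
rewrite combS ip_lin//; last 2 first.
- by apply/VW/He.
- by apply/VW/V_comb => i ik; apply: He; exact: ltnW.
by rewrite big_ord_recr /= IH 1?addrC// => i ik; apply: He; exact: ltnW.
Qed.

Definition orthonormal k (e : nat -> R -> C) :=
  (forall i, (i < k)%N -> V (e i)) /\
  forall i j, (i < k)%N -> (j < k)%N -> ip (e i) (e j) = (i == j)%:R.

Definition has_projection := forall g, W g -> exists2 chi, V chi &
  forall phi, V phi -> ip chi phi = ip g phi.

(** The form is only semi-definite on functions: those which vanish on [0, 1]
    are isotropic. *)
Lemma ip_isotropic f z : W f -> W z -> ip z z = 0 -> ip z f = 0.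
Proof.
move=> Wf Wz zz; apply/eqP; apply: contraT => zf.
have := ip_ge0 (fun x => (- (ip f f + 1) / (2 * ip z f))%:C%C * z x + f x).
set c := _ / _.
have Wc : W (fun x => c%:C%C * z x + f x) by exact: W_lin.
rewrite ip_lin// (ip_sym z) (ip_sym f) !ip_lin// zz mulr0 add0r (ip_sym f z).
have -> : c * ip z f + (c * ip z f + ip f f) = - 1 by rewrite /c; field.
by rewrite oppr_ge0 ler10.
Qed.

(** A Gram-Schmidt step: subtract from some phi in V its components along the
    family. If every remainder is isotropic, the components of g along the family
    define its projection. *)
Lemma orthonormal_extend k e : orthonormal k e ->
  has_projection \/ exists e', orthonormal k.+1 e'.
Proof.
move=> [eV eO].
pose res phi : R -> C := fun x => phi x - comb k (fun i => ip phi (e i)) e x.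
have resE phi : res phi = fun x => (-1)%:C%C * comb k (fun i => ip phi (e i)) e x + phi x.
  by apply/funext => x; apply: complex_ext; rewrite /res !reimE; ring.
have Wres phi : W phi -> W (res phi).
  by move=> Wp; rewrite resE; apply: W_lin => //; apply/VW/V_comb.
have res_e phi j : W phi -> (j < k)%N -> ip (res phi) (e j) = 0.
  move=> Wp jk; rewrite resE ip_lin//; last 2 first.
  - exact/VW/V_comb.
  - exact/VW/eV.
  rewrite ip_comb//; last exact/VW/eV.
  rewrite (bigD1 (Ordinal jk))//= eO// eqxx mulr1 big1 ?addr0 ?mulN1r ?addNr// => i ij.
  rewrite eO// (_ : (i == j :> nat) = false) ?mulr0//.
  by apply: contra_neqF ij => /eqP ij; exact: val_inj.
have [[phi [Vp pp]]|no] := pselect (exists phi, V phi /\ ip (res phi) (res phi) != 0).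
  right; pose c := (Num.sqrt (ip (res phi) (res phi)))^-1.
  have Vr : V (res phi) by rewrite resE; apply: V_lin => //; exact: V_comb.
  pose z : R -> C := fun x => c%:C%C * res phi x + (fun=> 0) x.
  have Vz : V z by exact: V_lin.
  have ipz w : W w -> ip z w = c * ip (res phi) w.
    by move=> Ww; rewrite ip_lin ?(ip_null V0) ?addr0//; exact: VW.
  have zz : ip z z = 1.
    have p0 : 0 < ip (res phi) (res phi) by rewrite lt_neqAle eq_sym pp ip_ge0.
    rewrite (ipz _ (VW Vz)) (ip_sym (res phi)) (ipz _ (VW Vr)) mulrA -expr2 /c exprVn.
    by rewrite sqr_sqrtr ?mulVf// ltW.
  exists (fun i => if (i < k)%N then e i else z); split=> [i _|i j]; first by case: ifP => // /eV.
  rewrite !ltnS => ik jk.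
  have [ik'|ki] := ltnP i k; have [jk'|kj] := ltnP j k.
  - exact: eO.
  - have -> : (i == j) = false by apply/eqP => ij; rewrite ij ltnNge kj in ik'.
    by rewrite ip_sym (ipz _ (VW (eV i ik'))) (res_e _ _ (VW Vp) ik') mulr0.
  - have -> : (i == j) = false by apply/eqP => ij; rewrite ij leqNgt jk' in ki.
    by rewrite (ipz _ (VW (eV j jk'))) (res_e _ _ (VW Vp) jk') mulr0.
  - have -> : i = j by apply/eqP; rewrite eqn_leq (leq_trans ik kj) (leq_trans jk ki).
    by rewrite eqxx.
left=> g Wg; exists (comb k (fun i => ip g (e i)) e); first exact: V_comb.
move=> phi Vp; have Wp := VW Vp.
have res0 : ip (res phi) (res phi) = 0.
  by apply/eqP; apply: contraT => h; exfalso; apply: no; exists phi.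
have := ip_isotropic (Wres g Wg) (Wres phi Wp) res0.
rewrite {1}[res phi]resE ip_lin//; [|exact/VW/V_comb|exact: Wres].
rewrite ip_comb//; last exact: Wres.
rewrite big1; last by move=> i _; rewrite (ip_sym (e i)) res_e ?mulr0.
rewrite mulr0 add0r ip_sym resE ip_lin//; last exact/VW/V_comb.
by rewrite mulN1r addrC => /eqP; rewrite subr_eq0 => /eqP ->.
Qed.

Hypothesis V_fin : exists n (b : 'I_n -> R -> C), forall v, V v ->
  exists c : 'I_n -> C, forall x : R, 0 <= x <= 1 -> v x = \sum_(i < n) c i * b i x.

(** Orthonormal families in V are bounded in size by the real dimension of a
    complex spanning family; a family that cannot be extended projects. *)
Lemma projection_exists : has_projection.
Proof.
have [n [b bV]] := V_fin.
have bound k e : orthonormal k e -> (k <= n + n)%N.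
  move=> [eV eO]; rewrite leqNgt; apply/negP => nk.
  have /choice [c Hc] : forall i : 'I_k, exists c : 'I_n -> C,
      forall x : R, 0 <= x <= 1 -> e i x = \sum_(j < n) c j * b j x.
    by move=> i; apply: bV; exact: eV.
  (* Complex coordinates are read as pairs of real ones, since dependencies with
     real coefficients are the ones that the real form detects. *)
  pose A : 'M[R]_(k, n + n) := \matrix_(i, j)
    match fintype.split j with inl j => re (c i j) | inr j => im (c i j) end.
  have : kermx A != 0.
    rewrite -mxrank_eq0 mxrank_ker subn_eq0 -ltnNge.
    exact: leq_ltn_trans (rank_leq_col A) nk.
  move=> /rowV0Pn[r /sub_kermxP rA /eqP r0]; apply: r0.
  pose d (i : nat) : R := if insub i is Some j then r 0 j else 0.
  have dE (i : 'I_k) : d i = r 0 i by rewrite /d valK.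
  have cj j : \sum_(i < k) (d i)%:C%C * c i j = 0.
    apply: complex_ext.
      have := congr1 (fun M : 'rV[R]_(n + n) => M 0 (lshift n j)) rA.
      rewrite !mxE [re 0]re_0 => <-; rewrite (big_morph (@complex.Re R) (@re_add _) (erefl _)).
      by apply: eq_bigr => i _; rewrite mxE (unsplitK (inl j)) dE !reimE; ring.
    have := congr1 (fun M : 'rV[R]_(n + n) => M 0 (rshift n j)) rA.
    rewrite !mxE [im 0]im_0 => <-; rewrite (big_morph (@complex.Im R) (@im_add _) (erefl _)).
    by apply: eq_bigr => i _; rewrite mxE (unsplitK (inr j)) dE !reimE; ring.
  have comb_0 x : 0 <= x <= 1 -> comb k d e x = 0.
    move=> x01; rewrite /comb.
    under eq_bigr => i _ do rewrite Hc// mulr_sumr.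
    rewrite exchange_big /= big1// => j _.
    under eq_bigr => i _ do rewrite mulrA.
    by rewrite -mulr_suml cj mul0r.
  apply/rowP => j; rewrite mxE -dE.
  have Wj : W (e j) by apply/VW/eV.
  have := ip_null (V_comb d eV) comb_0 Wj; rewrite ip_comb//.
  rewrite (bigD1 j)//= eO// eqxx mulr1 big1 ?addr0// => i ij.
  by rewrite eO// (_ : (i == j :> nat) = false) ?mulr0//; exact: negbTE.
have grow k : has_projection \/ exists e, orthonormal k e.
  elim: k => [|k [|[e /orthonormal_extend]]]; [|by left|by []].
  by right; exists (fun=> fun=> 0); split.
have [//|[e /bound]] := grow (n + n).+1.
by rewrite ltnn.
Qed.

End projection.

#[local] Opaque rip norm2 inner wderiv Bform eip.

Section primitive.
Context {R : realType}.
Local Notation C := R[i].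
Local Notation leb := (@lebesgue_measure R).
Local Notation D := (@Dom R).
#[local] Hint Resolve measurable_Dom : core.

Lemma within_cst (c : R) (A : set R) : {within A, continuous (cst c : R -> R)}.
Proof. by move=> x; exact: cvg_cst. Qed.

Lemma int_ind_le_id (x : R) : 0 <= x <= 1 -> \int[leb]_(y in D) ind_le x y = x.
Proof.
move=> x01.
have Hid y : 0 <= y <= 1 -> has_der 0 1 (fun y : R => y) y 1.
  by move=> _; exact: is_derive_has_der.
have c1 : {within `[0, 1], continuous (cst 1 : R -> R)} by exact: within_cst.
have := weak_FTC (has_der_within Hid) (within_int_on_D c1) (classical_rweak Hid c1) x01.
rewrite subr0 => xE; rewrite [RHS]xE.
by apply: eq_Rintegral => y _; rewrite mul1r.
Qed.

Lemma int_abs_ind (x y : R) : 0 <= x <= 1 -> 0 <= y <= 1 ->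
  \int[leb]_(z in D) `|ind_le y z - ind_le x z| = `|y - x|.
Proof.
wlog xy : x y / x <= y => [hw|].
  move=> x01 y01; have [xy|/ltW yx] := leP x y; first exact: hw.
  by rewrite distrC -(hw y x)//; apply: eq_Rintegral => z _; rewrite distrC.
move=> x01 y01; rewrite ger0_norm ?subr_ge0//.
have ii z : int_on_D (ind_le z) := square_int_int (@square_int_ind_le R z).
rewrite -[in RHS](int_ind_le_id x01) -[in RHS](int_ind_le_id y01) -RintegralB//; [|exact: ii..].
apply: eq_Rintegral => z _; rewrite ger0_norm// subr_ge0 /ind_le.
by have [zx|] := leP z x; rewrite ?(le_trans zx xy)// ler0n.
Qed.

(** The increment is an integral of q between x and y, where q is close to q x.
    It solves the dual problem classically, up to the end points. *)
Lemma primitive_has_der (q : R -> R) : {within `[0, 1], continuous q} ->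
  forall x, 0 <= x <= 1 ->
  has_der 0 1 (fun x => \int[leb]_(y in D) (q y * ind_le x y)) x (q x).
Proof.
move=> cq x x01 e e0.
have [d d0 H] := (within_itv_continuousP 0 1 q).1 cq x x01 e e0.
exists d => // y y01 yx.
have sq := within_square_int cq.
have si z := @square_int_ind_le R z.
have ii z : int_on_D (ind_le z) := square_int_int (si z).
have iq z : int_on_D (fun y => q y * ind_le z y) by exact: square_int_mul.
have idiff : int_on_D (fun z => ind_le y z - ind_le x z) by exact: int_on_DB.
have -> : (y - x) * q x = \int[leb]_(z in D) (q x * (ind_le y z - ind_le x z)).
  by rewrite RintegralZl// RintegralB; [|by []|exact: ii..]; rewrite !int_ind_le_id// mulrC.
rewrite -RintegralB; [|by []|exact: iq..].
have iqd : int_on_D (fun z => q z * ind_le y z - q z * ind_le x z) by exact: int_on_DB.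
rewrite -RintegralB; [|by []|exact: iqd|exact: int_on_DZ].
have iall : int_on_D (fun z => q z * ind_le y z - q z * ind_le x z -
  q x * (ind_le y z - ind_le x z)) by apply: int_on_DB => //; exact: int_on_DZ.
apply: (le_trans (le_normr_Rintegral _ iall)) => //.
rewrite -(int_abs_ind x01 y01) -RintegralZl//; last exact: integrable_norm idiff.
apply: le_Rintegral => //.
- exact: integrable_norm iall.
- by apply: int_on_DZ; exact: integrable_norm idiff.
move=> z; rewrite DomE => z01.
rewrite -mulrBr -mulrBl normrM.
have [->|nz] := eqVneq (ind_le y z - ind_le x z) 0; first by rewrite normr0 !mulr0.
rewrite ler_wpM2r//; apply: H; first by lra.
move: nz; rewrite /ind_le.
have [zy|yz] := leP z y; have [zx|xz] := leP z x; rewrite ?subrr ?eqxx// => _.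
  by rewrite ger0_norm ?subr_ge0 ?ltW//; move: yx; rewrite ger0_norm; lra.
by rewrite ler0_norm ?subr_le0//; move: yx; rewrite ler0_norm; lra.
Qed.

End primitive.

Section finite_elements.
Context {R : realType}.
Local Notation C := R[i].
Local Notation leb := (@lebesgue_measure R).
Local Notation D := (@Dom R).
#[local] Hint Resolve measurable_Dom : core.
Implicit Types (v w : R -> C).

Lemma sob_norm_ge0 s v : 0 <= sob_norm s v.
Proof. exact: sqrtr_ge0. Qed.

Lemma sob_norm_sqr s v :
  sob_norm s v ^+ 2 = \sum_(l < s.+1) norm2 (iter l wderiv v) ^+ 2.
Proof. by rewrite sqr_sqrtr// sumr_ge0// => i _; exact: sqr_ge0. Qed.

Lemma wderiv_le_sob v : norm2 (wderiv v) <= sob_norm 1 v.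
Proof.
rewrite -[leLHS]ger0_norm ?norm2_ge0// -sqrtr_sqr ler_wsqrtr//.
by rewrite !big_ord_recr big_ord0 /= add0r lerDr sqr_ge0.
Qed.

Lemma sob_norm1_le v : sob_norm 1 v <= norm2 v + norm2 (wderiv v).
Proof.
rewrite -[leRHS]ger0_norm ?addr_ge0 ?norm2_ge0// -sqrtr_sqr ler_wsqrtr//.
rewrite !big_ord_recr big_ord0 /= add0r sqrrD.
by rewrite lerD2r lerDl mulrn_wge0// mulr_ge0// norm2_ge0.
Qed.

Lemma le_sqr_mul (a b : R) : 0 <= a -> 0 <= b -> a ^+ 2 <= b * a -> a <= b.
Proof.
move=> a0 b0; have [->//|an0] := eqVneq a 0.
by rewrite expr2 ler_pM2r// lt_neqAle eq_sym an0.
Qed.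

Section one_space.
Variables (r : nat) (h : R) (V : set (R -> C)).
Hypothesis fe : fe_space r h V.

Lemma fe_0 : V (fun=> 0).
Proof.
have := fe_lin fe (-1) (fe_id fe) (fe_id fe); congr V; apply/funext => x; ring.
Qed.

Lemma feZ (c : C) v : V v -> V (fun x => c * v x).
Proof.
by move=> Vv; have := fe_lin fe c Vv fe_0; congr V; apply/funext => x; rewrite addr0.
Qed.

Lemma feB v w : V v -> V w -> V (fun x => v x - w x).
Proof.
by move=> Vv Vw; have := fe_lin fe (-1) Vw Vv; congr V; apply/funext => x; ring.
Qed.

Lemma fe_Hs0 v : V v -> Hs0 1 v. Proof. exact: (fe_H1 fe). Qed.

Lemma H1_null v w : Hs0 1 v -> (forall x, 0 <= x <= 1 -> v x = 0) -> L2 w ->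
  rip (wderiv v) w = 0.
Proof.
move=> Hv v0 Lw.
have E : ae_eqD v (fun x => 0 * v x).
  by apply: eqD_ae => x x01; rewrite mul0r v0//; lra.
rewrite (wderiv_ext (H1_L2 Hv) (H1_L2 (H1Z 0 Hv)) E).
have := wderiv_ae (is_wderivZ 0 (H1_L2 Hv) (H1_wd Hv)) => E'.
rewrite (rip_ae _ _ Lw E'); [|exact/H1_L2w/H1Z|exact/L2Z/H1_L2w].
by rewrite (_ : (fun x => _) = fun=> 0) ?rip0l//; apply/funext => x; rewrite mul0r.
Qed.

Lemma L2_projection g : L2 g -> exists2 chi, V chi &
  forall phi, V phi -> rip chi phi = rip g phi.
Proof.
apply: (@projection_exists R V (@L2 R) (@rip R)).
- by move=> v /fe_Hs0/H1_L2.
- exact: fe_0.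
- by move=> c v w; exact: (fe_lin fe).
- by move=> c v w; exact: L2_lin.
- exact: ripC.
- by move=> c u v w; exact: rip_linl.
- exact: rip_ge0.
- by move=> v w Vv v0 Lw; rewrite (eq_rip (g := fun=> 0)) ?rip0l// => x x01; apply: v0; lra.
- exact: fe_fin fe.
Qed.

(** The imaginary part of the condition for phi is the real part of the one for
    i phi. *)
Lemma elliptic_projP v w : Hs0 1 v -> elliptic_proj V v w <->
  V w /\ forall phi, V phi -> eip w phi = eip v phi.
Proof.
move=> Hv; split=> [[Vw H]|[Vw H]].
  by split; [exact: Vw|move=> phi Vp; rewrite -(re_Bform w phi) -(re_Bform v phi) H].
split; first exact: Vw.
move=> phi Vp; have Hp := fe_Hs0 Vp; have Hw := fe_Hs0 Vw.
apply: complex_ext.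
  have e1 := re_Bform w phi.
  have e2 := re_Bform v phi.
  have e3 := H phi Vp.
  exact: (etrans e1 (etrans e3 (esym e2))).
exact: (etrans (im_Bform Hw Hp) (etrans (H _ (feZ 'i%C Vp)) (esym (im_Bform Hv Hp)))).
Qed.

Lemma elliptic_exists v : Hs0 1 v -> exists w, elliptic_proj V v w.
Proof.
move=> Hv; have : @has_projection R V (Hs0 1) (@eip R).
  apply: projection_exists.
  - exact: fe_Hs0.
  - exact: fe_0.
  - by move=> c u w; exact: (fe_lin fe).
  - by move=> c u w; exact: H1_lin.
  - exact: eipC.
  - by move=> c u1 u2 w; exact: eip_linl.
  - by move=> u; exact: rip_ge0.
  - by move=> u w Vu u0 Hw; apply: H1_null => //; [exact: fe_Hs0|exact: H1_L2w].
  - exact: fe_fin fe.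
move=> /(_ v Hv)[w Vw H]; exists w; exact/elliptic_projP.
Qed.

Lemma elliptic_orth v w phi : Hs0 1 v -> elliptic_proj V v w -> V phi ->
  eip (fun x => w x - v x) phi = 0.
Proof.
move=> Hv /(elliptic_projP _ Hv)[Vw H] Vp.
by rewrite eipBl ?H ?subrr//; exact: fe_Hs0.
Qed.

Lemma elliptic_stable v w : Hs0 1 v -> elliptic_proj V v w ->
  norm2 (wderiv w) <= norm2 (wderiv v).
Proof.
move=> Hv /(elliptic_projP _ Hv)[Vw H]; have Hw := fe_Hs0 Vw.
apply: le_sqr_mul; [exact: norm2_ge0..|].
rewrite norm2_sqr -(eipE w w) (H w Vw) (eipE v w).
by apply: rip_le; exact: H1_L2w.
Qed.

(** By Galerkin orthogonality the squared energy norm of w - v is, up to sign,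
    its energy product with v - phi. *)
Lemma elliptic_best v w phi : Hs0 1 v -> elliptic_proj V v w -> V phi ->
  norm2 (wderiv (fun x => w x - v x)) <= norm2 (wderiv (fun x => v x - phi x)).
Proof.
move=> Hv E Vp; have [Vw _] := E; have Hw := fe_Hs0 Vw; have Hp := fe_Hs0 Vp.
set z := fun x => w x - v x.
have Hz : Hs0 1 z by exact: H1B.
have Hvp : Hs0 1 (fun x => v x - phi x) by exact: H1B.
have : eip z z = - eip (fun x => v x - phi x) z.
  have e1 := elliptic_orth Hv E Vw; have e2 := elliptic_orth Hv E Vp.
  rewrite eipBl// {1}/z eipBl//.
  by rewrite (eipC w) (eipC v) (eipC phi) e1 e2; ring.
move=> zz; apply: le_sqr_mul; [exact: norm2_ge0..|].
rewrite norm2_sqr -(eipE z z) zz (eipE _ z).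
by rewrite (le_trans (ler_norm _))// normrN rip_CS//; exact: H1_L2w.
Qed.

(** The identity belongs to V and has derivative 1, so the orthogonality of w - v
    to it says that the integral of (w - v)', that is (w - v)(1), vanishes. The
    boundary values of the elliptic projection are therefore exact. *)
Lemma elliptic_at1 v w : Hs0 1 v -> elliptic_proj V v w -> w 1 = v 1.
Proof.
move=> Hv E; have [Vw _] := E; have Hw := fe_Hs0 Vw.
set z := fun x => w x - v x; have Hz : Hs0 1 z by exact: H1B.
have cst_der (c : C) x : 0 <= x <= 1 -> has_cder 0 1 (fun=> c) x 0.
  by move=> _; split; exact: is_derive_has_der.
have cst_cont (c : C) : cont01 (fun=> c) by split; exact: within_cst.
have idW : is_wderiv (fun x : R => x%:C%C : C) (fun=> 1).
  apply: classical_wderiv; last exact: cst_cont.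
  move=> x _; split; last exact: (@is_derive_has_der _ 0 1 (fun y => 0) x 0 (is_derive_cst _ _ _)).
  exact: (@is_derive_has_der _ 0 1 (fun y => y) x 1 (is_derive_id _ _)).
have Hid := fe_Hs0 (fe_id fe).
have key (c : C) : rip (fun=> c) (wderiv z) = re (c * (z 1)^*%C).
  have := ibp_H1 (fun x => cst_der c x) (cst_cont 0) Hz.
  by rewrite rip0l add0r.
have orth (c : C) : re (c * (z 1)^*%C) = 0.
  rewrite -key; have := elliptic_orth Hv E (feZ c (fe_id fe)); rewrite eipC eipE => <-.
  apply: rip_ae.
  - exact: cont01_L2.
  - by apply/H1_L2w/H1Z.
  - exact: H1_L2w.
  - apply: ae_eqD_sym; apply: wderiv_ae.
    have := is_wderivZ c (H1_L2 Hid) idW; congr is_wderiv.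
    by apply/funext => x; rewrite mulr1.
apply/eqP; rewrite -subr_eq0; apply/eqP; rewrite -[_ - _]/(z 1).
apply: complex_ext.
  by have := orth 1; rewrite mul1r reimE => ->.
by have := orth 'i%C; rewrite !reimE mul0r mul1r sub0r opprK => ->.
Qed.

End one_space.
End finite_elements.

Section arithmetic.
Context {R : realType}.

Lemma sum_three_sqr (a b c : R) : 0 <= a -> 0 <= b -> a <= c -> b <= c ->
  a ^+ 2 + b ^+ 2 + c ^+ 2 <= (2 * c) ^+ 2.
Proof.
move=> a0 b0 ac bc; have := ler_pM a0 a0 ac ac; have := ler_pM b0 b0 bc bc.
have c0 := le_trans a0 ac; have := mulr_ge0 c0 c0.
by rewrite !expr2; lra.
Qed.

Lemma nitsche_arith (h K m z S c : R) : 0 < h -> 0 <= K -> 0 <= m -> 0 <= z ->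
  S <= 2 * z ->
  (forall e, 0 < e -> exists2 n, c <= n * m & h * n <= K * h ^+ 2 * S + e) ->
  c <= 2 * K * h * m * z.
Proof.
move=> h0 K0 m0 z0 Sz H; rewrite -(ler_pM2l h0); apply/ler_addgt0Pr => e e0.
have m1 : 0 < m + 1 by lra.
have [n cn hn] := H (e / (m + 1)) (divr_gt0 e0 m1).
have s1 : h * c <= h * (n * m) by rewrite ler_pM2l.
have s3 : h * n * m <= (K * h ^+ 2 * S + e / (m + 1)) * m by rewrite ler_wpM2r.
have s4 : K * h ^+ 2 * S <= K * h ^+ 2 * (2 * z).
  by rewrite ler_wpM2l// mulr_ge0// sqr_ge0.
have s5 : K * h ^+ 2 * S * m <= K * h ^+ 2 * (2 * z) * m by rewrite ler_wpM2r.
have s6 : e / (m + 1) * m <= e.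
  by rewrite mulrAC ler_pdivrMr// ler_pM2l// lerDl.
have -> : h * (2 * K * h * m * z) = K * h ^+ 2 * (2 * z) * m by ring.
by move: s3; rewrite mulrDl; lra.
Qed.

Lemma stable_arith (h K J a b c d e f k : R) : 0 < h -> 0 <= K -> 0 <= J ->
  a <= b + c -> c <= d -> b <= J * h^-1 * k -> k <= f -> f <= 2 * K * h * e ->
  e <= 2 * d -> a <= (1 + 4 * K * J) * d.
Proof.
move=> h0 K0 J0 tri st inv' cw n best.
have s1 : J * h^-1 * k <= J * h^-1 * (2 * K * h * (2 * d)).
  rewrite ler_wpM2l// ?mulr_ge0 ?invr_ge0 ?(ltW h0)//.
  by apply: (le_trans cw); apply: (le_trans n); rewrite ler_wpM2l// !mulr_ge0// ltW.
have -> : (1 + 4 * K * J) * d = J * h^-1 * (2 * K * h * (2 * d)) + d.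
  by field; rewrite gt_eqF.
by lra.
Qed.

End arithmetic.

(** * Approximation by the elliptic projection *)

Section duality.
Context {R : realType}.
Local Notation C := R[i].
Local Notation leb := (@lebesgue_measure R).
Local Notation D := (@Dom R).
#[local] Hint Resolve measurable_Dom : core.
Implicit Types (v w : R -> C).

Lemma has_der_cstB (a b c : R) (f : R -> R) (x d : R) :
  has_der a b f x d -> has_der a b (fun y => c - f y) x (- d).
Proof.
move=> H e /H[r r0 {}H]; exists r => // y yab yx.
have -> : c - f y - (c - f x) - (y - x) * - d = - (f y - f x - (y - x) * d) by ring.
by rewrite normrN; exact: H.
Qed.

(** Integrate twice: psi1 x is the integral of rho over (x, 1). *)
Lemma dual_problem (rho : R -> C) : cont01 rho -> exists psi psi1 : R -> C,
  [/\ forall x, 0 <= x <= 1 -> has_cder 0 1 psi x (psi1 x),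
      forall x, 0 <= x <= 1 -> has_cder 0 1 psi1 x (- rho x),
      psi 0 = 0 & psi1 1 = 0].
Proof.
pose P (q : R -> R) x := \int[leb]_(y in D) (q y * ind_le x y).
have real (q : R -> R) : {within `[0, 1], continuous q} -> exists p p1 : R -> R,
    [/\ forall x, 0 <= x <= 1 -> has_der 0 1 p x (p1 x),
      forall x, 0 <= x <= 1 -> has_der 0 1 p1 x (- q x), p 0 = 0 & p1 1 = 0].
  move=> cq; pose p1 x := P q 1 - P q x.
  have H1 x : 0 <= x <= 1 -> has_der 0 1 p1 x (- q x).
    by move=> x01; apply: has_der_cstB; exact: primitive_has_der.
  exists (P p1), p1; split => //.
  - by move=> x x01; apply: primitive_has_der => //; exact: has_der_within H1.
  - rewrite /P (eq_Rintegral _ (g := fun=> 0)) ?int_cst//.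
    by move=> y; rewrite inE DomE /ind_le => /andP[y0 _]; rewrite leNgt y0 mulr0.
  - by rewrite /p1 subrr.
move=> [/real [p [p1 [a1 a2 a3 a4]]] /real [q [q1 [b1 b2 b3 b4]]]].
exists (fun x => Complex (p x) (q x)), (fun x => Complex (p1 x) (q1 x)); split.
- by move=> x x01; split; [exact: a1|exact: b1].
- by move=> x x01; split; rewrite !reimE; [exact: a2|exact: b2].
- by rewrite a3 b3.
- by rewrite a4 b4.
Qed.

Lemma cont01N v : cont01 v -> cont01 (fun x => - v x).
Proof.
move=> cv; have := cont01_lin (-2) cv cv.
by have -> : (fun x => -2 * v x + v x) = fun x => - v x by apply/funext => x; ring.
Qed.

Lemma norm2_wderivD v w : Hs0 1 v -> Hs0 1 w ->
  norm2 (wderiv (fun x => v x + w x)) <= norm2 (wderiv v) + norm2 (wderiv w).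
Proof.
move=> Hv Hw; have -> : (fun x => v x + w x) = fun x => 1 * v x + w x.
  by apply/funext => x; rewrite mul1r.
rewrite (norm2_wderiv_lin _ Hv Hw).
apply: (le_trans (norm2D (L2Z _ (H1_L2w Hv)) (H1_L2w Hw))); rewrite lerD2r.
by rewrite (eq_norm2 (g := wderiv v))// => x _; rewrite mul1r.
Qed.

Lemma norm2_wderivN v : Hs0 1 v -> norm2 (wderiv (fun x => - v x)) = norm2 (wderiv v).
Proof.
move=> Hv; have W := is_wderivZ (-1) (H1_L2 Hv) (H1_wd Hv).
have -> : (fun x => - v x) = fun x => -1 * v x by apply/funext => x; rewrite mulN1r.
rewrite (norm2_wderiv W) -[RHS]norm2N; apply: eq_norm2 => x _; exact: mulN1r.
Qed.

Lemma norm2_wderivB v w : Hs0 1 v -> Hs0 1 w ->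
  norm2 (wderiv (fun x => v x - w x)) <= norm2 (wderiv v) + norm2 (wderiv w).
Proof.
move=> Hv Hw; have HN : Hs0 1 (fun x => - w x).
  by have := H1Z (-1) Hw; have -> // : (fun x => -1 * w x) = fun x => - w x;
    apply/funext => x; rewrite mulN1r.
by rewrite -(norm2_wderivN Hw); exact: norm2_wderivD.
Qed.

Section one_space.
Variables (r : nat) (h : R) (V : set (R -> C)).
Hypothesis fe : fe_space r h V.
Hypothesis h_gt0 : 0 < h.

(** The infimum in the approximation property, as a statement about
    near-minimisers. *)
Definition approximates (K : R) (s : nat) := forall v, Hs0 s.+1 v -> forall e, 0 < e ->
  exists2 phi, V phi & norm2 (fun x => v x - phi x) +
    h * sob_norm 1 (fun x => v x - phi x) <= K * h ^+ s.+1 * sob_norm s.+1 v + e.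

Lemma approximates_energy K s v w : approximates K s -> Hs0 s.+1 v ->
  elliptic_proj V v w ->
  h * norm2 (wderiv (fun x => w x - v x)) <= K * h ^+ s.+1 * sob_norm s.+1 v.
Proof.
move=> A Hv E; apply/ler_addgt0Pr => e e0; have [phi Vp le] := A v Hv e e0.
have := elliptic_best fe (Hs0S Hv) E Vp.
have := wderiv_le_sob (fun x => v x - phi x).
have := norm2_ge0 (fun x => v x - phi x); move: le.
set a := norm2 _; set b := sob_norm 1 _; set c := norm2 _; set d := norm2 _.
move: a b c d => a b c d le a0 cb dc; apply: le_trans le.
by rewrite -[leLHS]add0r lerD// ler_pM2l// (le_trans dc).
Qed.

(** Aubin and Nitsche: the error is tested against the solution of the dual
    problem - psi'' = rho, psi(0) = psi'(1) = 0, which costs one power of h. *)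
Lemma nitsche K v w : 0 <= K -> approximates K 1 -> Hs0 1 v -> elliptic_proj V v w ->
  norm2 (fun x => w x - v x) <= 2 * K * h * norm2 (wderiv (fun x => w x - v x)).
Proof.
move=> K0 A Hv E; have Vw := E.1; have Hw := fe_Hs0 fe Vw.
have Hr : Hs0 1 (fun x => w x - v x) by exact: H1B.
have orth phi : V phi -> eip (fun x => w x - v x) phi = 0 by exact: (elliptic_orth fe Hv E).
move: Hr orth; move: (fun x => w x - v x) => rho Hr orth.
have cr := H1_cont Hr; have Lr := H1_L2 Hr.
have [psi [psi1 [d1 d2 p0 p1]]] := dual_problem cr.
have cp1 : cont01 psi1 by exact: has_cder_cont01 d2.
have cp : cont01 psi by exact: has_cder_cont01 d1.
have cNr : cont01 (fun x => - rho x) by exact: cont01N.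
have W1 : is_wderiv psi psi1 by exact: classical_wderiv.
have W2 : is_wderiv psi1 (fun x => - rho x) by exact: classical_wderiv.
have H2 : Hs0 2 psi.
  split => //; split; first exact: cont01_L2.
  exists psi1 => //; split; first exact: cont01_L2.
  by exists (fun x => - rho x) => //; split => //; exact: cont01_L2.
have H1 : Hs0 1 psi := Hs0S H2.
have n1 : norm2 (wderiv psi) = norm2 psi1 := norm2_wderiv W1.
have eqw : wderiv (wderiv psi) = wderiv psi1.
  by apply: wderiv_ext; [exact: H1_L2w|exact: cont01_L2|exact: wderiv_ae].
have n2 : norm2 (wderiv (wderiv psi)) = norm2 rho.
  by rewrite eqw (norm2_wderiv W2) norm2N.
have ibp z : Hs0 1 z -> rip psi1 (wderiv z) = rip rho z.
  move=> Hz; have := ibp_H1 d2 cNr Hz; rewrite p1 mul0r re_0.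
  have -> : rip (fun x => - rho x) z = - rip rho z.
    have := ripZl (-1) Lr (H1_L2 Hz); rewrite mulN1r => <-; apply: eq_rip => x _.
    by apply: complex_ext; rewrite !reimE; ring.
  by rewrite addrC => /eqP; rewrite subr_eq0 => /eqP.
have Lp1 := cont01_L2 cp1.
have eE z : Hs0 1 z -> eip psi z = rip psi1 (wderiv z).
  move=> Hz; rewrite (eipE psi z); apply: rip_ae; [exact: H1_L2w|exact: Lp1|exact: H1_L2w|].
  exact: wderiv_ae.
have stab1 : norm2 psi1 <= norm2 rho.
  apply: le_sqr_mul; [exact: norm2_ge0..|].
  rewrite -{1}n1 (norm2_sqr (wderiv psi)) -(eipE psi psi) (eE _ H1) (ibp _ H1).
  apply: (le_trans (rip_le Lr (H1_L2 H1))); rewrite ler_wpM2l ?norm2_ge0// -n1.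
  exact: poincare.
have stab0 : norm2 psi <= norm2 rho.
  by apply: le_trans stab1; rewrite -n1; exact: poincare.
have stab : sob_norm 2 psi <= 2 * norm2 rho.
  rewrite -[leRHS]ger0_norm ?mulr_ge0 ?norm2_ge0// -sqrtr_sqr ler_wsqrtr//.
  rewrite !big_ord_recr big_ord0 /= add0r n1 n2.
  exact: (sum_three_sqr (norm2_ge0 psi) (norm2_ge0 psi1) stab0 stab1).
apply: le_sqr_mul; first exact: norm2_ge0.
  by rewrite !mulr_ge0 ?norm2_ge0// ltW.
rewrite (norm2_sqr rho) -(ibp _ Hr) -(eE _ Hr).
have N0 := norm2_ge0 (wderiv rho).
apply: (nitsche_arith h_gt0 K0 N0 (norm2_ge0 rho) stab) => e e0.
have [phi Vp le] := A psi H2 e e0.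
have Hp := fe_Hs0 fe Vp.
have -> : eip psi rho = eip (fun x => psi x - phi x) rho.
  by rewrite (eipBl H1 Hp Hr) (eipC phi rho) (orth _ Vp) subr0.
have Hd : Hs0 1 (fun x => psi x - phi x) by exact: H1B.
rewrite (eipE _ rho); exists (norm2 (wderiv (fun x => psi x - phi x))).
  by apply: rip_le; exact: H1_L2w.
apply: le_trans le; rewrite -[leLHS]add0r lerD ?norm2_ge0// ler_pM2l//.
exact: wderiv_le_sob.
Qed.

(** The L2 and the elliptic projection of g differ by an element of V whose L2
    norm is at most the one of the elliptic error, hence O(h) by nitsche; the
    inverse inequality loses exactly this factor h. *)
Lemma L2_projection_stable K J g chi : 0 <= K -> approximates K 1 -> 0 <= J ->
  (forall phi, V phi -> norm2 (wderiv phi) <= J * h^-1 * norm2 phi) ->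
  Hs0 1 g -> V chi -> (forall phi, V phi -> rip chi phi = rip g phi) ->
  norm2 (wderiv chi) <= (1 + 4 * K * J) * norm2 (wderiv g).
Proof.
move=> K0 A J0 inv Hg Vc H.
have [w E] := elliptic_exists fe Hg; have Vw := E.1.
have Hw := fe_Hs0 fe Vw; have Hc := fe_Hs0 fe Vc.
have st := elliptic_stable fe Hg E.
have Hwg : Hs0 1 (fun x => w x - g x) by exact: H1B.
have n := nitsche K0 A Hg E.
have best : norm2 (wderiv (fun x => w x - g x)) <= 2 * norm2 (wderiv g).
  by apply: (le_trans (norm2_wderivB Hw Hg)); rewrite mulr2n mulrDl !mul1r lerD2r.
have Vcw : V (fun x => chi x - w x) by exact: (feB fe).
have Hcw := fe_Hs0 fe Vcw.
have cw : norm2 (fun x => chi x - w x) <= norm2 (fun x => w x - g x).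
  apply: le_sqr_mul; [exact: norm2_ge0..|].
  rewrite (norm2_sqr (fun x => chi x - w x)).
  rewrite (ripBl (H1_L2 Hc) (H1_L2 Hw) (H1_L2 Hcw)) (H _ Vcw).
  rewrite -(ripBl (H1_L2 Hg) (H1_L2 Hw) (H1_L2 Hcw)) (norm2_distC w g).
  by apply: rip_le; [exact: L2B (H1_L2 Hg) (H1_L2 Hw)|exact: H1_L2].
have inv' := inv _ Vcw.
have tri : norm2 (wderiv chi) <= norm2 (wderiv (fun x => chi x - w x)) + norm2 (wderiv w).
  have e : chi = fun x => (chi x - w x) + w x by apply/funext => x; rewrite subrK.
  by rewrite [X in norm2 (wderiv X) <= _]e; exact: norm2_wderivD.
exact: (stable_arith h_gt0 K0 J0 tri st inv' cw n best).
Qed.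

End one_space.

Lemma approx_property_uniform hstar r (Sh : R -> set (R -> C)) :
  (forall h, 0 < h <= hstar -> fe_space r h (Sh h)) ->
  approx_property hstar r Sh -> exists2 K, 0 <= K & forall h, 0 < h <= hstar ->
  forall s, (s <= r)%N -> approximates h (Sh h) K s.
Proof.
move=> Hfe [K HK]; exists `|K| => // h hh s sr v Hv e e0.
have fe := Hfe h hh; have := HK h hh s sr v Hv.
set A := _ @` _ => le.
have A0 : has_inf A.
  split; first by exists (norm2 (fun x => v x - 0) + h * sob_norm 1 (fun x => v x - 0)), (fun=> 0) => //; exact: (fe_0 fe).
  exists 0 => _ [phi _ <-]; rewrite addr_ge0 ?norm2_ge0// mulr_ge0 ?sqrtr_ge0//.
  by case/andP: hh => /ltW.
have [_ [phi Vp <-] lt] := inf_adherent e0 A0.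
exists phi => //; apply: (le_trans (ltW lt)); rewrite lerD2r (le_trans le)//.
rewrite -!mulrA ler_wpM2r ?ler_norm// mulr_ge0 ?sqrtr_ge0// exprn_ge0//.
by case/andP: hh => /ltW.
Qed.

End duality.

(** * Functions on the space-time rectangle *)

Section rectangle.
Context {R : realType}.
Local Notation C := R[i].
Variable T : R.
Hypothesis T_gt0 : 0 < T.
Implicit Types (g : R -> R -> R).

Definition rect_cont g := {within (`[0, T]%classic `*` `[0, 1]%classic : set (R * R)),
  continuous (fun p => g p.1 p.2)}.

Lemma rect_contP g : rect_cont g <->
  forall t x : R, 0 <= t <= T -> 0 <= x <= 1 -> forall e, 0 < e -> exists2 d, 0 < d &
    forall s y, 0 <= s <= T -> 0 <= y <= 1 -> `|s - t| < d -> `|y - x| < d ->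
    `|g s y - g t x| <= e.
Proof.
rewrite /rect_cont within_continuousP; split=> H.
  move=> t x tT x01 e e0; have [|d d0 Hd] := H (t, x) _ e e0.
    by split; rewrite /= in_itv.
  exists d => // s y sT y01 st yx; apply: (Hd (s, y)); first by split; rewrite /= in_itv.
  by split; rewrite /ball /= distrC.
move=> [t x] [/= tT x01] e e0; rewrite !in_itv /= in tT x01.
have [d d0 Hd] := H t x tT x01 e e0; exists d => // -[s y] [/= sT y01] [/= st yx].
rewrite !in_itv /= in sT y01; apply: Hd => //.
  by move: st; rewrite /ball /= distrC.
by move: yx; rewrite /ball /= distrC.
Qed.

Lemma rect_slice_x g t : rect_cont g -> 0 <= t <= T -> {within `[0, 1], continuous (g t)}.
Proof.
move=> /rect_contP H tT; apply/within_itv_continuousP => x x01 e e0.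
have [d d0 Hd] := H t x tT x01 e e0; exists d => // y y01 yx; apply: Hd => //.
by rewrite subrr normr0.
Qed.

(** Uniformity in x comes from the compactness of [0, 1]. *)
Lemma rect_unif g t : rect_cont g -> 0 <= t <= T -> forall e, 0 < e ->
  exists2 d, 0 < d & forall s, 0 <= s <= T -> `|s - t| < d ->
  forall x, 0 <= x <= 1 -> `|g s x - g t x| <= e.
Proof.
move=> /rect_contP H tT e e0.
have cover := (compact_near_coveringP _).1 (@segment_compact R 0 1).
pose P (s x : R) := 0 <= x <= 1 -> 0 <= s <= T -> `|g s x - g t x| <= e.
have : \forall s \near t, `[0, 1]%classic `<=` P s.
  apply: (cover _ (nbhs t) P _) => x; rewrite /= in_itv /= => x01.
  have e2 : 0 < e / 2 by rewrite divr_gt0.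
  have [d d0 Hd] := H t x tT x01 _ e2.
  exists (ball x d, ball t d) => /=; first by split; exact: nbhsx_ballx.
  move=> [y s] [/= yx ts] y01 sT; rewrite /ball /= in yx ts.
  have A1 := Hd s y sT y01; have A2 := Hd t y tT y01.
  rewrite subrr normr0 in A2; rewrite distrC in yx; rewrite distrC in ts.
  have := A1 ts yx; have := A2 d0 yx.
  have := ler_normB (g s y - g t x) (g t y - g t x).
  have -> : g s y - g t x - (g t y - g t x) = g s y - g t y by ring.
  by lra.
move=> /nbhs_ballP[d /= d0 Hd]; exists d => // s sT st x x01.
have bs : ball t d s by rewrite /ball /= distrC.
have xi : `[0, 1]%classic x by rewrite /= in_itv.
exact: (Hd s bs x xi x01 sT).
Qed.

Lemma rect_bounded g : rect_cont g -> exists2 K, 0 <= K &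
  forall t x, 0 <= t <= T -> 0 <= x <= 1 -> `|g t x| <= K.
Proof.
move=> cg; pose A : set (R * R) := `[0, T]%classic `*` `[0, 1]%classic.
have cA : compact A by apply: compact_setX; exact: segment_compact.
have A0 : A !=set0 by exists (0, 0); split; rewrite /= in_itv /= lexx ?ler01 ?ltW.
have cn : {within A, continuous (fun p : R * R => `|g p.1 p.2|)}.
  apply/within_continuousP => p Ap e e0.
  have [d d0 Hd] := (within_continuousP _ _).1 cg p Ap e e0.
  by exists d => // q Aq pq; rewrite (le_trans (ler_dist_dist _ _))// Hd.
have [c _ Hc] := compact_EVT_max A0 cA cn.
exists `|g c.1 c.2| => // t x tT x01; apply: (Hc (t, x)).
by rewrite inE; split; rewrite /= in_itv.
Qed.

Lemma between_dist (p q z : R) : Num.min p q <= z <= Num.max p q -> `|z - p| <= `|q - p|.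
Proof.
have := ler_norm (q - p); have := ler_norm (p - q); rewrite (distrC p q).
by case: (leP p q) => h h1 h2 /andP[h3 h4]; rewrite ler_norml; lra.
Qed.

Lemma between_itv (a b p q z : R) : a <= p <= b -> a <= q <= b ->
  Num.min p q <= z <= Num.max p q -> a <= z <= b.
Proof. by case: (leP p q); lra. Qed.

Lemma has_derB (a b x d1 d2 : R) (f1 f2 : R -> R) : has_der a b f1 x d1 ->
  has_der a b f2 x d2 -> has_der a b (fun y => f1 y - f2 y) x (d1 - d2).
Proof.
move=> H1 H2 e e0; have e2 : 0 < e / 2 by rewrite divr_gt0.
have [r1 r10 {}H1] := H1 _ e2; have [r2 r20 {}H2] := H2 _ e2.
exists (Num.min r1 r2); first by rewrite lt_min r10.
move=> y yab; rewrite lt_min => /andP[/(H1 y yab) K1 /(H2 y yab) K2].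
have -> : f1 y - f2 y - (f1 x - f2 x) - (y - x) * (d1 - d2) =
  (f1 y - f1 x - (y - x) * d1) - (f2 y - f2 x - (y - x) * d2) by ring.
by rewrite (le_trans (ler_normB _ _))// (le_trans (lerD K1 K2))// -mulrDl -splitr.
Qed.

Lemma le_norm_split (e a b : R) : `|a| <= e / 2 -> `|b| <= e / 2 -> `|a - b| <= e.
Proof. by move=> h1 h2; rewrite (splitr e) (le_trans (ler_normB _ _))// lerD. Qed.

(** By the mean value theorem in time at fixed x, and rect_unif for g'. *)
Lemma rect_der_unif g (g' : R -> R -> R) t :
  (forall s x, 0 <= s <= T -> 0 <= x <= 1 -> has_der 0 T (fun s => g s x) s (g' s x)) ->
  rect_cont g' -> 0 <= t <= T -> forall e, 0 < e ->
  exists2 d, 0 < d & forall s, 0 <= s <= T -> `|s - t| < d ->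
  forall x, 0 <= x <= 1 -> `|g s x - g t x - (s - t) * g' t x| <= e * `|s - t|.
Proof.
move=> H cg' tT e e0; have [d d0 Hd] := rect_unif cg' tT e0.
exists d => // s sT st x x01.
have [z zts ->] := has_der_MVT (f := fun s => g s x) tT sT (fun z zT => H z x zT x01).
have -> : g' z x * (s - t) - (s - t) * g' t x = (g' z x - g' t x) * (s - t) by ring.
rewrite normrM ler_wpM2r//; apply: Hd => //.
  by move: zts; case: (leP t s); lra.
exact: le_lt_trans (between_dist zts) st.
Qed.

Lemma nearby (a b t d : R) : a < b -> a <= t <= b -> 0 < d ->
  exists s, [/\ a <= s <= b, s != t & `|s - t| < d].
Proof.
move=> ab tab d0; have [F _] := dnbhs_itv_proper ab tab.
apply: contrapT => no; apply: F; apply/near_dnbhs_itvP; exists d => // s sab st std.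
by apply: no; exists s.
Qed.

(** By the mean value theorem a second difference quotient at (t, x) is a value of
    either mixed derivative at some nearby point; both are continuous. *)
Lemma mixed_partials g (gt gx gtx gxt : R -> R -> R) :
  (forall s x, 0 <= s <= T -> 0 <= x <= 1 -> has_der 0 T (fun s => g s x) s (gt s x)) ->
  (forall s x, 0 <= s <= T -> 0 <= x <= 1 -> has_der 0 1 (g s) x (gx s x)) ->
  (forall s x, 0 <= s <= T -> 0 <= x <= 1 -> has_der 0 T (fun s => gx s x) s (gtx s x)) ->
  (forall s x, 0 <= s <= T -> 0 <= x <= 1 -> has_der 0 1 (gt s) x (gxt s x)) ->
  rect_cont gtx -> rect_cont gxt ->
  forall t x, 0 <= t <= T -> 0 <= x <= 1 -> gtx t x = gxt t x.
Proof.
move=> Ht Hx Htx Hxt /rect_contP ctx /rect_contP cxt t x tT x01.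
apply/eqP; rewrite -subr_eq0 -normr_eq0 eq_le normr_ge0 andbT.
apply/ler_addgt0Pr => e e0; rewrite add0r; have e2 : 0 < e / 2 by rewrite divr_gt0.
have [d1 d10 H1] := ctx t x tT x01 _ e2.
have [d2 d20 H2] := cxt t x tT x01 _ e2.
pose d := Num.min d1 d2; have d0 : 0 < d by rewrite lt_min d10.
have dd1 : d <= d1 by rewrite ge_min lexx.
have dd2 : d <= d2 by rewrite ge_min lexx orbT.
have [s [sT st std]] := nearby T_gt0 tT d0.
have [y [y01 yx yxd]] := nearby ltr01 x01 d0.
have btw (p q z : R) : Num.min p q <= z <= Num.max p q -> `|q - p| < d -> `|z - p| < d.
  by move=> /between_dist; exact: le_lt_trans.
have D1 z : 0 <= z <= 1 -> has_der 0 1 (fun y => g s y - g t y) z (gx s z - gx t z).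
  by move=> z01; apply: has_derB; exact: Hx.
have D2 z : 0 <= z <= T -> has_der 0 T (fun s => g s y - g s x) z (gt z y - gt z x).
  by move=> zT; apply: has_derB; [exact: (Ht z y)|exact: (Ht z x)].
have [z1 hz1 E1] := has_der_MVT x01 y01 D1.
have z101 := between_itv x01 y01 hz1.
have [s1 hs1 E2] := has_der_MVT (f := fun s => gx s z1) tT sT (fun z zT => Htx z z1 zT z101).
have s1T := between_itv tT sT hs1.
have [s2 hs2 E3] := has_der_MVT tT sT D2.
have s2T := between_itv tT sT hs2.
have [z2 hz2 E4] := has_der_MVT (f := gt s2) x01 y01 (fun z z01 => Hxt s2 z s2T z01).
have z201 := between_itv x01 y01 hz2.
have E : gtx s1 z1 = gxt s2 z2.
  have nz : (s - t) * (y - x) != 0 by rewrite mulf_neq0// subr_eq0.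
  apply: (mulIf nz).
  transitivity (g s y - g t y - (g s x - g t x)); first by rewrite E1 E2; ring.
  by transitivity (g s y - g s x - (g t y - g t x)); [ring|rewrite E3 E4; ring].
have A1 := H1 s1 z1 s1T z101 (lt_le_trans (btw _ _ _ hs1 std) dd1) (lt_le_trans (btw _ _ _ hz1 yxd) dd1).
have A2 := H2 s2 z2 s2T z201 (lt_le_trans (btw _ _ _ hs2 std) dd2) (lt_le_trans (btw _ _ _ hz2 yxd) dd2).
have -> : gtx t x - gxt t x = (gxt s2 z2 - gxt t x) - (gtx s1 z1 - gtx t x) by rewrite E; ring.
exact: le_norm_split.
Qed.

End rectangle.

(** * Differentiable curves with values in L2 *)

Lemma product_rule_arith {R : realType} (e e1 tau q1 q2 q3 ns nz nw nd n1 n2 n3 : R) :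
  e1 <= 1 -> e1 * (nw + nz + nd + 1) <= e ->
  `|q1| <= n1 * ns -> `|q2| <= nd * n2 -> `|q3| <= nw * n3 -> ns <= n2 + nz ->
  n1 <= e1 * `|tau| -> n3 <= e1 * `|tau| -> n2 <= e1 ->
  0 <= nw -> 0 <= nz -> 0 <= nd -> 0 <= ns -> 0 <= n1 ->
  `|q1 + tau * q2 + q3| <= e * `|tau|.
Proof.
move=> e11 eA b1 b2 b3 zs H1 H3 H2 nw0 nz0 nd0 ns0 n10.
rewrite (le_trans (ler_normD _ _))// (le_trans (lerD (ler_normD _ _) (lexx _)))//.
rewrite normrM; have t0 := normr_ge0 tau.
have c1 : `|q1| <= e1 * `|tau| * (nz + 1) by rewrite (le_trans b1)// ler_pM//; lra.
have c2 : `|tau| * `|q2| <= `|tau| * (nd * e1).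
  by rewrite ler_wpM2l// (le_trans b2)// ler_wpM2l.
have c3 : `|q3| <= nw * (e1 * `|tau|) by rewrite (le_trans b3)// ler_wpM2l.
apply: le_trans (ler_wpM2r t0 eA).
have -> : e1 * (nw + nz + nd + 1) * `|tau| =
  e1 * `|tau| * (nz + 1) + `|tau| * (nd * e1) + nw * (e1 * `|tau|) by ring.
by rewrite !lerD.
Qed.

Section curves.
Context {R : realType}.
Local Notation C := R[i].
Variable T : R.
Implicit Types (w z v : R -> R -> C) (dw dz : R -> C).

(** Frechet differentiability of a curve with values in L2. *)
Definition L2_der w t dw := forall e : R, 0 < e -> exists2 r, 0 < r &
  forall s, 0 <= s <= T -> `|s - t| < r ->
  norm2 (fun x => w s x - w t x - (s - t)%:C%C * dw x) <= e * `|s - t|.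

Definition L2_curve w := forall s, 0 <= s <= T -> L2 (w s).

Lemma L2_rest w t dw s : L2_curve w -> L2 dw -> 0 <= t <= T -> 0 <= s <= T ->
  L2 (fun x => w s x - w t x - (s - t)%:C%C * dw x).
Proof.
move=> Lw Ld tT sT; apply: (L2B (L2B (Lw s sT) (Lw t tT))); exact: L2Z.
Qed.

Lemma L2_der_cont w t dw : L2_curve w -> L2 dw -> 0 <= t <= T -> L2_der w t dw ->
  forall e : R, 0 < e -> exists2 r, 0 < r & forall s, 0 <= s <= T -> `|s - t| < r ->
  norm2 (fun x => w s x - w t x) <= e.
Proof.
move=> Lw Ld tT H e e0; have [r r0 {}H] := H 1 ltr01.
have K0 : 0 < 1 + norm2 dw by rewrite ltr_pwDl// norm2_ge0.
exists (Num.min r (e / (1 + norm2 dw))); first by rewrite lt_min r0 divr_gt0.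
move=> s sT; rewrite lt_min => /andP[sr se].
have := norm2_le_dist (L2B (Lw s sT) (Lw t tT)) (L2Z (s - t)%:C%C Ld).
rewrite norm2_real// => le; apply: (le_trans le).
rewrite (le_trans (lerD (H s sT sr) (lexx _)))//.
by rewrite [`|_| * norm2 _]mulrC -mulrDl mulrC; move: se; rewrite ltr_pdivlMr// => /ltW.
Qed.

Lemma rip_has_der w z t dw dz : L2_curve w -> L2_curve z -> L2 dw -> L2 dz ->
  0 <= t <= T -> L2_der w t dw -> L2_der z t dz ->
  has_der 0 T (fun s => rip (w s) (z s)) t (rip dw (z t) + rip (w t) dz).
Proof.
move=> Lw Lz Ldw Ldz tT Hw Hz e e0.
have Lwt := Lw t tT; have Lzt := Lz t tT.
pose A := norm2 (w t) + norm2 (z t) + norm2 dw + 1.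
have A0 : 0 < A by rewrite ltr_wpDl// !addr_ge0// norm2_ge0.
pose e1 := Num.min 1 (e / A).
have e10 : 0 < e1 by rewrite lt_min ltr01 divr_gt0.
have e1_1 : e1 <= 1 by rewrite ge_min lexx.
have e1A : e1 * A <= e by rewrite -ler_pdivlMr// ge_min lexx orbT.
have [r1 r10 H1] := Hw e1 e10; have [r2 r20 H2] := Hz e1 e10.
have [r3 r30 H3] := L2_der_cont Lz Ldz tT Hz e10.
exists (Num.min r1 (Num.min r2 r3)); first by rewrite !lt_min r10 r20.
move=> s sT; rewrite !lt_min => /and3P[s1 s2 s3].
have {}H1 := H1 s sT s1; have {}H2 := H2 s sT s2; have {}H3 := H3 s sT s3.
have Ls := Lw s sT; have Lzs := Lz s sT.
have LD := L2_rest Lw Ldw tT sT; have LE := L2_rest Lz Ldz tT sT.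
have eW : rip (fun x => w s x - w t x - (s - t)%:C%C * dw x) (z s) =
   rip (w s) (z s) - rip (w t) (z s) - (s - t) * rip dw (z s).
  rewrite (ripBl (L2B Ls Lwt) (L2Z _ Ldw) Lzs) (ripBl Ls Lwt Lzs).
  by rewrite (ripZl _ Ldw Lzs).
have eZ : rip (w t) (fun x => z s x - z t x - (s - t)%:C%C * dz x) =
   rip (w t) (z s) - rip (w t) (z t) - (s - t) * rip (w t) dz.
  rewrite (ripBr (L2B Lzs Lzt) (L2Z _ Ldz) Lwt) (ripBr Lzs Lzt Lwt).
  by rewrite (ripZr _ Ldz Lwt).
have eD : rip dw (fun x => z s x - z t x) = rip dw (z s) - rip dw (z t) := ripBr Lzs Lzt Ldw.
have -> : rip (w s) (z s) - rip (w t) (z t) - (s - t) * (rip dw (z t) + rip (w t) dz) =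
  rip (fun x => w s x - w t x - (s - t)%:C%C * dw x) (z s) +
  (s - t) * rip dw (fun x => z s x - z t x) +
  rip (w t) (fun x => z s x - z t x - (s - t)%:C%C * dz x).
  by rewrite eW eZ eD; ring.
have b1 := rip_CS LD Lzs; have b2 := rip_CS Ldw (L2B Lzs Lzt); have b3 := rip_CS Lwt LE.
have zs := norm2_le_dist Lzs Lzt.
exact: (product_rule_arith e1_1 e1A b1 b2 b3 zs H1 H2 H3 (norm2_ge0 _) (norm2_ge0 _)
  (norm2_ge0 _) (norm2_ge0 _) (norm2_ge0 _)).
Qed.

Lemma eq_L2_der w w' t dw dw' : (forall s x, 0 <= s <= T -> 0 <= x <= 1 -> w s x = w' s x) ->
  (forall x, 0 <= x <= 1 -> dw x = dw' x) -> 0 <= t <= T -> L2_der w t dw -> L2_der w' t dw'.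
Proof.
move=> Ew Ed tT H e /H[r r0 {}H]; exists r => // s sT st.
rewrite -(eq_norm2 (f := fun x => w s x - w t x - (s - t)%:C%C * dw x)) ?H// => x x01.
by rewrite !Ew ?Ed//; lra.
Qed.

Lemma L2_der_lin (c : C) w z t dw dz : L2_curve w -> L2_curve z -> L2 dw -> L2 dz ->
  0 <= t <= T -> L2_der w t dw -> L2_der z t dz ->
  L2_der (fun s x => c * w s x + z s x) t (fun x => c * dw x + dz x).
Proof.
move=> Lw Lz Ldw Ldz tT Hw Hz e e0.
have K0 : 0 < normc c + 1 by rewrite ltr_wpDl// normc_ge0.
have ek : 0 < e / (normc c + 1) by rewrite divr_gt0.
have [r1 r10 H1] := Hw _ ek; have [r2 r20 H2] := Hz _ ek.
exists (Num.min r1 r2); first by rewrite lt_min r10.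
move=> s sT; rewrite lt_min => /andP[s1 s2].
have {}H1 := H1 s sT s1; have {}H2 := H2 s sT s2.
have LD := L2_rest Lw Ldw tT sT; have LE := L2_rest Lz Ldz tT sT.
rewrite (eq_norm2 (g := fun x => c * (w s x - w t x - (s - t)%:C%C * dw x) +
  (z s x - z t x - (s - t)%:C%C * dz x))); last by move=> x _; ring.
apply: (le_trans (norm2D (L2Z c LD) LE)); rewrite norm2Z// -normc_reim.
apply: (le_trans (lerD (ler_wpM2l (normc_ge0 c) H1) H2)).
by rewrite le_eqVlt; apply/orP; left; apply/eqP; field; rewrite gt_eqF.
Qed.

Lemma L2_mul_cont (b f : R -> C) : cont01 b -> L2 f -> L2 (fun x => b x * f x).
Proof.
move=> [cr ci] /L2P[fr fi].
have bd (q : R -> R) (p : R -> R) : {within `[0, 1], continuous q} -> square_int p ->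
    square_int (fun x => q x * p x).
  exact: square_int_mul_cont.
apply/L2P; split.
  have := square_intDZ (-1) (bd _ _ ci fi) (bd _ _ cr fr).
  by have -> // : (fun x => -1 * (im (b x) * im (f x)) + re (b x) * re (f x)) =
    fun x => re (b x * f x); apply/funext => x; rewrite !reimE; ring.
have := square_intDZ 1 (bd _ _ cr fi) (bd _ _ ci fr).
by have -> // : (fun x => 1 * (re (b x) * im (f x)) + im (b x) * re (f x)) =
  fun x => im (b x * f x); apply/funext => x; rewrite !reimE; ring.
Qed.

Lemma norm2_mul_sup (b f : R -> C) (c : R) : cont01 b -> L2 f -> 0 <= c ->
  (forall x, 0 <= x <= 1 -> normc (b x) <= c) -> norm2 (fun x => b x * f x) <= c * norm2 f.
Proof.
move=> cb Lf c0 H; have Lbf := L2_mul_cont cb Lf.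
apply: norm2_le; first by rewrite mulr_ge0// norm2_ge0.
rewrite exprMn (norm2_sqr f) ripE ripE -RintegralZl; [|exact: measurable_Dom|exact: rip_int].
apply: le_Rintegral; [exact: measurable_Dom|exact: rip_int|exact/int_on_DZ/rip_int|].
move=> x; rewrite DomE => x01; rewrite -!expr2 -!normc_sqr Normc.normcM exprMn.
rewrite ler_wpM2r ?sqr_ge0// lerXn2r ?nnegrE ?normc_ge0//; apply: H; lra.
Qed.

End curves.

Lemma mul_curve_arith {R : realType} (e e1 tau K K' a b c nw ns n1 n2 : R) :
  0 <= K -> 0 <= K' -> e1 <= 1 -> 0 <= e1 -> e1 * (2 * (nw + 1) + K' + K) <= e ->
  a <= 2 * (e1 * `|tau|) * ns -> b <= K' * n1 -> c <= K * n2 -> ns <= n1 + nw ->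
  n1 <= e1 -> n2 <= e1 * `|tau| -> 0 <= nw ->
  a + (`|tau| * b + c) <= e * `|tau|.
Proof.
move=> K0 K'0 e11 e10 eA ha hb hc hn h1 h2 nw0; have t0 := normr_ge0 tau.
apply: le_trans (ler_wpM2r t0 eA).
have c1 : 2 * (e1 * `|tau|) * ns <= 2 * (e1 * `|tau|) * (nw + 1).
  by rewrite ler_wpM2l ?mulr_ge0//; lra.
have c2 : `|tau| * b <= `|tau| * (K' * e1).
  by rewrite ler_wpM2l// (le_trans hb)// ler_wpM2l.
have c3 : K * n2 <= K * (e1 * `|tau|) by rewrite ler_wpM2l.
have -> : e1 * (2 * (nw + 1) + K' + K) * `|tau| = 2 * (e1 * `|tau|) * (nw + 1) +
  (`|tau| * (K' * e1) + K * (e1 * `|tau|)) by ring.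
by rewrite !lerD// ?(le_trans ha c1)// (le_trans hc c3).
Qed.

Section smooth.
Context {R : realType}.
Local Notation C := R[i].
Local Notation leb := (@lebesgue_measure R).
Variable T : R.
Hypothesis T_gt0 : 0 < T.
Implicit Types (u v w : R -> R -> C).

Lemma normc_le_add (z : C) : normc z <= `|re z| + `|im z|.
Proof.
apply: normc_le; first exact: addr_ge0.
rewrite sqrrD !real_normK ?num_real// -addrA lerD2l lerDr.
by rewrite mulrn_wge0// mulr_ge0.
Qed.

Lemma norm2_le_parts (f : R -> C) (c : R) : cont01 f ->
  (forall x, 0 <= x <= 1 -> `|re (f x)| <= c /\ `|im (f x)| <= c) -> norm2 f <= 2 * c.
Proof.
move=> cf H; have c0 : 0 <= c.
  by have [|h _] := H 0; [rewrite lexx ler01|exact: le_trans h].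
apply: norm2_le_sup => //; first by rewrite mulr_ge0.
move=> x x01; have [|h1 h2] := H x; first lra.
by rewrite (le_trans (normc_le_add _))// mulr2n mulrDl mul1r lerD.
Qed.

Lemma Ck_cont k v : Ck_rect T k v ->
  rect_cont T (fun t x => re (v t x)) /\ rect_cont T (fun t x => im (v t x)).
Proof. by case: k => [|k] /= [[]]. Qed.

Lemma CkS k v : Ck_rect T k.+1 v -> Ck_rect T k v.
Proof.
elim: k v => [|k IH] v [c [d Ht Hx]]; first by split.
exact: (conj c (And3 d (IH _ Ht) (IH _ Hx))).
Qed.

Lemma Ck_le k l v : (l <= k)%N -> Ck_rect T k v -> Ck_rect T l v.
Proof.
elim: k => [|k IH]; first by rewrite leqn0 => /eqP ->.
by rewrite leq_eqVlt ltnS => /orP[/eqP -> //|lk] /CkS; exact: IH.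
Qed.

Lemma Ck_Dt k v : Ck_rect T k.+1 v -> Ck_rect T k (Dt T v).
Proof. by case=> _ []. Qed.

Lemma Ck_Dx k v : Ck_rect T k.+1 v -> Ck_rect T k (Dx v).
Proof. by case=> _ []. Qed.

Lemma Ck_iter_Dx l k v : Ck_rect T (k + l) v -> Ck_rect T k (iter l Dx v).
Proof.
elim: l k => [|l IH] k; first by rewrite addn0.
by rewrite addnS -addSn => /IH /Ck_Dx.
Qed.

Lemma Ck_iter_Dt l k v : Ck_rect T (k + l) v -> Ck_rect T k (iter l (Dt T) v).
Proof.
elim: l k => [|l IH] k; first by rewrite addn0.
by rewrite addnS -addSn => /IH /Ck_Dt.
Qed.

Lemma Ck_has_dert k v t x : Ck_rect T k.+1 v -> 0 <= t <= T -> 0 <= x <= 1 ->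
  has_cder 0 T (fun s => v s x) t (Dt T v t x).
Proof.
move=> [_ [d _ _]] tT x01; have [[dr di] _] := d t x tT x01.
by split; exact: derivable_has_der.
Qed.

Lemma Ck_has_derx k v t x : Ck_rect T k.+1 v -> 0 <= t <= T -> 0 <= x <= 1 ->
  has_cder 0 1 (v t) x (Dx v t x).
Proof.
move=> [_ [d _ _]] tT x01; have [_ [dr di]] := d t x tT x01.
by split; exact: derivable_has_der.
Qed.

Lemma Ck_cont01 k v t : Ck_rect T k v -> 0 <= t <= T -> cont01 (v t).
Proof. by move=> /Ck_cont[cr ci] tT; split;
  [exact: (rect_slice_x (g := fun t x => re (v t x)) cr tT)|
   exact: (rect_slice_x (g := fun t x => im (v t x)) ci tT)]. Qed.

Lemma Ck_L2 k v : Ck_rect T k v -> L2_curve T v.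
Proof. by move=> H t tT; apply: cont01_L2; exact: Ck_cont01 H tT. Qed.

Lemma Clairaut v t x : Ck_rect T 2 v -> 0 <= t <= T -> 0 <= x <= 1 ->
  Dt T (Dx v) t x = Dx (Dt T v) t x.
Proof.
move=> H tT x01; have Hx := Ck_Dx H; have Ht := Ck_Dt H.
have [c1 c2] := Ck_cont (Ck_Dt Hx); have [c3 c4] := Ck_cont (Ck_Dx Ht).
apply: complex_ext.
  apply: (mixed_partials T_gt0 (g := fun t x => re (v t x)) (gt := fun t x => re (Dt T v t x))
    (gx := fun t x => re (Dx v t x)) (gtx := fun t x => re (Dt T (Dx v) t x))
    (gxt := fun t x => re (Dx (Dt T v) t x))) => // s y sT y01.
  - by have [] := Ck_has_dert H sT y01.
  - by have [] := Ck_has_derx H sT y01.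
  - by have [] := Ck_has_dert Hx sT y01.
  - by have [] := Ck_has_derx Ht sT y01.
apply: (mixed_partials T_gt0 (g := fun t x => im (v t x)) (gt := fun t x => im (Dt T v t x))
  (gx := fun t x => im (Dx v t x)) (gtx := fun t x => im (Dt T (Dx v) t x))
  (gxt := fun t x => im (Dx (Dt T v) t x))) => // s y sT y01.
- by have [] := Ck_has_dert H sT y01.
- by have [] := Ck_has_derx H sT y01.
- by have [] := Ck_has_dert Hx sT y01.
- by have [] := Ck_has_derx Ht sT y01.
Qed.

Lemma Ck_rest_parts v t s x : re (v s x - v t x - (s - t)%:C%C * Dt T v t x) =
    re (v s x) - re (v t x) - (s - t) * re (Dt T v t x) /\
  im (v s x - v t x - (s - t)%:C%C * Dt T v t x) =
    im (v s x) - im (v t x) - (s - t) * im (Dt T v t x).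
Proof. by rewrite !reimE; split; ring. Qed.

Lemma Ck_rest_cont01 v t s : Ck_rect T 1 v -> 0 <= t <= T -> 0 <= s <= T ->
  cont01 (fun x => v s x - v t x - (s - t)%:C%C * Dt T v t x).
Proof.
move=> H tT sT; have c1 := Ck_cont01 H tT; have c2 := Ck_cont01 H sT.
have c3 := Ck_cont01 (Ck_Dt H) tT.
have := cont01_lin (- (s - t)%:C%C) c3 (cont01_lin (-1) c1 c2).
have -> // : (fun x => - (s - t)%:C%C * Dt T v t x + (-1 * v t x + v s x)) =
  fun x => v s x - v t x - (s - t)%:C%C * Dt T v t x.
by apply/funext => x; ring.
Qed.

Lemma Ck_L2_der v t : Ck_rect T 1 v -> 0 <= t <= T -> L2_der T v t (Dt T v t).
Proof.
move=> H tT e e0; have e2 : 0 < e / 2 by rewrite divr_gt0.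
have [cr ci] := Ck_cont (Ck_Dt H).
have Hr s x : 0 <= s <= T -> 0 <= x <= 1 -> has_der 0 T (fun s => re (v s x)) s (re (Dt T v s x)).
  by move=> sT x01; have [] := Ck_has_dert H sT x01.
have Hi s x : 0 <= s <= T -> 0 <= x <= 1 -> has_der 0 T (fun s => im (v s x)) s (im (Dt T v s x)).
  by move=> sT x01; have [] := Ck_has_dert H sT x01.
have [r1 r10 H1] := rect_der_unif Hr cr tT e2.
have [r2 r20 H2] := rect_der_unif Hi ci tT e2.
exists (Num.min r1 r2); first by rewrite lt_min r10.
move=> s sT; rewrite lt_min => /andP[s1 s2].
have -> : e * `|s - t| = 2 * (e / 2 * `|s - t|) by field.
apply: norm2_le_parts; first exact: Ck_rest_cont01.
move=> x x01; have [-> ->] := Ck_rest_parts v t s x.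
by split; [exact: H1|exact: H2].
Qed.

Lemma Ck_norm2_cont v : Ck_rect T 0 v -> {within `[0, T], continuous (fun t => norm2 (v t))}.
Proof.
move=> H; apply/within_itv_continuousP => t tT e e0.
have e2 : 0 < e / 2 by rewrite divr_gt0.
have [cr ci] := Ck_cont H.
have [r1 r10 H1] := rect_unif cr tT e2; have [r2 r20 H2] := rect_unif ci tT e2.
exists (Num.min r1 r2); first by rewrite lt_min r10.
move=> s sT; rewrite lt_min => /andP[s1 s2].
have ct := Ck_cont01 H tT; have cs := Ck_cont01 H sT.
apply: (le_trans (norm2_dist (cont01_L2 cs) (cont01_L2 ct))).
have -> : e = 2 * (e / 2) by field.
apply: norm2_le_parts.
  have := cont01_lin (-1) ct cs.
  by have -> // : (fun x => -1 * v t x + v s x) = fun x => v s x - v t x; apply/funext => x; ring.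
by move=> x x01; rewrite !reimE; split; [exact: H1|exact: H2].
Qed.

Lemma wderiv_smooth v t : Ck_rect T 1 v -> 0 <= t <= T -> is_wderiv (v t) (Dx v t).
Proof.
move=> H tT; apply: classical_wderiv; last exact: Ck_cont01 (Ck_Dx H) tT.
by move=> x x01; exact: Ck_has_derx H tT x01.
Qed.

Lemma Hs_smooth k v t : Ck_rect T k v -> 0 <= t <= T -> Hs k (v t).
Proof.
elim: k v => [|k IH] v H tT; first by split => //; exact: (Ck_L2 H tT).
split; first exact: (Ck_L2 H tT).
exists (Dx v t); last by apply: IH => //; exact: Ck_Dx.
by apply: wderiv_smooth => //; exact: Ck_le H.
Qed.

Lemma Hs0_smooth k v t : Ck_rect T k v -> 0 <= t <= T -> v t 0 = 0 -> Hs0 k (v t).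
Proof. by move=> H tT v0; split => //; [exact: Hs_smooth|exact: Ck_cont01 H tT]. Qed.

Lemma iter_wderiv_smooth l v t : Ck_rect T l v -> 0 <= t <= T ->
  L2 (iter l wderiv (v t)) /\ ae_eqD (iter l wderiv (v t)) (iter l Dx v t).
Proof.
elim: l v => [|l IH] v H tT.
  by split; [exact: (Ck_L2 H tT)|exact: eqD_ae].
have [L E] := IH v (CkS H) tT.
have Hl : Ck_rect T 1 (iter l Dx v) by apply: Ck_iter_Dx; rewrite add1n.
have W := wderiv_smooth Hl tT.
have Ew : wderiv (iter l wderiv (v t)) = wderiv (iter l Dx v t).
  by apply: wderiv_ext => //; exact: (Ck_L2 Hl tT).
rewrite !iterS Ew; split; last exact: wderiv_ae W.
exact: is_wderiv_L2 (wderivP W).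
Qed.

Lemma norm2_iter_smooth l v t : Ck_rect T l v -> 0 <= t <= T ->
  norm2 (iter l wderiv (v t)) = norm2 (iter l Dx v t).
Proof.
move=> H tT; have [L E] := iter_wderiv_smooth H tT; apply: norm2_ae => //.
have Hl : Ck_rect T 0 (iter l Dx v) by apply: Ck_iter_Dx; rewrite add0n.
exact: (Ck_L2 Hl tT).
Qed.

(** For smooth v the iterated weak derivatives agree almost everywhere with the
    classical ones, whose L2 norms depend continuously on time. *)
Lemma sob_norm_cont k v : Ck_rect T k v ->
  {within `[0, T], continuous (fun t => sob_norm k (v t) ^+ 2)}.
Proof.
move=> H; suff : {within `[0, T], continuous (fun t => \sum_(l < k.+1) norm2 (iter l Dx v t) ^+ 2)}.
  move=> /within_itv_continuousP c; apply/within_itv_continuousP => t tT e e0.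
  have E s : 0 <= s <= T -> sob_norm k (v s) ^+ 2 = \sum_(l < k.+1) norm2 (iter l Dx v s) ^+ 2.
    move=> sT; rewrite sob_norm_sqr; apply: eq_bigr => l _.
    by rewrite norm2_iter_smooth//; apply: Ck_le H; rewrite -ltnS.
  have [d d0 Hd] := c t tT e e0; exists d => // s sT st.
  by rewrite !E//; exact: Hd.
have cl l : (l <= k)%N -> {within `[0, T], continuous (fun t => norm2 (iter l Dx v t))}.
  by move=> lk; apply/Ck_norm2_cont/Ck_iter_Dx; rewrite add0n; exact: Ck_le H.
have : forall n, (n <= k.+1)%N ->
   {within `[0, T], continuous (fun t => \sum_(l < n) norm2 (iter l Dx v t) ^+ 2)}.
  elim=> [_|n IH nk].
    have -> : (fun t => \sum_(l < 0) norm2 (iter l Dx v t) ^+ 2) = cst 0.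
      by apply/funext => t; rewrite big_ord0.
    exact: within_cst.
  have -> : (fun t => \sum_(l < n.+1) norm2 (iter l Dx v t) ^+ 2) =
     fun t => \sum_(l < n) norm2 (iter l Dx v t) ^+ 2 + norm2 (iter n Dx v t) * norm2 (iter n Dx v t).
    by apply/funext => t; rewrite big_ord_recr /= expr2.
  by apply: within_add; [exact/IH/ltnW|apply: within_mul; exact: cl].
exact.
Qed.

(** By Clairaut, the x-derivative of the remainder is the remainder of the
    x-derivative. *)
Lemma Ck_H1_der v t : Ck_rect T 2 v -> 0 <= t <= T -> forall e : R, 0 < e ->
  exists2 r, 0 < r & forall s, 0 <= s <= T -> `|s - t| < r ->
  norm2 (wderiv (fun x => v s x - v t x - (s - t)%:C%C * Dt T v t x)) <= e * `|s - t|.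
Proof.
move=> H tT e e0; have H1 := CkS H; have Hx := Ck_Dx H; have Ht := Ck_Dt H.
have [r r0 Hr] := Ck_L2_der Hx tT e0; exists r => // s sT st.
have Ls := Ck_L2 H sT; have Lt := Ck_L2 H tT; have Ld := Ck_L2 Ht tT.
have W1 := is_wderiv_lin (-1) Lt Ls (wderiv_smooth H1 tT) (wderiv_smooth H1 sT).
have W := is_wderiv_lin (- (s - t)%:C%C) Ld (L2_lin (-1) Lt Ls) (wderiv_smooth Ht tT) W1.
have E : (fun x => - (s - t)%:C%C * Dt T v t x + (-1 * v t x + v s x)) =
   fun x => v s x - v t x - (s - t)%:C%C * Dt T v t x by apply/funext => x; ring.
rewrite -E (norm2_wderiv W); apply: le_trans (Hr s sT st).
rewrite (eq_norm2 (g := fun x => Dx v s x - Dx v t x - (s - t)%:C%C * Dt T (Dx v) t x))//.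
move=> x x01; rewrite Clairaut//; last by lra.
by ring.
Qed.

Lemma Dt_zero v t : Ck_rect T 1 v -> (forall s, 0 <= s <= T -> v s 0 = 0) ->
  0 <= t <= T -> Dt T v t 0 = 0.
Proof.
move=> H v0 tT; have [] := Ck_has_dert H tT (x := 0); first by rewrite lexx ler01.
have z (g : R -> R) (d : R) : (forall s, 0 <= s <= T -> g s = 0) -> has_der 0 T g t d -> d = 0.
  move=> g0 hd; have hc := eq_has_der tT g0 hd.
  have h0 : has_der 0 T (fun=> 0) t (0 : R).
    by move=> e e0; exists 1 => // y _ _; rewrite mulr0 !subr0 normr0 mulr_ge0// ltW.
  have [_ E1] := has_der_der T_gt0 tT hc; have [_ E2] := has_der_der T_gt0 tT h0.
  by rewrite -E1 E2.
move=> /z zr /z zi; apply: complex_ext; first by apply: zr => s /v0 ->.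
by apply: zi => s /v0 ->.
Qed.

Lemma rect_normc_bounded k v : Ck_rect T k v -> exists2 K, 0 <= K &
  forall t x, 0 <= t <= T -> 0 <= x <= 1 -> normc (v t x) <= K.
Proof.
move=> /Ck_cont[cr ci]; have [K1 K10 H1] := rect_bounded T_gt0 cr.
have [K2 K20 H2] := rect_bounded T_gt0 ci.
exists (K1 + K2); first exact: addr_ge0.
by move=> t x tT x01; rewrite (le_trans (normc_le_add _))// lerD ?H1 ?H2.
Qed.

Lemma L2_der_mul (b : R -> R -> C) w t dw : Ck_rect T 1 b -> L2_curve T w -> L2 dw ->
  0 <= t <= T -> L2_der T w t dw ->
  L2_der T (fun s x => b s x * w s x) t (fun x => Dt T b t x * w t x + b t x * dw x).
Proof.
move=> Hb Lw Ld tT Hw e e0.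
have [K K0 HK] := rect_normc_bounded Hb.
have [K' K'0 HK'] := rect_normc_bounded (Ck_Dt Hb).
have [cr ci] := Ck_cont (Ck_Dt Hb).
pose A := 2 * (norm2 (w t) + 1) + K' + K.
have A0 : 0 < A by rewrite /A; have := norm2_ge0 (w t); lra.
pose e1 := Num.min 1 (e / A).
have e10 : 0 < e1 by rewrite lt_min ltr01 divr_gt0.
have e11 : e1 <= 1 by rewrite ge_min lexx.
have e1A : e1 * A <= e by rewrite -ler_pdivlMr// ge_min lexx orbT.
have Hr s x : 0 <= s <= T -> 0 <= x <= 1 -> has_der 0 T (fun s => re (b s x)) s (re (Dt T b s x)).
  by move=> sT x01; have [] := Ck_has_dert Hb sT x01.
have Hi s x : 0 <= s <= T -> 0 <= x <= 1 -> has_der 0 T (fun s => im (b s x)) s (im (Dt T b s x)).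
  by move=> sT x01; have [] := Ck_has_dert Hb sT x01.
have [r1 r10 H1] := rect_der_unif Hr cr tT e10.
have [r2 r20 H2] := rect_der_unif Hi ci tT e10.
have [r3 r30 H3] := L2_der_cont Lw Ld tT Hw e10.
have [r4 r40 H4] := Hw e1 e10.
exists (Num.min (Num.min r1 r2) (Num.min r3 r4)); first by rewrite !lt_min r10 r20 r30.
move=> s sT; rewrite !lt_min => /andP[/andP[s1 s2] /andP[s3 s4]].
have {}H3 := H3 s sT s3; have {}H4 := H4 s sT s4.
have Ls := Lw s sT; have Lt := Lw t tT.
have cb := Ck_rest_cont01 Hb tT sT.
have cb' := Ck_cont01 (Ck_Dt Hb) tT; have cbt := Ck_cont01 Hb tT.
have LD := L2_rest Lw Ld tT sT.
have LB := L2B Ls Lt.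
rewrite (eq_norm2 (g := fun x => (b s x - b t x - (s - t)%:C%C * Dt T b t x) * w s x +
   ((s - t)%:C%C * (Dt T b t x * (w s x - w t x)) +
    b t x * (w s x - w t x - (s - t)%:C%C * dw x)))); last by move=> x _; ring.
have L1 := L2_mul_cont cb Ls; have L2' := L2_mul_cont cb' LB.
have L3 := L2_mul_cont cbt LD.
apply: (le_trans (norm2D L1 (L2D (L2Z _ L2') L3))).
have n1 : norm2 (fun x => (b s x - b t x - (s - t)%:C%C * Dt T b t x) * w s x) <=
    2 * (e1 * `|s - t|) * norm2 (w s).
  apply: norm2_mul_sup => //; first by rewrite !mulr_ge0// ltW.
  move=> x x01; apply: (le_trans (normc_le_add _)).
  have [-> ->] := Ck_rest_parts b t s x.
  have -> : 2 * (e1 * `|s - t|) = e1 * `|s - t| + e1 * `|s - t| by ring.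
  by apply: lerD; [exact: H1|exact: H2].
have n2 : norm2 (fun x => Dt T b t x * (w s x - w t x)) <= K' * norm2 (fun x => w s x - w t x).
  by apply: norm2_mul_sup => // x x01; exact: HK'.
have n3 : norm2 (fun x => b t x * (w s x - w t x - (s - t)%:C%C * dw x)) <=
    K * norm2 (fun x => w s x - w t x - (s - t)%:C%C * dw x).
  by apply: norm2_mul_sup => // x x01; exact: HK.
have n4 := norm2D (L2Z (s - t)%:C%C L2') L3.
have n5 := norm2_le_dist Ls Lt.
rewrite (norm2_real _ L2') in n4.
apply: (le_trans (lerD (lexx _) n4)).
exact: (mul_curve_arith K0 K'0 e11 (ltW e10) e1A n1 n2 n3 n5 H3 H4 (norm2_ge0 _)).
Qed.

End smooth.

(** * Scalar functions of time *)

Section scalar_calculus.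
Context {R : realType}.
Local Notation leb := (@lebesgue_measure R).
Implicit Types (f g : R -> R) (x a b c : R).

Lemma is_der_add f g x a b : is_derive x 1 f a -> is_derive x 1 g b ->
  is_derive x 1 (fun y => f y + g y) (a + b).
Proof. by move=> hf hg; exact: is_deriveD. Qed.

Lemma is_der_sub f g x a b : is_derive x 1 f a -> is_derive x 1 g b ->
  is_derive x 1 (fun y => f y - g y) (a - b).
Proof. by move=> hf hg; exact: is_deriveB. Qed.

Lemma is_der_mul f g x a b : is_derive x 1 f a -> is_derive x 1 g b ->
  is_derive x 1 (fun y => f y * g y) (a * g x + f x * b).
Proof.
move=> hf hg; have := is_deriveM hf hg; rewrite /GRing.scale /= addrC.
by rewrite [g x * a]mulrC.
Qed.

Lemma is_der_scale f x a c : is_derive x 1 f a -> is_derive x 1 (fun y => c * f y) (c * a).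
Proof.
by move=> hf; have := is_der_mul (is_derive_cst c x (1 : R)) hf; rewrite mul0r add0r.
Qed.

Lemma is_der_comp f g x a b : is_derive (g x) 1 f a -> is_derive x 1 g b ->
  is_derive x 1 (fun y => f (g y)) (b * a).
Proof.
move=> hf hg; have := @is_derive1_comp _ f g x a b hf hg.
by rewrite mulrC.
Qed.

Lemma is_der_subl x c : is_derive x 1 (fun y => c - y) (-1).
Proof.
have := is_der_sub (is_derive_cst c x (1 : R)) (is_derive_id x (1 : R)).
by rewrite sub0r.
Qed.

Lemma is_der_sqrt_subl x t : x < t ->
  is_derive x 1 (fun y => Num.sqrt (t - y)) (- (2 * Num.sqrt (t - x))^-1).
Proof.
move=> xt; have h : 0 < t - x by rewrite subr_gt0.
by have := is_der_comp (g := fun y => t - y) (is_derive1_sqrt h) (is_der_subl x t); rewrite mulN1r.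
Qed.

Lemma is_der_expN x c : is_derive x 1 (fun y => expR (- (c * y))) (- c * expR (- (c * x))).
Proof.
have h : is_derive x 1 (fun y => - (c * y)) (- c).
  have := is_der_scale (- c) (is_derive_id x (1 : R)); rewrite mulr1.
  by have -> : (fun y => - c * id y) = fun y => - (c * y) by apply/funext => y; rewrite mulNr.
exact: is_der_comp (is_derive_expR _) h.
Qed.

Lemma within_sub f g (A : set R) : {within A, continuous f} ->
  {within A, continuous g} -> {within A, continuous (fun x => f x - g x)}.
Proof. by move=> cf cg x; apply: cvgB; [exact: cf|exact: cg]. Qed.

Lemma within_id (A : set R) : {within A, continuous (fun x : R => x)}.
Proof. by apply: continuous_subspaceT => x; exact: cvg_id. Qed.

Lemma within_comp f g (A : set R) : continuous f -> {within A, continuous g} ->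
  {within A, continuous (fun x => f (g x))}.
Proof. by move=> cf cg x; apply: (continuous_comp (cg x)); exact: cf. Qed.

Lemma within_sqrt_subl t (A : set R) : {within A, continuous (fun y => Num.sqrt (t - y))}.
Proof.
apply: within_comp; first exact: sqrt_continuous.
by apply: within_sub; [exact: within_cst|exact: within_id].
Qed.

Lemma within_expN c (A : set R) : {within A, continuous (fun y => expR (- (c * y)))}.
Proof.
apply: (@within_comp (fun y => expR (- y))).
  by move=> y; apply: continuous_comp; [exact: opp_continuous|exact: continuous_expR].
by apply: within_mul; [exact: within_cst|exact: within_id].
Qed.

Variable T : R.
Hypothesis T_gt0 : 0 < T.

Definition prim p s := \int[leb]_(x in `[0, s]) p x.

Lemma prim_props (p : R -> R) : {within `[0, T], continuous p} ->
  [/\ prim p 0 = 0, {within `[0, T], continuous (prim p)} &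
      forall s, 0 < s < T -> is_derive s 1 (prim p) (p s)].
Proof.
move=> cp; have ip : leb.-integrable `[0, T] (EFin \o p).
  by apply: continuous_compact_integrable => //; exact: segment_compact.
split.
- by rewrite /prim set_itv1 Rintegral_set1.
- by apply: parameterized_integral_continuous => //; exact: ltW.
move=> s /andP[s0 sT].
have [c _ _] := (continuous_within_itvP p T_gt0).1 cp.
have cs : {for s, continuous p} by apply: c; rewrite in_itv /= s0.
have [d e] := continuous_FTC1_closed sT ip s0 cs.
by split; [exact: d|rewrite -derive1E].
Qed.

Lemma within_sub_itv (p : R -> R) t : {within `[0, T], continuous p} -> t <= T ->
  {within `[0, t], continuous p}.
Proof.
by move=> cp tT; apply: continuous_subspaceW cp => x /=; rewrite !in_itv /=; lra.
Qed.

Lemma prim_mono (p : R -> R) a b : {within `[0, T], continuous p} ->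
  (forall s, 0 <= s <= T -> 0 <= p s) -> 0 <= a -> a <= b -> b <= T -> prim p a <= prim p b.
Proof.
move=> cp p0 a0 ab bT; have [_ c d] := prim_props cp.
rewrite -lerN2; apply: (nonincreasing_between (f := fun s => - prim p s) (df := fun s => - p s)) => //.
- move=> x xab; have := is_der_scale (-1) (d x ltac:(lra)); rewrite mulN1r.
  by have -> : (fun y => -1 * prim p y) = fun y => - prim p y by apply/funext => y; rewrite mulN1r.
- by move=> x xab; rewrite oppr_le0 p0//; lra.
- have cN : {within `[0, T], continuous (fun s => - prim p s)} by move=> x; apply: cvgN; exact: c.
  by apply: continuous_subspaceW cN => x /=; rewrite !in_itv /=; lra.
Qed.

Lemma prim_ge0 (p : R -> R) s : (forall s, 0 <= s <= T -> 0 <= p s) -> 0 <= s <= T -> 0 <= prim p s.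
Proof.
by move=> p0 sT; apply: Rintegral_ge0 => x; rewrite /= in_itv /= => xs; apply: p0; lra.
Qed.

Lemma prim_le (p q : R -> R) s : {within `[0, T], continuous p} -> {within `[0, T], continuous q} ->
  (forall s, 0 <= s <= T -> p s <= q s) -> 0 <= s <= T -> prim p s <= prim q s.
Proof.
move=> cp cq pq sT.
have i (f : R -> R) : {within `[0, T], continuous f} -> leb.-integrable `[0, s] (EFin \o f).
  move=> cf; apply: continuous_compact_integrable; first exact: segment_compact.
  by apply: within_sub_itv => //; lra.
apply: le_Rintegral => //; [exact: i|exact: i|].
by move=> x; rewrite /= in_itv /= => xs; apply: pq; lra.
Qed.

Lemma prim_scale (p : R -> R) c s : {within `[0, T], continuous p} -> 0 <= s <= T ->
  prim (fun x => c * p x) s = c * prim p s.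
Proof.
move=> cp sT; rewrite /prim RintegralZl//.
apply: continuous_compact_integrable; first exact: segment_compact.
by apply: within_sub_itv => //; lra.
Qed.

(** Where n vanishes it need not be differentiable, so sqrt(n^2 + e^2) is
    estimated instead and e tends to 0. *)
Lemma norm_growth (n k N' : R -> R) : (forall s, 0 <= s <= T -> 0 <= n s) ->
  {within `[0, T], continuous n} -> {within `[0, T], continuous k} ->
  (forall s, 0 < s < T -> is_derive s 1 (fun s => n s ^+ 2) (N' s)) ->
  (forall s, 0 < s < T -> N' s <= 2 * (n s * k s)) ->
  (forall s, 0 <= s <= T -> 0 <= k s) ->
  forall s, 0 <= s <= T -> n s <= n 0 + prim k s.
Proof.
move=> n0 cn ck dN bN k0 s sT; have [K0 cK dK] := prim_props ck.
apply/ler_addgt0Pr => e e0; have e2 : 0 < e ^+ 2 by rewrite exprn_gt0.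
pose g s := Num.sqrt (n s ^+ 2 + e ^+ 2) - prim k s.
have pos u : 0 < n u ^+ 2 + e ^+ 2 by rewrite ltr_wpDl// sqr_ge0.
have gs : g s <= g 0.
  apply: (nonincreasing_between (df := fun s => N' s * (2 * Num.sqrt (n s ^+ 2 + e ^+ 2))^-1 - k s)).
  - by case/andP: sT.
  - move=> x xs; have xT : 0 < x < T by lra.
    apply: is_der_sub (dK x xT); apply: (is_der_comp (g := fun s => n s ^+ 2 + e ^+ 2)).
      exact: is_derive1_sqrt.
    have := is_der_add (dN x xT) (is_derive_cst (e ^+ 2) x (1 : R)).
    by rewrite addr0.
  - move=> x xs; have xT : 0 < x < T by lra.
    have sp : 0 < Num.sqrt (n x ^+ 2 + e ^+ 2) by rewrite sqrtr_gt0.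
    rewrite subr_le0 ler_pdivrMr ?mulr_gt0//; apply: (le_trans (bN x xT)).
    have -> : 2 * (n x * k x) = k x * (2 * n x) by ring.
    rewrite ler_wpM2l//; first by apply: k0; lra.
    rewrite ler_wpM2l//.
    rewrite -[leLHS]ger0_norm; last by apply: n0; lra.
    by rewrite -sqrtr_sqr ler_wsqrtr// lerDl sqr_ge0.
  - apply: (@within_sub_itv g); last by case/andP: sT.
    apply: within_sub cK; apply: within_comp; first exact: sqrt_continuous.
    apply: within_add; last exact: within_cst.
    by apply: (@within_mul _ n n).
have h1 : n s <= Num.sqrt (n s ^+ 2 + e ^+ 2).
  rewrite -[leLHS]ger0_norm; last exact: n0.
  by rewrite -sqrtr_sqr ler_wsqrtr// lerDl sqr_ge0.
have h2 : Num.sqrt (n 0 ^+ 2 + e ^+ 2) <= n 0 + e.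
  have n00 : 0 <= n 0 by apply: n0; rewrite lexx ltW.
  rewrite -[leRHS]ger0_norm ?addr_ge0 ?(ltW e0)// -sqrtr_sqr ler_wsqrtr//.
  by rewrite sqrrD lerD2r lerDl mulrn_wge0// mulr_ge0// ltW.
by move: gs; rewrite /g K0 subr0; lra.
Qed.

(** Here lam stands for sqrt(t - s). By the arithmetic-geometric inequality
    sqrt(q X) <= (lam q + X / lam) / 2; the choice A c = C / 2 lets the
    dissipation - c q in Y' cancel the first half, and the second half costs a
    factor 1 / sqrt(t - s), which is integrable. *)
Lemma lyapunov_arith (C c A C1 C2 M lam st n0 kap k q X Y n m L' Y' : R) :
  0 <= C -> 0 < c -> 0 <= A -> A * c = C / 2 -> 0 <= C1 -> 0 <= C2 -> 0 <= M ->
  0 < lam -> lam <= st -> 0 <= n0 -> 0 <= kap -> 0 <= k -> 0 <= q -> 0 <= X ->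
  X <= C2 * M * (n0 + kap) -> - Y <= C * M * (n0 + kap) ->
  0 <= n -> n <= n0 + kap -> 0 <= m -> m <= M ->
  L' <= C * (Num.sqrt (q * X) + X + n * m) ->
  Y' <= - c * q + C1 * (k * M) ->
  L' + A * (- (2 * lam)^-1 * Y + lam * Y') <=
  (C * C2 / 2 + C * C2 * st + C * st + A * C / 2) * M * (n0 + kap) / lam + A * C1 * M * (lam * k).
Proof.
move=> C0 c0 A0 Ac C10 C20 M0 l0 ls n00 kap0 k0 q0 X0 bX bY nn bn mm bm bL bY'.
have li0 : 0 < lam^-1 by rewrite invr_gt0.
set W := n0 + kap in bX bY bn *; have W0 : 0 <= W by rewrite addr_ge0.
have MW0 : 0 <= M * W by rewrite mulr_ge0.
have st1 : 1 <= st * lam^-1 by rewrite ler_pdivlMr// mul1r.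
have amgm : Num.sqrt (q * X) <= lam * q / 2 + X * lam^-1 / 2.
  have h : 0 <= lam * q / 2 + X * lam^-1 / 2 by rewrite addr_ge0// !mulr_ge0// ltW.
  rewrite -[leRHS]ger0_norm// -sqrtr_sqr ler_wsqrtr//.
  have -> : q * X = (lam * q) * (X * lam^-1) by field; rewrite gt_eqF.
  by have := sqr_ge0 (lam * q - X * lam^-1); rewrite !expr2; lra.
have b1 : C * Num.sqrt (q * X) <= C * (lam * q / 2 + X * lam^-1 / 2) by rewrite ler_wpM2l.
have b2 : C * (X * lam^-1 / 2) <= C * C2 / 2 * (M * W * lam^-1).
  have : C * (X * lam^-1) <= C * (C2 * M * W * lam^-1) by rewrite ler_wpM2l// ler_wpM2r// ltW.
  by lra.
have b3 : C * X <= C * C2 * st * (M * W * lam^-1).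
  apply: (@le_trans _ _ (C * (C2 * M * W))); first by rewrite ler_wpM2l.
  have -> : C * C2 * st * (M * W * lam^-1) = C * (C2 * M * W) * (st * lam^-1) by ring.
  by rewrite ler_peMr// !mulr_ge0.
have b4 : C * (n * m) <= C * st * (M * W * lam^-1).
  apply: (@le_trans _ _ (C * (W * M))); first by rewrite ler_wpM2l// ler_pM.
  have -> : C * st * (M * W * lam^-1) = C * (W * M) * (st * lam^-1) by ring.
  by rewrite ler_peMr// !mulr_ge0.
have b5 : A * (- (2 * lam)^-1 * Y) <= A * C / 2 * (M * W * lam^-1).
  have -> : A * (- (2 * lam)^-1 * Y) = A * lam^-1 / 2 * (- Y) by field; rewrite gt_eqF.
  apply: (@le_trans _ _ (A * lam^-1 / 2 * (C * M * W))).
    by rewrite ler_wpM2l// !mulr_ge0// ltW.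
  by rewrite le_eqVlt; apply/orP; left; apply/eqP; ring.
have b6 : A * (lam * Y') <= A * (lam * (- c * q + C1 * (k * M))).
  by rewrite !ler_wpM2l// ltW.
have b7 : A * (lam * (- c * q + C1 * (k * M))) = - (C / 2 * (lam * q)) + A * C1 * M * (lam * k).
  by rewrite -Ac; ring.
set z1 := M * W * lam^-1 in b2 b3 b4 b5.
have -> : L' + A * (- (2 * lam)^-1 * Y + lam * Y') =
  L' + A * (- (2 * lam)^-1 * Y) + A * (lam * Y') by ring.
have -> : (C * C2 / 2 + C * C2 * st + C * st + A * C / 2) * M * W / lam + A * C1 * M * (lam * k) =
  C * C2 / 2 * z1 + C * C2 * st * z1 + C * st * z1 + A * C / 2 * z1 + A * C1 * M * (lam * k).
  by rewrite /z1; ring.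
have b1' : C * Num.sqrt (q * X) <= C / 2 * (lam * q) + C * (X * lam^-1 / 2).
  by apply: (le_trans b1); rewrite le_eqVlt; apply/orP; left; apply/eqP; ring.
have bL' : L' <= C * Num.sqrt (q * X) + C * X + C * (n * m).
  by apply: (le_trans bL); rewrite !mulrDr.
move: bL' b1' b2 b3 b4 b5 b6; rewrite b7; clear.
move: (C * Num.sqrt (q * X)) (C * X) (C * (n * m)) (C / 2 * (lam * q)) (C * (X * lam^-1 / 2)).
move: (C * C2 / 2 * z1) (C * C2 * st * z1) (C * st * z1) (A * C / 2 * z1) (A * C1 * M * (lam * k)).
move: (A * (- (2 * lam)^-1 * Y)) (A * (lam * Y')).
by move=> a1 a2 a3 a4 a5 a6 a7 a8 a9 a10 a11 a12; lra.
Qed.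

End scalar_calculus.

(** * The scalar energy estimate *)

Section gronwall_arithmetic.
Context {R : realType}.

Lemma young_arith (e C' M x : R) : 0 < e ->
  C' * M * x <= e * M ^+ 2 + C' ^+ 2 / (4 * e) * x ^+ 2.
Proof.
move=> e0; rewrite -subr_ge0.
have -> : e * M ^+ 2 + C' ^+ 2 / (4 * e) * x ^+ 2 - C' * M * x =
  (2 * e * M - C' * x) ^+ 2 / (4 * e) by field; rewrite gt_eqF.
by rewrite divr_ge0 ?sqr_ge0// mulr_ge0// ltW.
Qed.

Lemma energy_arith (x z b u C a M w : R) : x = z + b -> z <= u -> b <= C * (M * w) ->
  u <= a * M * w -> x <= (a + C) * M * w.
Proof.
move=> -> zu bw ua; have -> : (a + C) * M * w = a * M * w + C * (M * w) by ring.
by rewrite lerD// (le_trans zu).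
Qed.

Lemma lyapunov_sum (dl ay c3w ak ck em ts6 ts : R) :
  dl + ay <= c3w + ak -> ak + ck <= em + ts -> ts6 = ts ->
  dl + ay + (- c3w + ck) - em - ts6 <= 0.
Proof. by move=> h1 h2 ->; lra. Qed.

Lemma weighted_sum (n2 nb ts dN k2 : R) : n2 <= nb -> 0 <= ts -> - dN <= 2 * k2 ->
  - (-1 * n2 + ts * dN) - nb - 2 * (ts * k2) <= 0.
Proof.
move=> h1 h2 h3; have := ler_wpM2l h2 h3.
have -> : - (-1 * n2 + ts * dN) - nb - 2 * (ts * k2) = n2 - nb + (ts * - dN - ts * (2 * k2)) by ring.
by lra.
Qed.

Lemma final_sum (l e t C3 C6 M sn tn2 P H K : R) : 0 < e -> 0 <= t -> 0 <= C6 -> 0 <= P -> 0 <= H ->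
  0 <= K -> l - e * M ^+ 2 * t - C6 * H <= 2 * C3 * M * sn ->
  2 * C3 * M * sn <= e * M ^+ 2 + K * tn2 -> tn2 <= P + 2 * H -> e * (1 + t) <= 4^-1 ->
  l <= M ^+ 2 / 4 + (C6 + 2 * K) * (P + H).
Proof.
move=> e0 t0 C60 P0 H0 K0 h1 h2 h3 h4.
have k1 := ler_wpM2l K0 h3; have k2 := ler_wpM2r (sqr_ge0 M) h4.
have k3 : 0 <= C6 * P by rewrite mulr_ge0.
have k4 : 0 <= K * P by rewrite mulr_ge0.
have -> : (C6 + 2 * K) * (P + H) = C6 * P + C6 * H + (K * (P + 2 * H) + K * P) by ring.
have e1 : e * (1 + t) * M ^+ 2 = e * M ^+ 2 + e * M ^+ 2 * t by ring.
by rewrite e1 in k2; lra.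
Qed.

Lemma absorb_arith (a1 a2 a3 a4 : R) : a1 <= a2 -> a4 <= a3 ->
  a3 / 2 <= a3 / 4 + a1 -> a4 <= 4 * a2.
Proof. by lra. Qed.

End gronwall_arithmetic.

Section gronwall.
Context {R : realType}.
Variable T : R.
Hypothesis T_gt0 : 0 < T.
Variable C : R.
Hypothesis C_ge0 : 0 <= C.

Let C1 := C ^+ 2 + C.
Let c' := expR (- (C * T)).
Let c := c' / 2.
Let C2 := C1 / c' + C.
Let A := C / c'.
Let C3 := C * C2 / 2 + C * C2 * Num.sqrt T + C * Num.sqrt T + A * C / 2.
Let C5 := A * C1 + 2 * C3.
Let eps := (4 * (1 + T))^-1.
Let C6 := C5 ^+ 2 / (4 * eps).

Let c'_gt0 : 0 < c'. Proof. exact: expR_gt0. Qed.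
Let C1_ge0 : 0 <= C1. Proof. by rewrite addr_ge0// sqr_ge0. Qed.
Let C2_ge0 : 0 <= C2. Proof. by rewrite addr_ge0// divr_ge0// ltW. Qed.
Let A_ge0 : 0 <= A. Proof. by rewrite divr_ge0// ltW. Qed.
Let C3_ge0 : 0 <= C3.
Proof.
have st := sqrtr_ge0 T; have cc : 0 <= C * C2 by rewrite mulr_ge0.
have h1 : 0 <= C * C2 / 2 by rewrite divr_ge0.
have h2 : 0 <= C * C2 * Num.sqrt T by rewrite mulr_ge0.
have h3 : 0 <= C * Num.sqrt T by rewrite mulr_ge0.
have h4 : 0 <= A * C / 2 by rewrite divr_ge0// mulr_ge0.
exact: (addr_ge0 (addr_ge0 (addr_ge0 h1 h2) h3) h4).
Qed.
Let eps_gt0 : 0 < eps.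
Proof. by rewrite invr_gt0 mulr_gt0// ltr_wpDl. Qed.
Let C6_ge0 : 0 <= C6.
Proof. by rewrite divr_ge0 ?sqr_ge0// mulr_ge0// ltW. Qed.
Let Ac : A * c = C / 2. Proof. by rewrite /A /c; field; rewrite gt_eqF. Qed.

(* In the application m and n are the L2 norms of the discrete error th and of its
   source F, X is the energy of th, q the dissipation at the boundary and B is
   Im (F, th) / a; k bounds the norms of F and of its time derivative. *)
Variables (m n k nb2 X B q dL dZ dN : R -> R).
Hypothesis pos : forall s, 0 <= s <= T ->
  [/\ 0 <= m s, 0 <= n s, 0 <= X s & 0 <= q s].
Hypothesis bnd : forall s, 0 <= s <= T ->
  [/\ n s <= k s, n s ^+ 2 <= nb2 s & `|B s| <= C * (n s * m s)].
Hypothesis cm : {within `[0, T], continuous m}.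
Hypothesis cn : {within `[0, T], continuous n}.
Hypothesis ck : {within `[0, T], continuous k}.
Hypothesis cnb : {within `[0, T], continuous nb2}.
Hypothesis cZ : {within `[0, T], continuous (fun s => X s - B s)}.
Hypothesis dL_der : forall s, 0 < s < T -> is_derive s 1 (fun s => m s ^+ 2 / 2) (dL s).
Hypothesis dL_le : forall s, 0 < s < T ->
  dL s <= C * (Num.sqrt (q s * X s) + X s + n s * m s).
Hypothesis dZ_der : forall s, 0 < s < T -> is_derive s 1 (fun s => X s - B s) (dZ s).
Hypothesis dZ_le : forall s, 0 < s < T -> dZ s <= - q s / 2 + C * X s + C * (k s * m s).
Hypothesis dN_der : forall s, 0 < s < T -> is_derive s 1 (fun s => n s ^+ 2) (dN s).
Hypothesis dN_le : forall s, 0 < s < T -> `|dN s| <= 2 * (n s * k s).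
Hypothesis m0 : m 0 = 0.
Hypothesis X0 : X 0 = 0.

Let kap := prim k.
Let K2 := prim (fun s => k s ^+ 2).
Let H := prim K2.
Let P := prim nb2.
Let Z s := X s - B s.
Let Y s := expR (- (C * s)) * Z s.

Let k_ge0 s : 0 <= s <= T -> 0 <= k s.
Proof. by move=> sT; have [_ h _ _] := pos sT; have [h' _ _] := bnd sT; exact: le_trans h'. Qed.

Let ck2 : {within `[0, T], continuous (fun s => k s ^+ 2)}.
Proof. by apply: (@within_mul _ k k). Qed.

Let kapP := prim_props T_gt0 ck.
Let K2P := prim_props T_gt0 ck2.
Let cK2 : {within `[0, T], continuous K2}. Proof. by case: K2P. Qed.
Let HP := prim_props T_gt0 cK2.
Let PP := prim_props T_gt0 cnb.

Let zT : 0 <= (0 : R) <= T. Proof. by rewrite lexx ltW. Qed.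

Let kap_ge0 s : 0 <= s <= T -> 0 <= kap s. Proof. exact: prim_ge0. Qed.
Let K2_ge0 s : 0 <= s <= T -> 0 <= K2 s.
Proof. by apply: prim_ge0 => u _; exact: sqr_ge0. Qed.
Let H_ge0 s : 0 <= s <= T -> 0 <= H s. Proof. exact: prim_ge0. Qed.
Let nb2_ge0 s : 0 <= s <= T -> 0 <= nb2 s.
Proof. by move=> /bnd[_ h _]; apply: le_trans h; exact: sqr_ge0. Qed.
Let P_ge0 s : 0 <= s <= T -> 0 <= P s. Proof. exact: prim_ge0. Qed.

Let n_le s : 0 <= s <= T -> n s <= n 0 + kap s.
Proof.
apply: (norm_growth T_gt0 _ cn ck dN_der _ k_ge0).
  by move=> u /pos[].
by move=> u uT; exact: le_trans (ler_norm _) (dN_le uT).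
Qed.

Let expN_itv s : 0 <= s <= T -> c' <= expR (- (C * s)) <= 1.
Proof.
move=> sT; rewrite /c' ler_expR lerN2 ler_wpM2l//=; last by case/andP: sT.
by rewrite -[leRHS]expR0 ler_expR oppr_le0 mulr_ge0//; case/andP: sT.
Qed.

Let Z0 : Z 0 = 0.
Proof.
have [_ _] := bnd zT; rewrite m0 !mulr0 normr_le0 => /eqP b0.
by rewrite /Z X0 b0 subrr.
Qed.

Definition energy_const := 4 * (C6 + 2 * (C3 ^+ 2 / eps)).

Lemma energy_const_ge0 : 0 <= energy_const.
Proof. by rewrite mulr_ge0// addr_ge0// mulr_ge0// divr_ge0 ?sqr_ge0// ltW. Qed.

Section fixed_time.
Variables (t M : R).
Hypothesis tT : 0 < t <= T.
Hypothesis mM : forall s, 0 <= s <= t -> m s <= M.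

Let inT s : 0 <= s <= t -> 0 <= s <= T. Proof. by have := tT; lra. Qed.
Let inT' s : 0 < s < t -> 0 < s < T. Proof. by have := tT; lra. Qed.
Let inT0 s : 0 < s < t -> 0 <= s <= t. Proof. lra. Qed.

Let M_ge0 : 0 <= M.
Proof. by apply: le_trans (mM (s := 0) _); rewrite ?m0// lexx; case/andP: tT => /ltW. Qed.

Let dY s := - C * expR (- (C * s)) * Z s + expR (- (C * s)) * dZ s.

Let dY_der s : 0 < s < t -> is_derive s 1 Y (dY s).
Proof. by move=> st; apply: is_der_mul; [exact: is_der_expN|exact/dZ_der/inT']. Qed.

Let cY : {within `[0, T], continuous Y}.
Proof. by apply: within_mul => //; exact: within_expN. Qed.

Let dY_le s : 0 < s < t -> dY s <= - c * q s + C1 * (k s * M).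
Proof.
move=> st; have sT := inT (inT0 st); have [m0' n0' x0' q0'] := pos sT.
have [nk _ bB] := bnd sT; have ms := mM (inT0 st); have dz := dZ_le (inT' st).
have /andP[e1 e2] := expN_itv sT; have k0' := k_ge0 sT.
have xz : X s <= Z s + C * (k s * M).
  have : B s <= C * (k s * M).
    apply: (le_trans (ler_norm _)); apply: (le_trans bB); rewrite ler_wpM2l//.
    exact: ler_pM.
  by rewrite /Z; lra.
have km : C * (k s * m s) <= C * (k s * M) by rewrite !ler_wpM2l.
have cx : C * X s <= C * (Z s + C * (k s * M)) by rewrite ler_wpM2l.
have -> : dY s = expR (- (C * s)) * (dZ s - C * Z s) by rewrite /dY; ring.
have h : dZ s - C * Z s <= - q s / 2 + C1 * (k s * M) by rewrite /C1; lra.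
apply: (le_trans (ler_wpM2l (ltW (expR_gt0 _)) h)); rewrite mulrDr; apply: lerD.
  rewrite !mulNr mulrN lerN2 /c [leLHS](_ : _ = c' * (q s / 2)); last by ring.
  by rewrite ler_wpM2r// divr_ge0.
by rewrite ler_piMl// mulr_ge0// mulr_ge0.
Qed.

Let within_t (f : R -> R) : {within `[0, T], continuous f} -> forall s, s <= t ->
  {within `[0, s], continuous f}.
Proof. by move=> cf s st; apply: (within_sub_itv cf); case/andP: tT => _; exact: le_trans. Qed.

Let Y_le s : 0 <= s <= t -> Y s <= C1 * M * kap s.
Proof.
move=> st; have [kap0 ckap dkap] := kapP.
suff : Y s - C1 * M * kap s <= Y 0 - C1 * M * kap 0.
  by rewrite [kap 0]kap0 /Y Z0 !mulr0 subr0; lra.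
apply: (nonincreasing_between (f := fun s => Y s - C1 * M * kap s)
  (df := fun s => dY s - C1 * M * k s)).
- by case/andP: st.
- move=> x xs; have xt : 0 < x < t by lra.
  by apply: is_der_sub; [exact: dY_der|apply: is_der_scale; exact/dkap/inT'].
- move=> x xs; have xt : 0 < x < t by lra.
  have := dY_le xt; have [_ _ _ q0'] := pos (inT (inT0 xt)).
  have : 0 <= c * q x by rewrite mulr_ge0// divr_ge0// ltW.
  by lra.
- apply: (@within_t (fun s => Y s - C1 * M * kap s)); last by case/andP: st.
  apply: within_sub => //; apply: within_mul; last exact: ckap.
  exact: within_cst.
Qed.

Let X_le s : 0 <= s <= t -> X s <= C2 * M * (n 0 + kap s).
Proof.
move=> st; have sT := inT st; have [m0' n0' x0' q0'] := pos sT.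
have [nk _ bB] := bnd sT; have ms := mM st; have /andP[e1 e2] := expN_itv sT.
have e0 : 0 < expR (- (C * s)) := expR_gt0 _.
have n00 : 0 <= n 0 by have [] := pos zT.
have kp := kap_ge0 sT.
have cm0 : 0 <= C1 * M * kap s by rewrite !mulr_ge0.
have zle : Z s <= C1 * M * kap s / c'.
  rewrite -(ler_pM2l e0) -/(Y s); apply: (le_trans (Y_le st)).
  rewrite mulrCA ler_peMr// ler_pdivlMr// mul1r//.
have bw : B s <= C * (M * (n 0 + kap s)).
  apply: (le_trans (ler_norm _)); apply: (le_trans bB); rewrite ler_wpM2l// mulrC.
  by apply: ler_pM => //; exact: n_le.
have : X s = Z s + B s by rewrite /Z subrK.
have h3 : C1 * M * kap s / c' <= C1 / c' * M * (n 0 + kap s).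
  have -> : C1 * M * kap s / c' = C1 / c' * M * kap s by ring.
  by rewrite ler_wpM2l ?lerDr// mulr_ge0// divr_ge0// ltW.
by move=> xe; rewrite /C2; exact: energy_arith xe zle bw h3.
Qed.

Let Y_ge s : 0 <= s <= t -> - Y s <= C * M * (n 0 + kap s).
Proof.
move=> st; have sT := inT st; have [m0' n0' x0' q0'] := pos sT.
have [nk _ bB] := bnd sT; have ms := mM st; have /andP[e1 e2] := expN_itv sT.
have n00 : 0 <= n 0 by have [] := pos zT.
have kp := kap_ge0 sT.
have e0 : 0 < expR (- (C * s)) := expR_gt0 _.
have bw : B s <= C * M * (n 0 + kap s).
  apply: (le_trans (ler_norm _)); apply: (le_trans bB); rewrite -mulrA ler_wpM2l// mulrC.
  by apply: ler_pM => //; exact: n_le.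
rewrite /Y -mulrN; have zb : - Z s <= C * M * (n 0 + kap s) by rewrite /Z; lra.
apply: (le_trans (ler_wpM2l (ltW e0) zb)); rewrite ler_piMl// !mulr_ge0// addr_ge0//.
Qed.

Let lam s := Num.sqrt (t - s).
(* After the Lyapunov functional m^2 / 2 + A lam Y come antiderivatives of the
   bounds for its derivative: the one of lam (n 0 + kap) contains
   - (n 0 + kap) / (2 lam), the last ones take care of lam k after Young. *)
Let D s := m s ^+ 2 / 2 + A * (lam s * Y s) + 2 * C3 * M * (lam s * (n 0 + kap s))
  - eps * M ^+ 2 * s - C6 * ((t - s) * K2 s + H s).
Let dD s := dL s + A * (- (2 * lam s)^-1 * Y s + lam s * dY s)
  + 2 * C3 * M * (- (2 * lam s)^-1 * (n 0 + kap s) + lam s * k s)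
  - eps * M ^+ 2 - C6 * ((t - s) * k s ^+ 2).

Let dD_der s : 0 < s < t -> is_derive s 1 D (dD s).
Proof.
move=> st; have sT := inT' st; have [_ _ dkap] := kapP; have [_ _ dK2] := K2P.
have [_ _ dH] := HP; have st' : s < t by case/andP: st.
have dl := is_der_sqrt_subl st'.
apply: is_der_sub.
  apply: is_der_sub.
    apply: is_der_add.
      apply: is_der_add; first exact: (dL_der sT).
      apply: is_der_scale; exact: (is_der_mul dl (dY_der st)).
    have dk : is_derive s 1 (fun s => n 0 + kap s) (k s).
      by have := is_der_add (is_derive_cst (n 0) s (1 : R)) (dkap s sT); rewrite add0r.
    exact: (is_der_scale _ (is_der_mul dl dk)).
  by have := is_der_scale (eps * M ^+ 2) (is_derive_id s (1 : R)); rewrite mulr1.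
apply: is_der_scale.
have := is_der_add (is_der_mul (is_der_subl s t) (dK2 s sT)) (dH s sT).
by have -> : -1 * prim (fun s => k s ^+ 2) s + (t - s) * k s ^+ 2 + K2 s = (t - s) * k s ^+ 2
  by rewrite /K2; ring.
Qed.

Let dD_le s : 0 < s < t -> dD s <= 0.
Proof.
move=> st; have st0 := inT0 st; have sT := inT st0; have [m0' n0' x0' q0'] := pos sT.
have [nk _ bB] := bnd sT; have kp := kap_ge0 sT; have k0' := k_ge0 sT.
have n00 : 0 <= n 0 by have [] := pos zT.
have l0 : 0 < lam s by rewrite sqrtr_gt0 subr_gt0; case/andP: st.
have ls : lam s <= Num.sqrt T by rewrite ler_wsqrtr//; have := tT; lra.
have cpos : 0 < c by rewrite divr_gt0.
have main := lyapunov_arith C_ge0 cpos A_ge0 Ac C1_ge0 C2_ge0 M_ge0 l0 ls n00 kp k0' q0' x0'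
  (X_le st0) (Y_ge st0) n0' (n_le sT) m0' (mM st0) (dL_le (inT' st)) (dY_le st).
have yg := young_arith C5 M (lam s * k s) eps_gt0.
have l2 : (lam s * k s) ^+ 2 = (t - s) * k s ^+ 2.
  by rewrite exprMn sqr_sqrtr// subr_ge0 ltW//; case/andP: st.
rewrite l2 -/C6 in yg.
have e1 : 2 * C3 * M * (- (2 * lam s)^-1 * (n 0 + kap s) + lam s * k s) =
   - (C3 * M * (n 0 + kap s) / lam s) + 2 * C3 * M * (lam s * k s).
  by field; rewrite gt_eqF.
have e2 : C5 * M * (lam s * k s) = A * C1 * M * (lam s * k s) + 2 * C3 * M * (lam s * k s).
  by rewrite /C5; ring.
rewrite e2 in yg; rewrite /dD e1; exact: lyapunov_sum main yg (erefl _).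
Qed.

Let cD : {within `[0, T], continuous D}.
Proof.
have [_ ckap _] := kapP; have [_ cH _] := HP.
have cst (a : R) (f : R -> R) : {within `[0, T], continuous f} ->
    {within `[0, T], continuous (fun s => a * f s)}.
  by move=> cf; apply: within_mul cf; exact: within_cst.
have cl : {within `[0, T], continuous lam} by exact: within_sqrt_subl.
apply: within_sub; last first.
  apply: (cst C6 (fun s => (t - s) * K2 s + H s)); apply: within_add => //.
  by apply: within_mul => //; apply: within_sub; [exact: within_cst|exact: within_id].
apply: within_sub; last by apply: (cst (eps * M ^+ 2) (fun s => s)); exact: within_id.
apply: within_add; last first.
  apply: (cst (2 * C3 * M) (fun s => lam s * (n 0 + kap s))); apply: within_mul => //.
  by apply: within_add; [exact: within_cst|].
apply: within_add; last by apply: (cst A (fun s => lam s * Y s)); exact: within_mul.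
by apply: (@within_mul _ (fun s => m s ^+ 2) (fun=> 2^-1));
  [apply: (@within_mul _ m m)|exact: within_cst].
Qed.

(* The value at time 0 is traded for averages over [0, t]: the derivative of
   (t - s) n^2 contains - n^2. *)
Let tn0 : t * n 0 ^+ 2 <= P t + 2 * H t.
Proof.
have [_ cK2' dK2] := K2P; have [H0 cH dH] := HP; have [P0 cP dP] := PP.
have [K20 _ _] := K2P.
pose g s := - ((t - s) * n s ^+ 2) - P s - 2 * ((t - s) * K2 s + H s).
have gt : g t <= g 0.
  apply: (nonincreasing_between (df := fun s => - (-1 * n s ^+ 2 + (t - s) * dN s) - nb2 s
      - 2 * ((t - s) * k s ^+ 2))).
  - by case/andP: tT => /ltW.
  - move=> s st; have sT := inT' st; apply: is_der_sub.
      apply: is_der_sub; last exact: dP.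
      have := is_der_scale (-1) (is_der_mul (is_der_subl s t) (dN_der sT)); rewrite !mulN1r.
      by have -> // : (fun y => -1 * ((t - y) * n y ^+ 2)) = fun y => - ((t - y) * n y ^+ 2)
        by apply/funext => y; rewrite mulN1r.
    apply: is_der_scale.
    have := is_der_add (is_der_mul (is_der_subl s t) (dK2 s sT)) (dH s sT).
    by have -> : -1 * prim (fun s => k s ^+ 2) s + (t - s) * k s ^+ 2 + K2 s = (t - s) * k s ^+ 2
      by rewrite /K2; ring.
  - move=> s st; have sT := inT (inT0 st); have [_ n0' _ _] := pos sT; have [nk nb _] := bnd sT.
    have dn := dN_le (inT' st); have ts : 0 <= t - s by rewrite subr_ge0 ltW//; case/andP: st.
    have h1 : - dN s <= 2 * k s ^+ 2.
      apply: (@le_trans _ _ `|dN s|); first by rewrite -normrN ler_norm.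
      by apply: (le_trans dn); rewrite ler_wpM2l// expr2 ler_wpM2r//; exact: k_ge0.
    exact: weighted_sum nb ts h1.
  - apply: (@within_t g); last exact: lexx.
    have ct : {within `[0, T], continuous (fun s => t - s)}.
      by apply: within_sub; [exact: within_cst|exact: within_id].
    apply: within_sub.
      apply: within_sub => //.
      have c1 : {within `[0, T], continuous (fun s => (t - s) * n s ^+ 2)}.
        by apply: within_mul => //; exact: (@within_mul _ n n).
      by move=> x; apply: cvgN; exact: c1.
    apply: (@within_mul _ (fun=> 2) (fun s => (t - s) * K2 s + H s)); first exact: within_cst.
    by apply: within_add => //; exact: within_mul.
move: gt; rewrite /g subrr !mul0r subr0 [P 0]P0 [H 0]H0 [K2 0]K20.
by move: (t * n 0 ^+ 2) => z; rewrite oppr0 add0r mulr0 !addr0 mulr0; lra.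
Qed.

(** The weight sqrt(t - s) vanishes at s = t, so D t controls m t ^+ 2 / 2, while
    D 0 consists of the source term at time 0, which tn0 estimates. *)
Lemma energy_bound_at : m t ^+ 2 / 2 <= M ^+ 2 / 4 +
  (C6 + 2 * (C3 ^+ 2 / eps)) * (P t + H t).
Proof.
have t0 : 0 <= t by case/andP: tT => /ltW.
have DD : D t <= D 0.
  apply: (nonincreasing_between (df := dD) t0); [exact: dD_der|exact: dD_le|].
  exact: (within_t cD (lexx t)).
have [kap0 _ _] := kapP; have [K20 _ _] := K2P; have [H0 _ _] := HP.
move: DD; rewrite /D /lam subrr sqrtr0 !mul0r !mulr0 [kap 0]kap0 [K2 0]K20 [H 0]H0.
rewrite /Y Z0 m0 expr0n !mulr0 !mul0r !addr0 !subr0 !add0r mulr0 subr0 => DD.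
have tn := tn0; have P0' := P_ge0 (s := t); have H0' := H_ge0 (s := t).
have tT' : 0 <= t <= T by rewrite t0; case/andP: tT.
have P00 := P_ge0 tT'; have H00 := H_ge0 tT'.
have yg := young_arith (2 * C3) M (Num.sqrt t * n 0) eps_gt0.
have s2 : (Num.sqrt t * n 0) ^+ 2 = t * n 0 ^+ 2 by rewrite exprMn sqr_sqrtr.
rewrite s2 in yg.
have e4 : (2 * C3) ^+ 2 / (4 * eps) = C3 ^+ 2 / eps by field; rewrite gt_eqF.
rewrite e4 in yg.
have c3e : 0 <= C3 ^+ 2 / eps by rewrite divr_ge0 ?sqr_ge0// ltW.
have et : eps * (1 + t) <= 4^-1.
  rewrite /eps invfM -mulrA ler_piMr ?invr_ge0// mulrC ler_pdivrMr ?ltr_wpDl//.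
  by rewrite mul1r lerD2l; case/andP: tT.
exact: final_sum eps_gt0 t0 C6_ge0 P00 H00 c3e DD yg tn et.
Qed.

End fixed_time.

(** At the point s of [0, t] where m is maximal, energy_bound_at holds with
    M = m s, and the term M^2 / 4 is absorbed. *)
Lemma energy_gronwall t : 0 <= t <= T ->
  m t ^+ 2 <= energy_const * (P t + H t).
Proof.
move=> tT; have t0 : 0 <= t by case/andP: tT.
have cmt : {within `[0, t], continuous m} by apply: (within_sub_itv cm); case/andP: tT.
have [s] := EVT_max t0 cmt; rewrite in_itv /= => st smax.
have sT : 0 <= s <= T by lra.
have Kp : 0 <= C6 + 2 * (C3 ^+ 2 / eps).
  by rewrite addr_ge0// mulr_ge0// divr_ge0 ?sqr_ge0// ltW.
have mono : P s + H s <= P t + H t.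
  by apply: lerD; apply: (prim_mono T_gt0) => //; lra.
have mt : m t <= m s by apply: smax; rewrite in_itv /= t0 lexx.
have [mt0 _ _ _] := pos tT; have [ms0 _ _ _] := pos sT.
have Kle := ler_wpM2l Kp mono.
have sq : m t ^+ 2 <= m s ^+ 2 by rewrite lerXn2r.
have [s0|sn0] := eqVneq s 0.
  have PH : 0 <= P t + H t by rewrite addr_ge0; [|exact: P_ge0|exact: H_ge0].
  by apply: (le_trans sq); rewrite s0 m0 expr0n mulr_ge0// energy_const_ge0.
have sT' : 0 < s <= T by rewrite lt_neqAle eq_sym sn0; lra.
have hM u : 0 <= u <= s -> m u <= m s by move=> us; apply: smax; rewrite in_itv /=; lra.
rewrite /energy_const -[leRHS]mulrA; exact: absorb_arith Kle sq (energy_bound_at sT' hM).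
Qed.

End gronwall.

(** * The energy estimate for the discrete error *)

Section energy_constants.
Context {R : realType}.

(** M bounds all coefficients and is at least 1. Its powers are collected into the
    tenth, the largest one that occurs: it comes from boundary_young with c = M^4. *)
Lemma pow_le10 (M x : R) i : 1 <= M -> 0 <= x -> (i <= 10)%N -> M ^+ i * x <= M ^+ 10 * x.
Proof. by move=> M1 x0 i10; rewrite ler_wpM2r// ler_weXn2l. Qed.

Lemma first_test_arith (M w S d y e m n aa im1 b1 f1 L : R) :
  1 <= M -> 0 <= w <= M -> 0 <= S <= M -> 0 <= d -> 0 <= y <= e -> 0 <= m <= e -> 0 <= n ->
  `|aa| <= M -> `|im1| <= (S * d + M * e) * y -> `|b1| <= M * m * m -> f1 <= n * m ->
  L = aa * w * im1 - b1 + f1 ->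
  L <= 20 * M ^+ 10 * (Num.sqrt (w * S * d ^+ 2 * (e ^+ 2 / 2)) + e ^+ 2 / 2 + n * m).
Proof.
move=> M1 /andP[w0 wM] /andP[S0 SM] d0 /andP[y0 ye] /andP[m0 me] n0 aM bi bb bf ->.
have M0 : 0 <= M by lra.
have e0 : 0 <= e := le_trans y0 ye.
set Q := w * S * d ^+ 2 * (e ^+ 2 / 2).
have wS0 : 0 <= w * S by rewrite mulr_ge0.
have Q0 : 0 <= Q by rewrite !mulr_ge0 ?sqr_ge0// invr_ge0.
have h1 : w * S * d * e <= 2 * M * Num.sqrt Q.
  have M20 : 0 <= 2 * M * Num.sqrt Q by rewrite !mulr_ge0// sqrtr_ge0.
  have x0 : 0 <= w * S * d * e by rewrite !mulr_ge0.
  rewrite -(@ler_pXn2r _ 2) ?nnegrE// [leRHS]exprMn sqr_sqrtr// /Q.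
  have -> : (w * S * d * e) ^+ 2 = w * S * ((w * S) * (d ^+ 2 * e ^+ 2)) by ring.
  have -> : (2 * M) ^+ 2 * (w * S * d ^+ 2 * (e ^+ 2 / 2)) =
    (2 * M ^+ 2) * ((w * S) * (d ^+ 2 * e ^+ 2)) by field.
  rewrite ler_wpM2r ?mulr_ge0 ?sqr_ge0//.
  by apply: (@le_trans _ _ (M * M)); [exact: ler_pM|rewrite -expr2; have := sqr_ge0 M; lra].
have ax : aa * w * im1 <= M * (w * S * d * e) + M ^+ 3 * e ^+ 2.
  apply: (le_trans (ler_norm _)); rewrite !normrM (ger0_norm w0).
  apply: (@le_trans _ _ (M * w * ((S * d + M * e) * e))).
    apply: ler_pM => //; first by rewrite mulr_ge0.
      by rewrite ler_wpM2r.
    by apply: (le_trans bi); rewrite ler_wpM2l// addr_ge0// mulr_ge0.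
  have -> : M * w * ((S * d + M * e) * e) = M * (w * S * d * e) + M ^+ 2 * e ^+ 2 * w by ring.
  have -> : M ^+ 3 * e ^+ 2 = M ^+ 2 * e ^+ 2 * M by ring.
  by rewrite lerD2l ler_wpM2l// mulr_ge0 ?sqr_ge0.
have bx : - b1 <= M * e ^+ 2.
  apply: (le_trans (ler_norm _)); rewrite normrN; apply: (le_trans bb).
  by rewrite -mulrA expr2 ler_wpM2l// ler_pM.
have s1 : M * (w * S * d * e) <= 2 * (M ^+ 2 * Num.sqrt Q).
  by have := ler_wpM2l M0 h1; rewrite expr2; lra.
have sQ := sqrtr_ge0 Q; have e2 : 0 <= e ^+ 2 := sqr_ge0 e; have nm : 0 <= n * m by rewrite mulr_ge0.
have p1 : M ^+ 2 * Num.sqrt Q <= M ^+ 10 * Num.sqrt Q by exact: pow_le10.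
have p2 : M ^+ 3 * e ^+ 2 <= M ^+ 10 * e ^+ 2 by exact: pow_le10.
have p3 : M ^+ 1 * e ^+ 2 <= M ^+ 10 * e ^+ 2 by exact: pow_le10.
have p4 : M ^+ 0 * (n * m) <= M ^+ 10 * (n * m) by exact: pow_le10.
have p5 : 0 <= M ^+ 10 * (n * m) by rewrite mulr_ge0// exprn_ge0.
have p6 : 0 <= M ^+ 10 * Num.sqrt Q by rewrite mulr_ge0// exprn_ge0.
have p7 : 0 <= M ^+ 10 * e ^+ 2 by rewrite mulr_ge0// exprn_ge0.
rewrite expr1 in p3; rewrite expr0 mul1r in p4.
have -> : 20 * M ^+ 10 * (Num.sqrt Q + e ^+ 2 / 2 + n * m) =
  20 * (M ^+ 10 * Num.sqrt Q) + 10 * (M ^+ 10 * e ^+ 2) + 20 * (M ^+ 10 * (n * m)) by field.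
by move: (M ^+ 10) p1 p2 p3 p4 p5 p6 p7 => M10; lra.
Qed.

(** Young's inequality; the weight S of the boundary dissipation is bounded away
    from 0. *)
Lemma boundary_young (w S M c : R) : 0 <= w <= M -> 0 < S -> S^-1 <= M -> 0 <= c ->
  0 <= M -> forall d e, w * c * d * e <= w * S * d ^+ 2 / 4 + M ^+ 2 * c ^+ 2 * e ^+ 2.
Proof.
move=> /andP[w0 wM] S0 SM c0 M0 d e.
apply: (@le_trans _ _ (w * S * d ^+ 2 / 4 + w * S^-1 * (c ^+ 2 * e ^+ 2))).
  rewrite -subr_ge0.
  have -> : w * S * d ^+ 2 / 4 + w * S^-1 * (c ^+ 2 * e ^+ 2) - w * c * d * e =
    w * S^-1 * (S * d / 2 - c * e) ^+ 2 by field; rewrite gt_eqF.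
  by rewrite mulr_ge0 ?sqr_ge0// divr_ge0// ltW.
have ce : 0 <= c ^+ 2 * e ^+ 2 by rewrite mulr_ge0 ?sqr_ge0.
rewrite lerD2l -[leRHS]mulrA; apply: (ler_wpM2r ce); rewrite expr2.
by apply: ler_pM => //; rewrite invr_ge0 ltW.
Qed.

Lemma second_test_arith (M w S d e m n k p al J dl r1 r3 Z : R) :
  1 <= M -> 0 <= w <= M -> 0 < S -> S <= M -> S^-1 <= M -> 0 <= d -> 0 <= e ->
  0 <= m <= e -> 0 <= n <= k -> `|p| <= M * e * d -> `|al| <= M -> `|dl| <= M ->
  `|J| <= M * w * (S * d + M * e) * (M * e) + M * (e * (M * e)) + M * m * (M * m) + n * (M * m) ->
  `|r1| <= n * m -> `|r3| <= k * m ->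
  Z = - w * (S * d ^+ 2 + p) + al * J - dl * r1 - al * r3 ->
  Z <= - (w * S * d ^+ 2) / 2 + 20 * M ^+ 10 * (e ^+ 2 / 2) + 20 * M ^+ 10 * (k * m).
Proof.
move=> M1 wb S0 SM SiM d0 e0 /andP[m0 me] /andP[n0 nk] bp bal bdl bJ b1 b3 ->.
have /andP[w0 wM] := wb; have M0 : 0 <= M by lra.
have e2 : 0 <= e ^+ 2 := sqr_ge0 e; have k0 := le_trans n0 nk.
have km : 0 <= k * m by rewrite mulr_ge0.
have nmkm : n * m <= k * m by rewrite ler_wpM2r.
have y1 := boundary_young (c := M) wb S0 SiM M0 M0 d e.
have y2 := boundary_young (c := M ^+ 4) wb S0 SiM (exprn_ge0 4 M0) M0 d e.
have t1 : - w * p <= w * M * d * e.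
  apply: (le_trans (ler_norm _)); rewrite normrM normrN (ger0_norm w0).
  have -> : w * M * d * e = w * (M * e * d) by ring.
  by rewrite ler_wpM2l.
have t3 : - dl * r1 <= M * (k * m).
  apply: (le_trans (ler_norm _)); rewrite normrM normrN.
  by apply: ler_pM => //; exact: le_trans nmkm.
have t4 : - al * r3 <= M * (k * m).
  by apply: (le_trans (ler_norm _)); rewrite normrM normrN ler_pM.
have t2 : al * J <= w * M ^+ 4 * d * e + M ^+ 5 * e ^+ 2 + 2 * (M ^+ 3 * e ^+ 2) + M ^+ 2 * (k * m).
  apply: (le_trans (ler_norm _)); rewrite normrM.
  have wd : M * w * (S * d + M * e) * (M * e) <= w * M ^+ 3 * d * e + M ^+ 4 * e ^+ 2.
    have -> : M * w * (S * d + M * e) * (M * e) = (w * M ^+ 2 * d * e) * S + M ^+ 3 * e ^+ 2 * w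
      by ring.
    have -> : w * M ^+ 3 * d * e + M ^+ 4 * e ^+ 2 = (w * M ^+ 2 * d * e) * M + M ^+ 3 * e ^+ 2 * M
      by ring.
    by apply: lerD; apply: ler_wpM2l => //; rewrite !mulr_ge0 ?exprn_ge0.
  have mm : M * m * (M * m) <= M ^+ 2 * e ^+ 2.
    have -> : M * m * (M * m) = M ^+ 2 * (m * m) by ring.
    by rewrite ler_wpM2l ?sqr_ge0// expr2 ler_pM.
  have nm : n * (M * m) <= M * (k * m).
    have -> : n * (M * m) = M * (n * m) by ring.
    by rewrite ler_wpM2l.
  have JJ : `|J| <= w * M ^+ 3 * d * e + M ^+ 4 * e ^+ 2 + 2 * (M ^+ 2 * e ^+ 2) + M * (k * m).
    apply: (le_trans bJ); have -> : M * (e * (M * e)) = M ^+ 2 * e ^+ 2 by ring.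
    lra.
  have -> : w * M ^+ 4 * d * e + M ^+ 5 * e ^+ 2 + 2 * (M ^+ 3 * e ^+ 2) + M ^+ 2 * (k * m) =
    M * (w * M ^+ 3 * d * e + M ^+ 4 * e ^+ 2 + 2 * (M ^+ 2 * e ^+ 2) + M * (k * m)) by ring.
  exact: ler_pM.
have q1 : M ^+ 4 * e ^+ 2 <= M ^+ 10 * e ^+ 2 by exact: pow_le10.
have q2 : M ^+ 5 * e ^+ 2 <= M ^+ 10 * e ^+ 2 by exact: pow_le10.
have q3 : M ^+ 3 * e ^+ 2 <= M ^+ 10 * e ^+ 2 by exact: pow_le10.
have q4 : M ^+ 2 * (k * m) <= M ^+ 10 * (k * m) by exact: pow_le10.
have q5 : M ^+ 1 * (k * m) <= M ^+ 10 * (k * m) by exact: pow_le10.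
have q6 : 0 <= M ^+ 10 * (k * m) by rewrite mulr_ge0// exprn_ge0.
have q7 : 0 <= M ^+ 10 * e ^+ 2 by rewrite mulr_ge0// exprn_ge0.
rewrite expr1 in q5.
have z1 : M ^+ 2 * M ^+ 2 = M ^+ 4 by rewrite -exprD.
have z2 : M ^+ 2 * (M ^+ 4) ^+ 2 = M ^+ 10 by rewrite -exprM -exprD.
have -> : 20 * M ^+ 10 * (e ^+ 2 / 2) = 10 * (M ^+ 10 * e ^+ 2) by field.
have -> : 20 * M ^+ 10 * (k * m) = 20 * (M ^+ 10 * (k * m)) by ring.
rewrite z1 in y1; rewrite z2 in y2.
move: (w * M * d * e) (w * M ^+ 4 * d * e) (M ^+ 10 * e ^+ 2) (M ^+ 10 * (k * m)) t1 t2 t3 t4 y1 y2 q1 q2 q3 q4 q5 q6 q7.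
by move=> A1 A2 A3 A4; lra.
Qed.

End energy_constants.

Section squares.
Context {R : realType}.
Local Notation C := R[i].

Lemma rip_i_self (f : R -> C) : L2 f -> rip f (fun x => 'i%C * f x) = 0.
Proof. by move=> Lf; have := rip_il Lf Lf; rewrite ripC; lra. Qed.

Lemma norm2_sqr_has_der (T : R) (w : R -> R -> C) t dw : L2_curve T w -> L2 dw ->
  0 <= t <= T -> L2_der T w t dw ->
  has_der 0 T (fun s => norm2 (w s) ^+ 2) t (2 * rip dw (w t)).
Proof.
move=> Lw Ld tT D; have := rip_has_der Lw Lw Ld Ld tT D D.
rewrite [rip (w t) _]ripC => H; rewrite [2 * _]mulr_natl mulr2n.
by apply: eq_has_der tT _ H => s sT; rewrite norm2_sqr.
Qed.

Lemma ripNr (f h : R -> C) : L2 f -> L2 h -> rip h (fun x => - f x) = - rip h f.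
Proof.
move=> Lf Lh; have -> : (fun x => - f x) = (fun x => (-1)%:C%C * f x).
  by apply/funext => x; rewrite rmorphN rmorph1 mulN1r.
by rewrite (ripZr _ Lf Lh) mulN1r.
Qed.

Lemma eipNr (v w : R -> C) : Hs0 1 v -> Hs0 1 w -> eip v (fun x => - w x) = - eip v w.
Proof.
move=> Hv Hw; have -> : (fun x => - w x) = (fun x => (-2)%:C%C * w x + w x).
  by apply/funext => x; apply: complex_ext; rewrite !reimE; ring.
by rewrite eipC (eip_linl _ Hw Hw Hv) [eip w v]eipC; ring.
Qed.

End squares.

Section error_energy.
Context {R : realType}.
Local Notation C := R[i].
Variables (T : R) (r : nat) (h : R) (V : set (R -> C)).
Hypothesis T_gt0 : 0 < T.
Hypothesis fe : fe_space r h V.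
Variables (a al dal mu S : R -> R) (G : R -> C) (beta : R -> R -> C) (M : R).
Variables (th dth F dF : R -> R -> C) (k nb2 : R -> R).
Hypothesis M1 : 1 <= M.
Hypothesis coeffs : forall t, 0 <= t <= T ->
  [/\ al t * a t = 1, `|a t| <= M, `|al t| <= M & `|dal t| <= M].
Hypothesis bcoeffs : forall t, 0 <= t <= T ->
  [/\ - M <= mu t <= 0, 0 < S t, S t <= M, (S t)^-1 <= M & normc (G t) <= M].
Hypothesis beta_cont : forall t, 0 <= t <= T -> cont01 (beta t).
Hypothesis beta_le : forall t x, 0 <= t <= T -> 0 <= x <= 1 -> normc (beta t x) <= M.
Hypothesis al_der : forall t : R, 0 < t < T -> is_derive t 1 al (dal t).
Hypothesis al_cont : {within `[0, T], continuous al}.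
Hypothesis thV : forall t, 0 <= t <= T -> V (th t).
Hypothesis dthV : forall t, 0 <= t <= T -> V (dth t).
Hypothesis FL : L2_curve T F.
Hypothesis dFL : L2_curve T dF.
Hypothesis th_der : forall t, 0 <= t <= T -> L2_der T th t (dth t).
Hypothesis wth_der : forall t, 0 <= t <= T ->
  L2_der T (fun s => wderiv (th s)) t (wderiv (dth t)).
Hypothesis F_der : forall t, 0 <= t <= T -> L2_der T F t (dF t).
Let g t := (S t)%:C%C * dth t 1 + G t * th t 1.
Hypothesis eqn : forall t phi, 0 <= t <= T -> V phi ->
  rip (dth t) phi = - (a t * mu t * im (g t * (phi 1)^*%C))
    + a t * eip (th t) (fun x => 'i%C * phi x)
    - rip (fun x => beta t x * th t x) (fun x => 'i%C * phi x) + rip (F t) phi.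
Hypothesis proj : forall t, 0 <= t <= T -> exists chi, [/\ V chi,
  forall phi, V phi -> rip chi phi = rip (fun x => beta t x * th t x) phi,
  norm2 chi <= M * norm2 (th t) & norm2 (wderiv chi) <= M * norm2 (wderiv (th t))].
Hypothesis kF : forall t, 0 <= t <= T ->
  [/\ norm2 (F t) <= k t, norm2 (dF t) <= k t & norm2 (F t) ^+ 2 <= nb2 t].
Hypothesis ck : {within `[0, T], continuous k}.
Hypothesis cnb : {within `[0, T], continuous nb2}.
Hypothesis th0 : norm2 (wderiv (th 0)) = 0.

Let m t := norm2 (th t).
Let e t := norm2 (wderiv (th t)).
Let n t := norm2 (F t).
Let d t := normc (dth t 1).
Let Cst := 20 * M ^+ 10.

Let M0 : 0 <= M. Proof. exact: le_trans M1. Qed.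
Let Hth t : 0 <= t <= T -> Hs0 1 (th t). Proof. by move=> tT; exact: (fe_Hs0 fe (thV tT)). Qed.
Let Hdth t : 0 <= t <= T -> Hs0 1 (dth t). Proof. by move=> tT; exact: (fe_Hs0 fe (dthV tT)). Qed.
Let Lth : L2_curve T th. Proof. by move=> t tT; exact: H1_L2 (Hth tT). Qed.
Let Ldth : L2_curve T dth. Proof. by move=> t tT; exact: H1_L2 (Hdth tT). Qed.
Let Lw : L2_curve T (fun t => wderiv (th t)). Proof. by move=> t tT; exact: H1_L2w (Hth tT). Qed.
Let Ldw : L2_curve T (fun t => wderiv (dth t)). Proof. by move=> t tT; exact: H1_L2w (Hdth tT). Qed.
Let Lbth t : 0 <= t <= T -> L2 (fun x => beta t x * th t x).
Proof. by move=> tT; exact: L2_mul_cont (beta_cont tT) (Lth tT). Qed.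
Let Lith : L2_curve T (fun t x => 'i%C * th t x). Proof. by move=> t tT; exact: L2Z (Lth tT). Qed.
Let one01 : 0 <= (1 : R) <= 1. Proof. by rewrite ler01 lexx. Qed.
Let interior s : 0 < s < T -> 0 <= s <= T. Proof. by move=> /andP[s0 sT]; rewrite !ltW. Qed.

Let th1_le t : 0 <= t <= T -> normc (th t 1) <= e t.
Proof. by move=> tT; exact: H1_sup (Hth tT) one01. Qed.

Let m_le t : 0 <= t <= T -> 0 <= m t <= e t.
Proof. by move=> tT; rewrite norm2_ge0; exact: poincare (Hth tT). Qed.

Let Gth_le t : 0 <= t <= T -> normc (G t * th t 1) <= M * e t.
Proof.
move=> tT; have [_ _ _ _ GM] := bcoeffs tT.
by rewrite Normc.normcM; apply: (ler_pM (normc_ge0 _) (normc_ge0 _) GM (th1_le tT)).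
Qed.

Let g_le t z : 0 <= t <= T -> `|im (g t * z^*%C)| <= (S t * d t + M * e t) * normc z.
Proof.
move=> tT; have [_ S0 _ _ _] := bcoeffs tT.
apply: (le_trans (im_le_normc _)); rewrite Normc.normcM normc_conj.
apply: (ler_wpM2r (normc_ge0 _)); apply: (le_trans (normcD _ _)).
rewrite Normc.normcM normc_real (gtr0_norm S0).
by apply: lerD; [exact: lexx|exact: Gth_le].
Qed.

Let bth_le t : 0 <= t <= T -> norm2 (fun x => beta t x * th t x) <= M * m t.
Proof.
move=> tT; apply: (norm2_mul_sup (beta_cont tT) (Lth tT) M0).
by move=> x; exact: beta_le.
Qed.

(** The real part of the error equation with phi = th: as B(th, th) is real, the
    energy term drops out. *)
Lemma first_test t : 0 <= t <= T ->
  rip (dth t) (th t) <= Cst * (Num.sqrt (- mu t * S t * d t ^+ 2 * (e t ^+ 2 / 2))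
    + e t ^+ 2 / 2 + n t * m t).
Proof.
move=> tT; have [al1 aM alM dalM] := coeffs tT.
have [/andP[muM mu0] S0 SM SiM GM] := bcoeffs tT.
have mu1 : 0 <= - mu t <= M by rewrite oppr_ge0 mu0/= lerNl.
have S1 : 0 <= S t <= M by rewrite ltW.
have y1 : 0 <= normc (th t 1) <= e t by rewrite normc_ge0 th1_le.
have b1 : `|rip (fun x => beta t x * th t x) (fun x => 'i%C * th t x)| <= M * m t * m t.
  apply: (le_trans (rip_CS (Lbth tT) (Lith tT))); rewrite (norm2_i (Lth tT)).
  by apply: (ler_wpM2r (norm2_ge0 _)); exact: bth_le.
have f1 : rip (F t) (th t) <= n t * m t := rip_le (FL tT) (Lth tT).
apply: (first_test_arith M1 mu1 S1 (normc_ge0 _) y1 (m_le tT) (norm2_ge0 _) aM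
  (g_le (th t 1) tT) b1 f1).
rewrite (eqn tT (thV tT)) (eip_i (Hth tT) (Hth tT)) (rip_i_self (Lw tT)).
by rewrite mulr0 addr0 mulrN mulNr.
Qed.

Let X t := e t ^+ 2 / 2.
Let B t := al t * rip (F t) (fun x => 'i%C * th t x).
Let dZ t := eip (th t) (dth t) - (dal t * rip (F t) (fun x => 'i%C * th t x)
  + al t * (rip (dF t) (fun x => 'i%C * th t x) + rip (F t) (fun x => 'i%C * dth t x))).

Let iiE (v : R -> C) : (fun x => 'i%C * ('i%C * v x)) = (fun x => - v x).
Proof. by apply/funext => x; apply: complex_ext; rewrite !reimE; ring. Qed.

(** The error equation with phi = i dth, for which the left hand side vanishes;
    its boundary term contains mu S |dth(1)|^2 <= 0. *)
Lemma rotated_test t : 0 <= t <= T ->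
  eip (th t) (dth t) = mu t * re (g t * (dth t 1)^*%C) +
    al t * rip (fun x => beta t x * th t x) (dth t) + al t * rip (F t) (fun x => 'i%C * dth t x).
Proof.
move=> tT; have [al1 _ _ _] := coeffs tT.
have Vi : V (fun x => 'i%C * dth t x) := feZ fe _ (dthV tT).
have := eqn tT Vi; rewrite (rip_i_self (Ldth tT)) iiE.
have -> : im (g t * ('i%C * dth t 1)^*%C) = - re (g t * (dth t 1)^*%C) by rewrite !reimE; ring.
rewrite (eipNr (Hth tT) (Hdth tT)) (ripNr (Ldth tT) (Lbth tT)).
move: (rip _ _) (rip _ _) (eip _ _) (re _) => x y z w E.
have E' : a t * z = a t * mu t * w + y + x by lra.
transitivity (al t * (a t * z)); first by rewrite mulrA al1 mul1r.
rewrite E'; transitivity (al t * a t * (mu t * w) + al t * y + al t * x); first by ring.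
by rewrite al1 mul1r.
Qed.

(** The L2 projection chi of beta th replaces it in the product with dth, and the
    error equation with phi = chi then expresses this product without time
    derivatives, except for the boundary value of dth. *)
Lemma projected_coupling t : 0 <= t <= T -> `|rip (fun x => beta t x * th t x) (dth t)| <=
  M * - mu t * (S t * d t + M * e t) * (M * e t) + M * (e t * (M * e t))
    + M * m t * (M * m t) + n t * (M * m t).
Proof.
move=> tT; have [chi [Vc cE c0 c1]] := proj tT; have [_ aM _ _] := coeffs tT.
have [/andP[muM mu0] S0 SM SiM GM] := bcoeffs tT.
have Hc := fe_Hs0 fe Vc; have Lc := H1_L2 Hc.
have ic : L2 (fun x => 'i%C * chi x) := L2Z _ Lc.
rewrite -(cE _ (dthV tT)) ripC (eqn tT Vc).
apply: (le_trans (ler_normD _ _)); apply: lerD; last first.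
  apply: (le_trans (rip_CS (FL tT) Lc)).
  by apply: (ler_wpM2l (norm2_ge0 _)).
apply: (le_trans (ler_normB _ _)); apply: lerD; last first.
  apply: (le_trans (rip_CS (Lbth tT) ic)); rewrite (norm2_i Lc).
  by apply: (ler_pM (norm2_ge0 _) (norm2_ge0 _) (bth_le tT) c0).
apply: (le_trans (ler_normD _ _)); apply: lerD; last first.
  rewrite normrM; apply: (ler_pM (normr_ge0 _) (normr_ge0 _) aM).
  rewrite (eip_i (Hth tT) Hc).
  apply: (le_trans (rip_CS (Lw tT) (L2Z _ (H1_L2w Hc)))); rewrite (norm2_i (H1_L2w Hc)).
  by apply: (ler_wpM2l (norm2_ge0 _)).
rewrite normrN !normrM (ler0_norm mu0) -[leRHS]mulrA.
have mu1 : 0 <= - mu t by rewrite oppr_ge0.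
apply: ler_pM => //; first by rewrite mulr_ge0.
  by rewrite ler_wpM2r.
apply: (le_trans (g_le _ tT)).
apply: ler_wpM2l; last by apply: (le_trans (H1_sup Hc one01)).
by rewrite addr_ge0// mulr_ge0// ?(ltW S0)// ?normc_ge0// norm2_ge0.
Qed.

(** In the derivative of X the source is paired with dth; subtracting B moves the
    time derivative from th to F. *)
Lemma second_test t : 0 <= t <= T ->
  dZ t <= - (- mu t * S t * d t ^+ 2) / 2 + Cst * X t + Cst * (k t * m t).
Proof.
move=> tT; have [al1 aM alM dalM] := coeffs tT.
have [/andP[muM mu0] S0 SM SiM GM] := bcoeffs tT; have [nk dk _] := kF tT.
have mu1 : 0 <= - mu t <= M by rewrite oppr_ge0 mu0/= lerNl.
have nk' : 0 <= n t <= k t by rewrite norm2_ge0.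
have pb : `|re (G t * th t 1 * (dth t 1)^*%C)| <= M * e t * d t.
  apply: (le_trans (re_le_normc _)); rewrite Normc.normcM normc_conj.
  by apply: (ler_wpM2r (normc_ge0 _)); exact: Gth_le.
have r1 : `|rip (F t) (fun x => 'i%C * th t x)| <= n t * m t.
  by apply: (le_trans (rip_CS (FL tT) (Lith tT))); rewrite (norm2_i (Lth tT)).
have r3 : `|rip (dF t) (fun x => 'i%C * th t x)| <= k t * m t.
  apply: (le_trans (rip_CS (dFL tT) (Lith tT))); rewrite (norm2_i (Lth tT)).
  by apply: (ler_wpM2r (norm2_ge0 _)).
apply: (second_test_arith M1 mu1 S0 SM SiM (normc_ge0 _) (norm2_ge0 _) (m_le tT) nk' pb alM dalM
  (projected_coupling tT) r1 r3).
rewrite /dZ (rotated_test tT).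
have -> : re (g t * (dth t 1)^*%C) = S t * d t ^+ 2 + re (G t * th t 1 * (dth t 1)^*%C).
  by rewrite /d normc_sqr /g !reimE; ring.
by rewrite -/(d t); ring.
Qed.

Let L_der s : 0 <= s <= T -> has_der 0 T (fun s => m s ^+ 2) s (2 * rip (dth s) (th s)).
Proof. by move=> sT; exact: norm2_sqr_has_der Lth (Ldth sT) sT (th_der sT). Qed.

Let X_der s : 0 <= s <= T -> has_der 0 T (fun s => e s ^+ 2) s (2 * eip (th s) (dth s)).
Proof.
by move=> sT; rewrite eipC; exact: norm2_sqr_has_der Lw (Ldw sT) sT (wth_der sT).
Qed.

Let N_der s : 0 <= s <= T -> has_der 0 T (fun s => n s ^+ 2) s (2 * rip (dF s) (F s)).
Proof. by move=> sT; exact: norm2_sqr_has_der FL (dFL sT) sT (F_der sT). Qed.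

Let ith_der s : 0 <= s <= T -> L2_der T (fun t x => 'i%C * th t x) s (fun x => 'i%C * dth s x).
Proof.
move=> sT eps eps0; have [rr rr0 H] := th_der sT eps0; exists rr => // u uT us.
have := H u uT us; rewrite -(norm2_i (L2_rest Lth (Ldth sT) sT uT)).
rewrite [X in norm2 X <= _ -> _](_ : _ = (fun x => 'i%C * th u x - 'i%C * th s x - (u - s)%:C%C * ('i%C * dth s x)))//.
by apply/funext => x; ring.
Qed.

Let B_der s : 0 <= s <= T -> has_der 0 T (fun s => rip (F s) (fun x => 'i%C * th s x)) s
  (rip (dF s) (fun x => 'i%C * th s x) + rip (F s) (fun x => 'i%C * dth s x)).
Proof.
by move=> sT; exact: (rip_has_der FL Lith (dFL sT) (L2Z _ (Ldth sT)) sT (F_der sT) (ith_der sT)).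
Qed.

Let norm_cont (p : R -> R) : (forall s, 0 <= p s) ->
  {within `[0, T], continuous (fun s => p s ^+ 2)} -> {within `[0, T], continuous p}.
Proof.
move=> p0 cp; rewrite (_ : p = fun s => Num.sqrt (p s ^+ 2)).
  by apply: (@within_comp _ Num.sqrt (fun s => p s ^+ 2)) => //; exact: sqrt_continuous.
by apply/funext => s; rewrite sqrtr_sqr ger0_norm.
Qed.

Theorem error_energy t : 0 <= t <= T ->
  m t ^+ 2 <= energy_const T Cst * (prim nb2 t + prim (prim (fun s => k s ^+ 2)) t).
Proof.
have cm : {within `[0, T], continuous m}.
  by apply: norm_cont; [move=> s; exact: norm2_ge0|exact: has_der_within L_der].
have cn : {within `[0, T], continuous n}.
  by apply: norm_cont; [move=> s; exact: norm2_ge0|exact: has_der_within N_der].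
have half (f : R -> R) (s z : R) : is_derive s 1 f (2 * z) -> is_derive s 1 (fun s => f s / 2) z.
  move=> /(is_der_scale 2^-1); rewrite mulrA mulVf// mul1r.
  by rewrite (_ : (fun y => _) = (fun s => f s / 2))//; apply/funext => y; rewrite mulrC.
have C0 : 0 <= Cst by rewrite mulr_ge0// exprn_ge0.
have z0 : 0 <= (0 : R) <= T by rewrite lexx ltW.
have cZ : {within `[0, T], continuous (fun s => X s - B s)}.
  apply: within_sub; last by apply: within_mul; [exact: al_cont|exact: has_der_within B_der].
  apply: (@within_mul _ (fun s => e s ^+ 2) (fun=> 2^-1)); last exact: within_cst.
  exact: has_der_within X_der.
move=> tT; apply: (energy_gronwall T_gt0 C0 (m := m) (n := n) (k := k) (nb2 := nb2) (X := X) (B := B)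
  (q := fun s => - mu s * S s * d s ^+ 2) (dL := fun s => rip (dth s) (th s)) (dZ := dZ)
  (dN := fun s => 2 * rip (dF s) (F s)) _ _ cm cn ck cnb cZ _ _ _ _ _ _ _ _ tT).
- move=> s sT; have [/andP[_ mu0] S0 _ _ _] := bcoeffs sT.
  split; [exact: norm2_ge0|exact: norm2_ge0| |].
    by rewrite divr_ge0 ?sqr_ge0.
  by rewrite mulr_ge0 ?sqr_ge0// mulr_ge0 ?oppr_ge0// ltW.
- move=> s sT; have [nk _ nb] := kF sT; split=> //; rewrite /B normrM.
  have [_ _ alM _] := coeffs sT.
  have c1 : M <= Cst.
    have h1 : M ^+ 1 <= M ^+ 10 by rewrite ler_weXn2l.
    by have := exprn_ge0 10 M0; rewrite /Cst; rewrite expr1 in h1; lra.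
  apply: (ler_pM (normr_ge0 _) (normr_ge0 _)); first exact: le_trans c1.
  by apply: (le_trans (rip_CS (FL sT) (Lith sT))); rewrite (norm2_i (Lth sT)).
- by move=> s sT; apply: half; exact: has_der_is_derive sT (L_der (interior sT)).
- by move=> s sT; exact: first_test (interior sT).
- move=> s sT; apply: is_der_sub; first by apply: half; exact: has_der_is_derive sT (X_der (interior sT)).
  exact: (is_der_mul (al_der sT) (has_der_is_derive sT (B_der (interior sT)))).
- by move=> s sT; exact: second_test (interior sT).
- by move=> s sT; exact: has_der_is_derive sT (N_der (interior sT)).
- move=> s /interior sT; have [_ dk _] := kF sT; rewrite normrM ger0_norm//.
  apply: (ler_wpM2l (ler0n _ 2)); apply: (le_trans (rip_CS (dFL sT) (FL sT))); rewrite mulrC.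
  exact: (ler_wpM2l (norm2_ge0 _)).
- by have := poincare (Hth z0); rewrite th0 => h0; apply/eqP; rewrite eq_le norm2_ge0 andbT.
- by rewrite /X /e th0 expr0n mul0r.
Qed.

End error_energy.

(** * The error equation *)

Section curve_calculus.
Context {R : realType}.
Local Notation C := R[i].
Variable T : R.

Lemma norm2_0 : norm2 (fun=> 0 : C) = 0.
Proof. by rewrite norm2E rip0l sqrtr0. Qed.

Lemma L2_der0 t : L2_der T (fun=> fun=> 0) t (fun=> 0 : C).
Proof.
move=> e e0; exists 1 => // s sT st.
rewrite [X in norm2 X](_ : _ = fun=> 0); last by apply/funext => x; rewrite mulr0 !subr0.
by rewrite norm2_0 mulr_ge0// ltW.
Qed.

Lemma L2_derZ (c : C) (w : R -> R -> C) t dw : L2_curve T w -> L2 dw -> 0 <= t <= T ->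
  L2_der T w t dw -> L2_der T (fun s x => c * w s x) t (fun x => c * dw x).
Proof.
move=> Lw Ld tT D; have L0 : L2_curve T (fun=> fun=> 0 : C) by move=> s _; exact: L2_0.
have := L2_der_lin c Lw L0 Ld (@L2_0 R) tT D (L2_der0 t).
by apply: eq_L2_der tT => [s x _ _|x _]; rewrite addr0.
Qed.

Lemma L2_derB (w z : R -> R -> C) t dw dz : L2_curve T w -> L2_curve T z -> L2 dw -> L2 dz ->
  0 <= t <= T -> L2_der T w t dw -> L2_der T z t dz ->
  L2_der T (fun s x => w s x - z s x) t (fun x => dw x - dz x).
Proof.
move=> Lw Lz Ldw Ldz tT Dw Dz; have := L2_der_lin (-1) Lz Lw Ldz Ldw tT Dz Dw.
by apply: eq_L2_der tT => [s x _ _|x _]; rewrite mulN1r addrC.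
Qed.

Lemma C1_into_L2_der (V : set (R -> C)) (w dw : R -> R -> C) t :
  (forall v, V v -> L2 v) -> C1_into T V w dw -> 0 <= t <= T -> L2_der T w t (dw t).
Proof.
move=> VL H tT e e0; have [Vw Vd Hd _] := H t tT.
have : \forall s \near within `[0, T]%classic t^',
    norm2 (fun x => ((s - t)^-1)%:C%C * (w s x - w t x) - dw t x) <= e.
  move/cvgr0Pnorm_le: Hd => /(_ e e0); apply: filterS => s.
  by rewrite ger0_norm// norm2_ge0.
move/near_dnbhs_itvP => [rr rr0 Hr]; exists rr => // s sT st.
have [Vs _ _ _] := H s sT.
have [-> |sn] := eqVneq s t.
  rewrite [X in norm2 X](_ : _ = fun=> 0); first by rewrite norm2_0 mulr_ge0// ltW.
  by apply/funext => x; rewrite !subrr mul0r subrr.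
have := Hr s sT sn st; set q := (fun x => _ * _ - _) => hq.
have Lq : L2 q by apply: L2B; [apply: L2Z; apply: L2B|]; exact: VL.
rewrite [X in norm2 X](_ : _ = (fun x => (s - t)%:C%C * q x)).
  by rewrite norm2_real// mulrC; apply: ler_wpM2r.
apply/funext => x; rewrite /q mulrBr mulrA -rmorphM mulfV ?subr_eq0// rmorph1 mul1r.
by [].
Qed.

Lemma norm2_wderiv_rest (c : C) (v w z : R -> C) : Hs0 1 v -> Hs0 1 w -> Hs0 1 z ->
  norm2 (fun x => wderiv v x - wderiv w x - c * wderiv z x) =
  norm2 (wderiv (fun x => v x - w x - c * z x)).
Proof.
move=> Hv Hw Hz; symmetry; apply: norm2_wderiv.
have h1 := is_wderiv_lin (-1) (H1_L2 Hw) (H1_L2 Hv) (H1_wd Hw) (H1_wd Hv).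
have L1 : L2 (fun x => -1 * w x + v x) by apply: L2_lin; exact: H1_L2.
have := is_wderiv_lin (- c) (H1_L2 Hz) L1 (H1_wd Hz) h1.
rewrite [X in is_wderiv X _](_ : _ = (fun x => v x - w x - c * z x)); last first.
  by apply/funext => x; ring.
rewrite [X in is_wderiv _ X](_ : _ = (fun x => wderiv v x - wderiv w x - c * wderiv z x))//.
by apply/funext => x; ring.
Qed.

End curve_calculus.

Section projected_curves.
Context {R : realType}.
Local Notation C := R[i].
Variables (r : nat) (h : R) (V : set (R -> C)).
Hypothesis fe : fe_space r h V.
Variable T : R.
Hypothesis T_gt0 : 0 < T.

Lemma elliptic_lin (c : R) v v' w w' : Hs0 1 v -> Hs0 1 v' ->
  elliptic_proj V v w -> elliptic_proj V v' w' ->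
  elliptic_proj V (fun x => c%:C%C * v x + v' x) (fun x => c%:C%C * w x + w' x).
Proof.
move=> Hv Hv' /(elliptic_projP fe _ Hv)[Vw E] /(elliptic_projP fe _ Hv')[Vw' E'].
apply/(elliptic_projP fe _ (H1_lin _ Hv Hv')); split; first exact: (fe_lin fe).
move=> phi Vp; have Hp := fe_Hs0 fe Vp.
rewrite (eip_linl c (fe_Hs0 fe Vw) (fe_Hs0 fe Vw') Hp) (eip_linl c Hv Hv' Hp).
by rewrite (E _ Vp) (E' _ Vp).
Qed.

(** The remainder of the projected curve is the projection of the remainder, and
    the elliptic projection is a contraction in the energy norm. *)
Lemma elliptic_curve_der (v W W' : R -> R -> C) t : Ck_rect T 2 v ->
  (forall s, 0 <= s <= T -> v s 0 = 0) ->
  (forall s, 0 <= s <= T -> elliptic_proj V (v s) (W s)) ->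
  (forall s, 0 <= s <= T -> elliptic_proj V (Dt T v s) (W' s)) ->
  0 <= t <= T -> L2_der T W t (W' t).
Proof.
move=> cv v0 E E' tT e e0; have [rr rr0 H] := Ck_H1_der T_gt0 cv tT e0.
exists rr => // s sT st; apply: le_trans (H s sT st).
have Hv u : 0 <= u <= T -> Hs0 1 (v u).
  by move=> uT; exact: (Hs0_smooth (CkS cv) uT (v0 u uT)).
have Hd : Hs0 1 (Dt T v t).
  by apply: (Hs0_smooth (Ck_Dt cv) tT); exact: (Dt_zero T_gt0 (CkS cv) v0 tT).
have e1 := elliptic_lin (-1) (Hv t tT) (Hv s sT) (E t tT) (E s sT).
have H1' := H1_lin (-1)%:C%C (Hv t tT) (Hv s sT).
have := elliptic_lin (- (s - t)) Hd H1' (E' t tT) e1.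
have combE (p q z : R -> C) : (fun x => (- (s - t))%:C%C * p x + ((-1)%:C%C * q x + z x)) =
    (fun x => z x - q x - (s - t)%:C%C * p x).
  by apply/funext => x; rewrite !rmorphN rmorph1; ring.
rewrite !combE => E2; have [V2 _] := E2.
apply: (le_trans (poincare (fe_Hs0 fe V2))); apply: (elliptic_stable fe _ E2).
by rewrite -combE; exact: H1_lin.
Qed.

End projected_curves.

Section weak_equations.
Context {R : realType}.
Local Notation C := R[i].
Variable T : R.
Hypothesis T_gt0 : 0 < T.
Variables (a : R -> R) (beta f : R -> R -> C) (mu S : R -> R) (G : R -> C).
Variables (u : R -> R -> C) (t : R).
Hypothesis tT : 0 <= t <= T.
Hypothesis cbeta : cont01 (beta t).
Hypothesis cf : cont01 (f t).

(** Integration by parts against phi, which vanishes at x = 0. *)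
Lemma pde_weak phi : Ck_rect T 2 u -> Hs0 1 phi ->
  (forall x : R, 0 <= x <= 1 -> Dt T u t x = 'i%C * (a t)%:C%C * Dx (Dx u) t x
                     + 'i%C * beta t x * u t x + f t x) ->
  rip (Dt T u t) phi = - (a t * im (Dx u t 1 * (phi 1)^*%C))
    + a t * eip (u t) (fun x => 'i%C * phi x)
    - rip (fun x => beta t x * u t x) (fun x => 'i%C * phi x) + rip (f t) phi.
Proof.
move=> cu Hp pde; have Lp := H1_L2 Hp; have Hip := H1Z 'i%C Hp.
have Lbu : L2 (fun x => beta t x * u t x) := L2_mul_cont cbeta (Ck_L2 cu tT).
have Lf := cont01_L2 cf.
have Luxx : L2 (Dx (Dx u) t) := Ck_L2 (Ck_Dx (Ck_Dx cu)) tT.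
have Lau : L2 (fun x => (a t)%:C%C * Dx (Dx u) t x) := L2Z _ Luxx.
have -> : rip (Dt T u t) phi = rip (fun x => 'i%C * ((a t)%:C%C * Dx (Dx u) t x) +
     'i%C * (beta t x * u t x) + f t x) phi.
  apply: eq_rip => x /andP[x0 x1]; rewrite pde ?ltW//.
  by rewrite !mulrA.
rewrite (ripDl (L2D (L2Z _ Lau) (L2Z _ Lbu)) Lf Lp) (ripDl (L2Z _ Lau) (L2Z _ Lbu) Lp).
rewrite (rip_il Lau Lp) (rip_il Lbu Lp) (ripZl _ Luxx (L2Z _ Lp)).
have ibp := ibp_H1 (fun x => Ck_has_derx (Ck_Dx cu) tT) (Ck_cont01 (Ck_Dx (Ck_Dx cu)) tT) Hip.
have eE : eip (u t) (fun x => 'i%C * phi x) = rip (Dx u t) (wderiv (fun x => 'i%C * phi x)).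
  have wd := wderiv_smooth (CkS cu) tT.
  rewrite eipE; apply: rip_ae (wderiv_ae wd); [exact: is_wderiv_L2 (wderivP wd)|exact: is_wderiv_L2 wd|].
  exact: H1_L2w.
rewrite eE; have bE : re (Dx u t 1 * ('i%C * phi 1)^*%C) = im (Dx u t 1 * (phi 1)^*%C).
  by rewrite !reimE; ring.
rewrite bE in ibp; move: ibp.
move: (rip (Dx (Dx u) t) _) (rip (Dx u t) _) (im _) => x y z <-.
by ring.
Qed.

Lemma semidiscrete_weak (w dw : R -> C) phi : Hs0 1 phi -> Hs0 1 w ->
  inner dw phi =
    'i%C * (a t)%:C%C * (mu t)%:C%C * ((S t)%:C%C * dw 1 + G t * w 1) * (phi 1)^*%C
    - 'i%C * (a t)%:C%C * Bform w phi
    + 'i%C * inner (fun x => beta t x * w x) phi + inner (f t) phi ->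
  rip dw phi = - (a t * mu t * im (((S t)%:C%C * dw 1 + G t * w 1) * (phi 1)^*%C))
    + a t * eip w (fun x => 'i%C * phi x)
    - rip (fun x => beta t x * w x) (fun x => 'i%C * phi x) + rip (f t) phi.
Proof.
move=> Hp Hw E; rewrite -re_inner E -[rip (f t) phi]re_inner -(im_Bform Hw Hp) -im_inner.
move: (inner _ _) (inner _ _) (Bform _ _) ((S t)%:C%C * _ + _) => x y z g.
by rewrite !reimE; ring.
Qed.

Variables (r : nat) (h : R) (V : set (R -> C)).
Hypothesis fe : fe_space r h V.

(** The semidiscrete equation minus the weak form of the partial differential
    equation. At x = 1 the values of u and of its time derivative are those of W0
    (by elliptic_at1) and W1, and B(u, phi) = B(W0, phi) by definition of W0. *)
Lemma error_equation (w dw W0 W1 : R -> C) phi :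
  Ck_rect T 2 u -> u t 0 = 0 -> V w -> V dw -> V phi ->
  (forall x : R, 0 <= x <= 1 -> Dt T u t x = 'i%C * (a t)%:C%C * Dx (Dx u) t x
                     + 'i%C * beta t x * u t x + f t x) ->
  Dx u t 1 = (mu t)%:C%C * ((S t)%:C%C * Dt T u t 1 + G t * u t 1) ->
  inner dw phi =
    'i%C * (a t)%:C%C * (mu t)%:C%C * ((S t)%:C%C * dw 1 + G t * w 1) * (phi 1)^*%C
    - 'i%C * (a t)%:C%C * Bform w phi
    + 'i%C * inner (fun x => beta t x * w x) phi + inner (f t) phi ->
  elliptic_proj V (u t) W0 -> V W1 -> W1 1 = Dt T u t 1 ->
  rip (fun x => dw x - W1 x) phi =
    - (a t * mu t * im (((S t)%:C%C * (dw 1 - W1 1) + G t * (w 1 - W0 1)) * (phi 1)^*%C))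
    + a t * eip (fun x => w x - W0 x) (fun x => 'i%C * phi x)
    - rip (fun x => beta t x * (w x - W0 x)) (fun x => 'i%C * phi x)
    + rip (fun x => 'i%C * (beta t x * (W0 x - u t x)) - (W1 x - Dt T u t x)) phi.
Proof.
move=> cu u0 Vw Vdw Vp pde bc sd E0 V1 W11.
have Hp := fe_Hs0 fe Vp; have Lp := H1_L2 Hp.
have Hu : Hs0 1 (u t) := Hs0_smooth (CkS cu) tT u0.
have Hw := fe_Hs0 fe Vw; have Ldw := H1_L2 (fe_Hs0 fe Vdw); have L1 := H1_L2 (fe_Hs0 fe V1).
have W01 := elliptic_at1 fe Hu E0.
have /(elliptic_projP fe _ Hu)[V0 e0] := E0.
have H0 := fe_Hs0 fe V0; have Vip := feZ fe 'i%C Vp; have Hip := fe_Hs0 fe Vip.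
have Lip := H1_L2 Hip.
have Lb v : L2 v -> L2 (fun x => beta t x * v x) := L2_mul_cont cbeta.
have Lbw := Lb _ (H1_L2 Hw); have Lb0 := Lb _ (H1_L2 H0); have Lbu := Lb _ (H1_L2 Hu).
have Lut : L2 (Dt T u t) := Ck_L2 (Ck_Dt cu) tT.
have pw := pde_weak cu Hp pde; have sw := semidiscrete_weak Hp Hw sd.
have d1 := ripBl Ldw L1 Lp.
have d2 := eipBl Hw H0 Hip; rewrite (e0 _ Vip) in d2.
have d3 : rip (fun x => beta t x * (w x - W0 x)) (fun x => 'i%C * phi x) =
    rip (fun x => beta t x * w x) (fun x => 'i%C * phi x) -
    rip (fun x => beta t x * W0 x) (fun x => 'i%C * phi x).
  rewrite -(ripBl Lbw Lb0 Lip); apply: eq_rip => x _; exact: mulrBr.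
have d4 : rip (fun x => 'i%C * (beta t x * (W0 x - u t x)) - (W1 x - Dt T u t x)) phi =
    - (rip (fun x => beta t x * W0 x) (fun x => 'i%C * phi x) -
       rip (fun x => beta t x * u t x) (fun x => 'i%C * phi x)) - (rip W1 phi - rip (Dt T u t) phi).
  have Lq : L2 (fun x => beta t x * (W0 x - u t x)).
    by apply: Lb; apply: L2B; exact: H1_L2.
  rewrite (ripBl (L2Z _ Lq) (L2B L1 Lut) Lp) (ripBl L1 Lut Lp) (rip_il Lq Lp).
  rewrite -(ripBl Lb0 Lbu Lip); congr (- _ - _); apply: eq_rip => x _; exact: mulrBr.
have d5 : im (((S t)%:C%C * (dw 1 - W1 1) + G t * (w 1 - W0 1)) * (phi 1)^*%C) =
   im (((S t)%:C%C * dw 1 + G t * w 1) * (phi 1)^*%C) -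
   im (((S t)%:C%C * Dt T u t 1 + G t * u t 1) * (phi 1)^*%C).
  by rewrite W11 W01 !reimE; ring.
have d6 : im (Dx u t 1 * (phi 1)^*%C) = mu t * im (((S t)%:C%C * Dt T u t 1 + G t * u t 1) * (phi 1)^*%C).
  by rewrite bc !reimE; ring.
rewrite d1 d2 d3 d4 d5 sw pw d6.
move: (im _) (im _) (eip _ _) (eip _ _) (rip _ _) (rip _ _) (rip _ _) (rip _ _) (rip _ _).
by move=> x1 x2 x3 x4 x5 x6 x7 x8 x9; ring.
Qed.

End weak_equations.

(** * Bounds for the coefficients and the data *)

Section coefficients.
Context {R : realType}.
Local Notation C := R[i].
Variable T : R.
Hypothesis T_gt0 : 0 < T.

Lemma within_inv (p : R -> R) : (forall t, 0 <= t <= T -> p t != 0) ->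
  {within `[0, T], continuous p} -> {within `[0, T], continuous (fun t => (p t)^-1)}.
Proof.
move=> p0 /continuous_within_itvP; move=> /(_ T_gt0) [c1 c2 c3].
have z0 : 0 <= (0 : R) <= T by rewrite lexx ltW.
have zT : 0 <= T <= T by rewrite lexx ltW.
apply/continuous_within_itvP => //; split.
- move=> x; rewrite in_itv /= => /andP[x0 xT]; apply: cvgV; first by apply: p0; rewrite !ltW.
  by apply: c1; rewrite in_itv /= x0.
- by apply: cvgV => //; exact: p0.
- by apply: cvgV => //; exact: p0.
Qed.

Lemma coefficient_bounds (a mu S : R -> R) (G : R -> C) (beta : R -> R -> C) :
  C1_on 0 T a -> (forall t, 0 <= t <= T -> a t != 0) -> Ck_rect T 1 beta ->
  {within `[0, T], continuous mu} -> {within `[0, T], continuous S} ->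
  continuous_on (`[0, T]%classic : set R) G ->
  (forall t, 0 <= t <= T -> mu t <= 0) -> (forall t, 0 <= t <= T -> 0 < S t) ->
  exists (al dal : R -> R) (M : R),
  [/\ 1 <= M,
      (forall t, 0 <= t <= T -> [/\ al t * a t = 1, `|a t| <= M, `|al t| <= M & `|dal t| <= M]),
      (forall t, 0 <= t <= T ->
         [/\ - M <= mu t <= 0, 0 < S t, S t <= M, (S t)^-1 <= M & normc (G t) <= M]),
      (forall t x, 0 <= t <= T -> 0 <= x <= 1 ->
         [/\ normc (beta t x) <= M, normc (Dt T beta t x) <= M & normc (Dx beta t x) <= M]) &
      (forall t : R, 0 < t < T -> is_derive t 1 al (dal t)) /\
      {within `[0, T], continuous al}].
Proof.
move=> [da cda] a0 cb cmu cS [cGr cGi] mu0 S0.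
have Ha t : 0 <= t <= T -> has_der 0 T a t (der 0 T a t) by move=> tT; exact/derivable_has_der/da.
have ca := has_der_within Ha.
have cal := within_inv a0 ca.
have cSi := within_inv (fun t tT => lt0r_neq0 (S0 t tT)) cS.
have cdal : {within `[0, T], continuous (fun t => (a t)^-1 * (a t)^-1 * der 0 T a t)}.
  by apply: (@within_mul _ (fun t => (a t)^-1 * (a t)^-1)) => //; exact: within_mul.
have T0 := ltW T_gt0.
have [K1 k1 b1] := bounded_within T0 ca; have [K2 k2 b2] := bounded_within T0 cal.
have [K3 k3 b3] := bounded_within T0 cdal; have [K4 k4 b4] := bounded_within T0 cmu.
have [K5 k5 b5] := bounded_within T0 cS; have [K6 k6 b6] := bounded_within T0 cSi.
have [K7 k7 b7] := bounded_within T0 cGr; have [K8 k8 b8] := bounded_within T0 cGi.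
have [K9 k9 b9] := rect_normc_bounded T_gt0 cb.
have [K10 k10 b10] := rect_normc_bounded T_gt0 (Ck_Dt cb).
have [K11 k11 b11] := rect_normc_bounded T_gt0 (Ck_Dx cb).
pose M := 1 + K1 + K2 + K3 + K4 + K5 + K6 + (K7 + K8) + K9 + K10 + K11.
exists (fun t => (a t)^-1), (fun t => - ((a t)^-1 * (a t)^-1 * der 0 T a t)), M.
have leM (x y : R) : x <= y -> y <= M -> x <= M by exact: le_trans.
split.
- by rewrite /M; lra.
- move=> t tT; split; first by rewrite mulVf// a0.
  + by apply: leM (b1 t tT) _; rewrite /M; lra.
  + by apply: leM (b2 t tT) _; rewrite /M; lra.
  + by rewrite normrN; apply: leM (b3 t tT) _; rewrite /M; lra.
- move=> t tT; split.
  + have := b4 t tT; rewrite (ler0_norm (mu0 t tT)) (mu0 t tT) andbT /M; lra.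
  + exact: S0.
  + by have := leM _ _ (b5 t tT); rewrite gtr0_norm ?S0//; apply; rewrite /M; lra.
  + by have := leM _ _ (b6 t tT); rewrite gtr0_norm ?invr_gt0 ?S0//; apply; rewrite /M; lra.
  + apply: (le_trans (normc_le_add _)); have := b7 t tT; have := b8 t tT; rewrite /M; lra.
- move=> t x tT x1; split.
  + by apply: leM (b9 t x tT x1) _; rewrite /M; lra.
  + by apply: leM (b10 t x tT x1) _; rewrite /M; lra.
  + by apply: leM (b11 t x tT x1) _; rewrite /M; lra.
- split=> // t tT; have tT' : 0 <= t <= T by case/andP: tT => ? ?; rewrite !ltW.
  have := is_deriveV (a0 t tT') (has_der_is_derive tT (Ha t tT')).
  rewrite (_ : - a t ^- 2 *: der 0 T a t = - ((a t)^-1 * (a t)^-1 * der 0 T a t))//.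
  by rewrite scaleNr expr2 invfM.
Qed.

Lemma H1_mul_smooth (beta : R -> R -> C) t (M : R) v : Ck_rect T 1 beta -> 0 <= t <= T -> 0 <= M ->
  (forall x, 0 <= x <= 1 -> normc (beta t x) <= M) ->
  (forall x, 0 <= x <= 1 -> normc (Dx beta t x) <= M) -> Hs0 1 v ->
  Hs0 1 (fun x => beta t x * v x) /\
  norm2 (wderiv (fun x => beta t x * v x)) <= 2 * M * norm2 (wderiv v).
Proof.
move=> cb tT M0 b1 b2 Hv; have cbt := Ck_cont01 cb tT; have cdb := Ck_cont01 (Ck_Dx cb) tT.
have wd := is_wderiv_mul (fun x => Ck_has_derx cb tT) cdb (H1_L2 Hv) (H1_wd Hv).
have Lbv := L2_mul_cont cbt (H1_L2 Hv).
split.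
  split; first by apply/Hs1P; split; [exact: Lbv|exact: wderivP wd].
  - have [r1 i1] := cbt; have [r2 i2] := H1_cont Hv; split.
      rewrite [X in {within _, continuous X}](_ : _ = fun x => re (beta t x) * re (v x) - im (beta t x) * im (v x)).
        by apply: within_sub; exact: within_mul.
      by apply/funext => x; rewrite re_mul.
    rewrite [X in {within _, continuous X}](_ : _ = fun x => re (beta t x) * im (v x) + im (beta t x) * re (v x)).
      by apply: within_add; exact: within_mul.
    by apply/funext => x; rewrite im_mul.
  - by have [_ _ ->] := Hv; rewrite mulr0.
rewrite (norm2_wderiv wd).
apply: (le_trans (norm2D (L2_mul_cont cdb (H1_L2 Hv)) (L2_mul_cont cbt (H1_L2w Hv)))).
have h1 := norm2_mul_sup cdb (H1_L2 Hv) M0 b2.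
have h2 := norm2_mul_sup cbt (H1_L2w Hv) M0 b1.
have h3 := ler_wpM2l M0 (poincare Hv).
by move: (norm2 _) (norm2 _) (norm2 _) (norm2 _) h1 h2 h3 => x y z w; lra.
Qed.

Lemma prim_add (p q : R -> R) s : {within `[0, T], continuous p} -> {within `[0, T], continuous q} ->
  0 <= s <= T -> prim (fun x => p x + q x) s = prim p s + prim q s.
Proof.
move=> cp cq sT; have sT' : s <= T by case/andP: sT.
have i (f : R -> R) : {within `[0, T], continuous f} ->
    (@lebesgue_measure R).-integrable `[0, s] (EFin \o f).
  move=> cf; apply: continuous_compact_integrable; first exact: segment_compact.
  exact: within_sub_itv cf sT'.
by rewrite /prim RintegralD//; exact: i.
Qed.

End coefficients.

Section gamma.
Context {R : realType}.
Local Notation C := R[i].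
Variables (T : R) (r : nat) (u : R -> R -> C).
Hypothesis T_gt0 : 0 < T.
Hypothesis cu : Ck_rect T r.+3 u.

Let Q j s := sob_norm r.+1 (iter j (Dt T) u s) ^+ 2.

Lemma sob_iter_cont j : (j <= 2)%N -> {within `[0, T], continuous (Q j)}.
Proof.
move=> j2; apply: sob_norm_cont; apply: Ck_iter_Dt; apply: Ck_le cu.
by rewrite addSn ltnS -[r.+2]addn2 leq_add2l.
Qed.

Let prim_split (q0 q1 q2 : R -> R) s : {within `[0, T], continuous q0} ->
  {within `[0, T], continuous q1} -> {within `[0, T], continuous q2} -> 0 <= s <= T ->
  q0 s + q1 s + (prim q0 s + prim q1 s + prim q2 s) =
  q0 s + q1 s + prim (fun s => q0 s + q1 s + q2 s) s.
Proof.
move=> c0 c1 c2 sT; have c01 := within_add c0 c1.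
by rewrite (prim_add c01 c2 sT) (prim_add c0 c1 sT).
Qed.

Let prim_sum (q0 q1 q2 : R -> R) t : {within `[0, T], continuous q0} ->
  {within `[0, T], continuous q1} -> {within `[0, T], continuous q2} ->
  (forall s, 0 <= q0 s) -> (forall s, 0 <= q1 s) -> (forall s, 0 <= q2 s) -> 0 <= t <= T ->
  0 <= prim (fun s => q0 s + q1 s + prim (fun s => q0 s + q1 s + q2 s) s) t /\
  prim (fun s => q0 s + q1 s) t + prim (prim (fun s => q0 s + q1 s + q2 s)) t
  <= prim (fun s => q0 s + q1 s + prim (fun s => q0 s + q1 s + q2 s) s) t.
Proof.
move=> c0 c1 c2 p0 p1 p2 tT; have c01 := within_add c0 c1; have c012 := within_add c01 c2.
have [_ cp _] := prim_props T_gt0 c012.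
rewrite (prim_add c01 cp tT); split; last exact: lexx.
apply: addr_ge0; apply: (prim_ge0 _ tT) => s sT; first exact: addr_ge0.
by apply: (prim_ge0 _ sT) => x _; rewrite !addr_ge0.
Qed.

(** The weighted norms of the data required by the energy estimate are those
    which GammaN accumulates. *)
Lemma data_le_Gamma t : 0 <= t <= T ->
  0 <= prim (GammaN T r u) t /\
  prim (fun s => Q 0 s + Q 1 s) t + prim (prim (fun s => Q 0 s + Q 1 s + Q 2 s)) t
  <= prim (GammaN T r u) t.
Proof.
move=> tT; have c0 := sob_iter_cont (leq0n 2); have c1 := sob_iter_cont (leqnSn 1).
have c2 := sob_iter_cont (leqnn 2).
have Q0 j s : 0 <= Q j s by exact: sqr_ge0.
have -> : prim (GammaN T r u) t = prim (fun s => Q 0 s + Q 1 s + prim (fun s => Q 0 s + Q 1 s + Q 2 s) s) t.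
  apply: eq_Rintegral => s; rewrite inE /= in_itv /= => /andP[s0 st].
  have sT : 0 <= s <= T by rewrite s0 (le_trans st)//; case/andP: tT.
  by rewrite -(prim_split c0 c1 c2 sT) /GammaN !big_ord_recr big_ord0 /= add0r.
exact: (prim_sum c0 c1 c2 (Q0 0) (Q0 1) (Q0 2) tT).
Qed.

End gamma.

(** * The error estimate on one mesh *)

Section error_arithmetic.
Context {R : realType}.

Lemma sum3_le_sqrt (x y z : R) :
  x + y + z <= 2 * Num.sqrt (x ^+ 2 + y ^+ 2 + z ^+ 2).
Proof.
have s0 := sqrtr_ge0 (x ^+ 2 + y ^+ 2 + z ^+ 2).
have q0 : 0 <= x ^+ 2 + y ^+ 2 + z ^+ 2 by rewrite !addr_ge0 ?sqr_ge0.
apply: (le_trans (ler_norm _)).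
rewrite -(@ler_pXn2r _ 2)// ?nnegrE ?mulr_ge0// [leRHS]exprMn sqr_sqrtr// real_normK ?num_real//.
have := sqr_ge0 (x - y); have := sqr_ge0 (x - z); have := sqr_ge0 (y - z).
by rewrite !expr2; have := sqr_ge0 (x + y + z); rewrite expr2; lra.
Qed.

Lemma sum2_sqr_le (B p x y : R) : 0 <= B -> 0 <= p -> p <= B * (x + y) ->
  p ^+ 2 <= (2 * B) ^+ 2 * (x ^+ 2 + y ^+ 2).
Proof.
move=> B0 p0 h; apply: (@le_trans _ _ ((B * (x + y)) ^+ 2)).
  by rewrite lerXn2r// nnegrE// (le_trans p0).
rewrite !exprMn -subr_ge0.
have -> : 2 ^+ 2 * B ^+ 2 * (x ^+ 2 + y ^+ 2) - B ^+ 2 * (x + y) ^+ 2 =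
  B ^+ 2 * ((x - y) ^+ 2 + 2 * (x ^+ 2 + y ^+ 2)) by ring.
by rewrite mulr_ge0 ?sqr_ge0// addr_ge0 ?sqr_ge0// mulr_ge0// addr_ge0 ?sqr_ge0.
Qed.

Lemma total_error_arith (h hs J K c0 H E A1 n1 e1 n2 e2 n3 e3 s1 R0 I : R) :
  0 <= h <= hs -> 0 <= J -> 0 <= K -> 0 <= c0 -> 0 <= H -> 0 <= E -> 0 <= A1 -> 0 <= n1 ->
  0 <= R0 -> 0 <= I ->
  n3 <= n1 + n2 -> e3 <= e1 + e2 -> s1 <= n3 + e3 -> h * e1 <= J * n1 ->
  n2 <= c0 * H * R0 -> h * e2 <= K * H * R0 -> n1 ^+ 2 <= E * (A1 * H) ^+ 2 * I ->
  n3 + h * s1 <= ((1 + hs + J) * (Num.sqrt E * A1) + (1 + hs) * c0 + K) * H *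
     Num.sqrt (R0 ^+ 2 + I).
Proof.
move=> /andP[h0 hh] J0 K0 c00 H0 E0 A0 n10 R00 I0 b3 d3 bs be1 b2 be2 bE.
set Q := Num.sqrt (R0 ^+ 2 + I); have Q0 : 0 <= Q := sqrtr_ge0 _.
have RQ : R0 <= Q.
  by rewrite -[leLHS]ger0_norm// -sqrtr_sqr ler_wsqrtr// lerDl.
have nQ : n1 <= Num.sqrt E * A1 * H * Q.
  rewrite -(@ler_pXn2r _ 2)// ?nnegrE ?mulr_ge0 ?sqrtr_ge0//.
  apply: (le_trans bE); rewrite /Q !exprMn !sqr_sqrtr ?addr_ge0 ?sqr_ge0// mulrA.
  by rewrite ler_wpM2l ?lerDr ?sqr_ge0// !mulr_ge0 ?sqr_ge0.
have hs0 : 0 <= hs := le_trans h0 hh.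
have HR : H * R0 <= H * Q by rewrite ler_wpM2l.
have n2Q : n2 <= c0 * (H * Q).
  by apply: (le_trans b2); rewrite -mulrA ler_wpM2l.
have e2Q : h * e2 <= K * (H * Q).
  by apply: (le_trans be2); rewrite -mulrA ler_wpM2l.
have step : n3 + h * s1 <= (1 + hs + J) * n1 + (1 + hs) * (c0 * (H * Q)) + K * (H * Q).
  have a1 : h * s1 <= h * (n1 + n2 + (e1 + e2)).
    by rewrite ler_wpM2l//; lra.
  have a2 : h * (n1 + n2) <= hs * (n1 + c0 * (H * Q)).
    have z0 : 0 <= n1 + c0 * (H * Q) by rewrite addr_ge0// !mulr_ge0.
    by apply: (@le_trans _ _ (h * (n1 + c0 * (H * Q)))); [rewrite ler_wpM2l// lerD2l|rewrite ler_wpM2r].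
  by lra.
apply: (le_trans step).
have J1 : 0 <= 1 + hs + J by rewrite !addr_ge0.
have := ler_wpM2l J1 nQ; lra.
Qed.

End error_arithmetic.

Section one_mesh.
Context {R : realType}.
Local Notation C := R[i].
Variables (T : R) (r : nat) (hs h : R) (V : set (R -> C)).
Hypothesis T_gt0 : 0 < T.
Hypothesis r_gt0 : (0 < r)%N.
Hypothesis fe : fe_space r h V.
Hypothesis h_gt0 : 0 < h.
Hypothesis h_le : h <= hs.
Variables (K J M : R).
Hypothesis K0 : 0 <= K.
Hypothesis J0 : 0 <= J.
Hypothesis appr : forall s, (s <= r)%N -> approximates h V K s.
Hypothesis inverse : forall phi, V phi -> norm2 (wderiv phi) <= J * h^-1 * norm2 phi.

Lemma elliptic_error v w : Hs0 r.+1 v -> elliptic_proj V v w ->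
  h * norm2 (wderiv (fun x => w x - v x)) <= K * h ^+ r.+1 * sob_norm r.+1 v /\
  norm2 (fun x => w x - v x) <= 2 * K ^+ 2 * h ^+ r.+1 * sob_norm r.+1 v.
Proof.
move=> Hv E; have e1 := approximates_energy fe h_gt0 (appr (leqnn r)) Hv E.
split=> //; apply: (le_trans (nitsche fe h_gt0 K0 (appr r_gt0) (Hs0S Hv) E)).
have -> : 2 * K ^+ 2 * h ^+ r.+1 * sob_norm r.+1 v = 2 * K * (K * h ^+ r.+1 * sob_norm r.+1 v) by ring.
by rewrite -[leLHS]mulrA ler_wpM2l// mulr_ge0.
Qed.

Lemma elliptic_curve (v : R -> R -> C) : (forall t, 0 <= t <= T -> Hs0 1 (v t)) ->
  exists W : R -> R -> C, forall t, 0 <= t <= T -> elliptic_proj V (v t) (W t).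
Proof.
move=> Hv; have H (t : R) : exists w, 0 <= t <= T -> elliptic_proj V (v t) w.
  have [tT|tT] := boolP (0 <= t <= T); last by exists (fun=> 0).
  by have [w Ew] := elliptic_exists fe (Hv t tT); exists w.
by have [W HW] := choice H; exists W.
Qed.

Variables (a al dal mu S : R -> R) (G : R -> C) (beta f u : R -> R -> C).
Hypothesis M1 : 1 <= M.
Hypothesis coeffs : forall t, 0 <= t <= T ->
  [/\ al t * a t = 1, `|a t| <= M, `|al t| <= M & `|dal t| <= M].
Hypothesis bcoeffs : forall t, 0 <= t <= T ->
  [/\ - M <= mu t <= 0, 0 < S t, S t <= M, (S t)^-1 <= M & normc (G t) <= M].
Hypothesis beta_smooth : Ck_rect T 1 beta.
Hypothesis beta_le : forall t x, 0 <= t <= T -> 0 <= x <= 1 ->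
  [/\ normc (beta t x) <= M, normc (Dt T beta t x) <= M & normc (Dx beta t x) <= M].
Hypothesis al_der : forall t : R, 0 < t < T -> is_derive t 1 al (dal t).
Hypothesis al_cont : {within `[0, T], continuous al}.
Hypothesis f_cont : forall t, 0 <= t <= T -> cont01 (f t).
Hypothesis cu : Ck_rect T r.+3 u.
Hypothesis pde : forall t x : R, 0 <= t <= T -> 0 <= x <= 1 ->
  Dt T u t x = 'i%C * (a t)%:C%C * Dx (Dx u) t x + 'i%C * beta t x * u t x + f t x.
Hypothesis u_0 : forall t : R, 0 <= t <= T -> u t 0 = 0.
Hypothesis u_1 : forall t : R, 0 <= t <= T ->
  Dx u t 1 = (mu t)%:C%C * ((S t)%:C%C * Dt T u t 1 + G t * u t 1).
Variables (u0 : R -> C) (uh duh : R -> R -> C).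
Hypothesis u_init : forall x : R, 0 <= x <= 1 -> u 0 x = u0 x.
Hypothesis uh_C1 : C1_into T V uh duh.
Hypothesis uh_init : elliptic_proj V u0 (uh 0).
Hypothesis uh_eq : forall phi (t : R), V phi -> 0 <= t <= T ->
  inner (duh t) phi =
    'i%C * (a t)%:C%C * (mu t)%:C%C * ((S t)%:C%C * duh t 1 + G t * uh t 1) * (phi 1)^*%C
    - 'i%C * (a t)%:C%C * Bform (uh t) phi
    + 'i%C * inner (fun x => beta t x * uh t x) phi + inner (f t) phi.

Let M0 : 0 <= M. Proof. exact: le_trans M1. Qed.
Let P := 2 * (1 + 4 * K * J).
Let N := M * P.
Let P1 : 1 <= P. Proof. by have : 0 <= 4 * K * J by [rewrite !mulr_ge0]; rewrite /P; lra. Qed.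
Let MN : M <= N. Proof. by rewrite /N ler_peMr. Qed.
Let N1 : 1 <= N. Proof. exact: le_trans MN. Qed.
Let N0 : 0 <= N. Proof. exact: le_trans N1. Qed.
Let D j := iter j (Dt T) u.

Let D_smooth j : (j <= 2)%N -> Ck_rect T r.+1 (D j).
Proof.
by move=> j2; apply: Ck_iter_Dt; apply: Ck_le cu; rewrite addSn ltnS -[r.+2]addn2 leq_add2l.
Qed.

Let D_zero j t : (j <= 2)%N -> 0 <= t <= T -> D j t 0 = 0.
Proof.
elim: j t => [|j IH] t j2 tT; first exact: u_0.
apply: (Dt_zero T_gt0 _ _ tT); last by move=> s; apply: IH; exact: ltnW.
by apply: (Ck_le _ (D_smooth (ltnW j2))).
Qed.

Let D_Hs0 j t : (j <= 2)%N -> 0 <= t <= T -> Hs0 r.+1 (D j t).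
Proof. by move=> j2 tT; exact: Hs0_smooth (D_smooth j2) tT (D_zero j2 tT). Qed.

Let D_H1 j t : (j <= 2)%N -> 0 <= t <= T -> Hs0 1 (D j t).
Proof. by move=> j2 tT; exact: Hs0S (D_Hs0 j2 tT). Qed.

(** Stability of the L2 projection in both norms, applied to beta v. *)
Lemma projected_product t v : 0 <= t <= T -> Hs0 1 v -> exists chi, [/\ V chi,
  forall phi, V phi -> rip chi phi = rip (fun x => beta t x * v x) phi,
  norm2 chi <= N * norm2 v & norm2 (wderiv chi) <= N * norm2 (wderiv v)].
Proof.
move=> tT Hv.
have [Hb nb] := H1_mul_smooth beta_smooth tT M0 (fun x x1 => let: And3 b _ _ := beta_le tT x1 in b)
  (fun x x1 => let: And3 _ _ b := beta_le tT x1 in b) Hv.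
have Lb := H1_L2 Hb; have [chi Vc cE] := L2_projection fe Lb; exists chi; split=> //.
  have Lc := H1_L2 (fe_Hs0 fe Vc).
  apply: (@le_trans _ _ (norm2 (fun x => beta t x * v x))).
    apply: le_sqr_mul; [exact: norm2_ge0|exact: norm2_ge0|].
    by rewrite norm2_sqr (cE _ Vc); exact: rip_le.
  apply: (@le_trans _ _ (M * norm2 v)).
    apply: (norm2_mul_sup (Ck_cont01 beta_smooth tT) (H1_L2 Hv) M0) => x x1.
    by have [] := beta_le tT x1.
  by rewrite ler_wpM2r ?norm2_ge0.
apply: (le_trans (L2_projection_stable fe h_gt0 K0 (appr r_gt0) J0 inverse Hb Vc cE)).
have -> : N * norm2 (wderiv v) = (1 + 4 * K * J) * (2 * M * norm2 (wderiv v)).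
  by rewrite /N /P; ring.
have q0 : 0 <= 1 + 4 * K * J by rewrite addr_ge0// !mulr_ge0.
exact: (ler_wpM2l q0 nb).
Qed.

Section projected_solution.
Variables W0 W1 W2 : R -> R -> C.
Hypothesis E0 : forall t, 0 <= t <= T -> elliptic_proj V (D 0 t) (W0 t).
Hypothesis E1 : forall t, 0 <= t <= T -> elliptic_proj V (D 1 t) (W1 t).
Hypothesis E2 : forall t, 0 <= t <= T -> elliptic_proj V (D 2 t) (W2 t).

Let rho0 t x := W0 t x - u t x.
Let rho1 t x := W1 t x - Dt T u t x.
Let rho2 t x := W2 t x - Dt T (Dt T u) t x.
Let th t x := uh t x - W0 t x.
Let dth t x := duh t x - W1 t x.
Let F t x := 'i%C * (beta t x * rho0 t x) - rho1 t x.
Let dF t x := 'i%C * (Dt T beta t x * rho0 t x + beta t x * rho1 t x) - rho2 t x.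
Let R_ j t := sob_norm r.+1 (D j t).
Let B := 2 * K ^+ 2 * h ^+ r.+1.
Let A := 2 * (N * B).

Let VH v : V v -> Hs0 1 v. Proof. exact: (fe_Hs0 fe). Qed.
Let VL v : V v -> L2 v. Proof. by move=> /VH; exact: H1_L2. Qed.
Let V0 t : 0 <= t <= T -> V (W0 t). Proof. by move=> /E0[]. Qed.
Let V1 t : 0 <= t <= T -> V (W1 t). Proof. by move=> /E1[]. Qed.
Let V2 t : 0 <= t <= T -> V (W2 t). Proof. by move=> /E2[]. Qed.
Let Vuh t : 0 <= t <= T -> V (uh t). Proof. by move=> /uh_C1[]. Qed.
Let Vduh t : 0 <= t <= T -> V (duh t). Proof. by move=> /uh_C1[]. Qed.
Let Vth t : 0 <= t <= T -> V (th t). Proof. by move=> tT; exact: (feB fe (Vuh tT) (V0 tT)). Qed.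
Let Vdth t : 0 <= t <= T -> V (dth t). Proof. by move=> tT; exact: (feB fe (Vduh tT) (V1 tT)). Qed.

Let C2 j : (j <= 1)%N -> Ck_rect T 2 (D j).
Proof. by move=> j1; apply: (Ck_le _ (D_smooth (leqW j1))). Qed.

Let Lrho0 : L2_curve T rho0.
Proof. by move=> t tT; exact: L2B (VL (V0 tT)) (H1_L2 (D_H1 (leq0n 2) tT)). Qed.
Let Lrho1 : L2_curve T rho1.
Proof. by move=> t tT; exact: L2B (VL (V1 tT)) (H1_L2 (D_H1 (leqnSn 1) tT)). Qed.
Let Lrho2 : L2_curve T rho2.
Proof. by move=> t tT; exact: L2B (VL (V2 tT)) (H1_L2 (D_H1 (leqnn 2) tT)). Qed.

Let W0_der t : 0 <= t <= T -> L2_der T W0 t (W1 t).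
Proof.
move=> tT; apply: (elliptic_curve_der fe T_gt0 (C2 (leq0n 1)) _ E0 E1 tT).
by move=> s sT; exact: D_zero.
Qed.

Let W1_der t : 0 <= t <= T -> L2_der T W1 t (W2 t).
Proof.
move=> tT; apply: (elliptic_curve_der fe T_gt0 (C2 (leqnn 1)) _ E1 E2 tT).
by move=> s sT; exact: D_zero.
Qed.

Let rho0_der t : 0 <= t <= T -> L2_der T rho0 t (rho1 t).
Proof.
move=> tT.
have h1 : L2_curve T W0 by move=> s sT; exact: VL (V0 sT).
have h2 : L2_curve T (D 0) by move=> s sT; exact: H1_L2 (D_H1 (leq0n 2) sT).
have h3 : L2 (W1 t) := VL (V1 tT).
have h4 : L2 (Dt T (D 0) t) := H1_L2 (D_H1 (leqnSn 1) tT).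
have h5 := Ck_L2_der (CkS (C2 (leq0n 1))) tT.
have h6 := L2_derB h1 h2 h3 h4 tT (W0_der tT) h5.
exact: h6.
Qed.

Let rho1_der t : 0 <= t <= T -> L2_der T rho1 t (rho2 t).
Proof.
move=> tT.
have h1 : L2_curve T W1 by move=> s sT; exact: VL (V1 sT).
have h2 : L2_curve T (D 1) by move=> s sT; exact: H1_L2 (D_H1 (leqnSn 1) sT).
have h3 : L2 (W2 t) := VL (V2 tT).
have h4 : L2 (Dt T (D 1) t) := H1_L2 (D_H1 (leqnn 2) tT).
have h5 := Ck_L2_der (CkS (C2 (leqnn 1))) tT.
have h6 := L2_derB h1 h2 h3 h4 tT (W1_der tT) h5.
exact: h6.
Qed.

Let th_der t : 0 <= t <= T -> L2_der T th t (dth t).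
Proof.
move=> tT; apply: (L2_derB _ _ _ _ tT (C1_into_L2_der VL uh_C1 tT) (W0_der tT)).
- by move=> s sT; exact: VL (Vuh sT).
- by move=> s sT; exact: VL (V0 sT).
- exact: VL (Vduh tT).
- exact: VL (V1 tT).
Qed.

(* On a fixed mesh the inverse inequality turns differentiability in L2 into
   differentiability in the energy norm. *)
Let wth_der t : 0 <= t <= T -> L2_der T (fun s => wderiv (th s)) t (wderiv (dth t)).
Proof.
move=> tT e e0; pose J' := J * h^-1 + 1.
have J'0 : 0 < J' by rewrite ltr_pwDr// mulr_ge0// invr_ge0 ltW.
have e1 : 0 < e / J' by rewrite divr_gt0.
have [rr rr0 H] := th_der tT e1; exists rr => // s sT st.
rewrite (norm2_wderiv_rest _ (VH (Vth sT)) (VH (Vth tT)) (VH (Vdth tT))).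
have Vr : V (fun x => th s x - th t x - (s - t)%:C%C * dth t x).
  by apply: (feB fe (feB fe (Vth sT) (Vth tT))); apply: (feZ fe); exact: Vdth.
apply: (le_trans (inverse Vr)).
apply: (@le_trans _ _ (J' * (e / J' * `|s - t|))); last first.
  by rewrite !mulrA [J' * e]mulrC mulfK// gt_eqF.
apply: ler_pM; [by rewrite mulr_ge0// invr_ge0 ltW|exact: norm2_ge0| |exact: H].
by rewrite /J' lerDl.
Qed.

Let Lb t v : 0 <= t <= T -> L2 v -> L2 (fun x => beta t x * v x).
Proof. by move=> tT; exact: L2_mul_cont (Ck_cont01 beta_smooth tT). Qed.
Let Ldb t v : 0 <= t <= T -> L2 v -> L2 (fun x => Dt T beta t x * v x).
Proof. by move=> tT; exact: L2_mul_cont (Ck_cont01 (Ck_Dt beta_smooth) tT). Qed.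

Let LF : L2_curve T F.
Proof. by move=> t tT; exact: L2B (L2Z _ (Lb tT (Lrho0 tT))) (Lrho1 tT). Qed.
Let LdF : L2_curve T dF.
Proof.
move=> t tT; apply: (L2B _ (Lrho2 tT)); apply: L2Z.
exact: L2D (Ldb tT (Lrho0 tT)) (Lb tT (Lrho1 tT)).
Qed.

Let F_der t : 0 <= t <= T -> L2_der T F t (dF t).
Proof.
move=> tT.
have Lq : L2_curve T (fun s x => beta s x * rho0 s x) by move=> s sT; exact: Lb sT (Lrho0 sT).
have Ldq := L2D (Ldb tT (Lrho0 tT)) (Lb tT (Lrho1 tT)).
have D1 := L2_der_mul T_gt0 beta_smooth Lrho0 (Lrho1 tT) tT (rho0_der tT).
have Liq : L2_curve T (fun s x => 'i%C * (beta s x * rho0 s x)) by move=> s sT; exact: L2Z (Lq s sT).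
exact: (L2_derB Liq Lrho1 (L2Z _ Ldq) (Lrho2 tT) tT (L2_derZ _ Lq Ldq tT D1) (rho1_der tT)).
Qed.

Let eqn t phi : 0 <= t <= T -> V phi ->
  rip (dth t) phi = - (a t * mu t * im (((S t)%:C%C * dth t 1 + G t * th t 1) * (phi 1)^*%C))
    + a t * eip (th t) (fun x => 'i%C * phi x)
    - rip (fun x => beta t x * th t x) (fun x => 'i%C * phi x) + rip (F t) phi.
Proof.
move=> tT Vp; have W11 := elliptic_at1 fe (D_H1 (leqnSn 1) tT) (E1 tT).
exact: (error_equation tT (Ck_cont01 beta_smooth tT) (f_cont tT) fe (C2 (leq0n 1)) (u_0 tT)
  (Vuh tT) (Vduh tT) Vp (fun x => pde tT (x := x)) (u_1 tT) (uh_eq Vp tT) (E0 tT) (V1 tT) W11).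
Qed.

Let B0 : 0 <= B. Proof. by rewrite !mulr_ge0 ?sqr_ge0// exprn_ge0// ltW. Qed.
Let R_ge0 j t : 0 <= R_ j t. Proof. exact: sob_norm_ge0. Qed.
Let rho0_le t : 0 <= t <= T -> norm2 (rho0 t) <= B * R_ 0 t.
Proof. by move=> tT; exact: (elliptic_error (D_Hs0 (leq0n 2) tT) (E0 tT)).2. Qed.
Let rho1_le t : 0 <= t <= T -> norm2 (rho1 t) <= B * R_ 1 t.
Proof. by move=> tT; exact: (elliptic_error (D_Hs0 (leqnSn 1) tT) (E1 tT)).2. Qed.
Let rho2_le t : 0 <= t <= T -> norm2 (rho2 t) <= B * R_ 2 t.
Proof. by move=> tT; exact: (elliptic_error (D_Hs0 (leqnn 2) tT) (E2 tT)).2. Qed.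

Let beta_mul t v : 0 <= t <= T -> L2 v -> norm2 (fun x => beta t x * v x) <= N * norm2 v.
Proof.
move=> tT Lv; apply: (norm2_mul_sup (Ck_cont01 beta_smooth tT) Lv N0) => x x1.
by have [b _ _] := beta_le tT x1; exact: le_trans MN.
Qed.

Let dbeta_mul t v : 0 <= t <= T -> L2 v -> norm2 (fun x => Dt T beta t x * v x) <= N * norm2 v.
Proof.
move=> tT Lv; apply: (norm2_mul_sup (Ck_cont01 (Ck_Dt beta_smooth) tT) Lv N0) => x x1.
by have [_ b _] := beta_le tT x1; exact: le_trans MN.
Qed.

Let scaled_le n R' : 0 <= R' -> n <= B * R' -> N * n <= N * B * R' /\ n <= N * B * R'.
Proof.
move=> R0 nB; have h1 : N * n <= N * B * R' by rewrite -mulrA ler_wpM2l.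
split=> //; apply: (le_trans nB); rewrite -mulrA; apply: ler_peMl => //.
exact: mulr_ge0.
Qed.

Let F_le t : 0 <= t <= T -> norm2 (F t) <= N * B * (R_ 0 t + R_ 1 t).
Proof.
move=> tT; have Lq := Lb tT (Lrho0 tT).
apply: (le_trans (norm2B (L2Z _ Lq) (Lrho1 tT))); rewrite (norm2_i Lq) mulrDr; apply: lerD.
  apply: (le_trans (beta_mul tT (Lrho0 tT))).
  exact: (scaled_le (R_ge0 0 t) (rho0_le tT)).1.
exact: (scaled_le (R_ge0 1 t) (rho1_le tT)).2.
Qed.

Let dF_le t : 0 <= t <= T -> norm2 (dF t) <= N * B * (R_ 0 t + R_ 1 t + R_ 2 t).
Proof.
move=> tT; have L1 := Ldb tT (Lrho0 tT); have L2' := Lb tT (Lrho1 tT).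
apply: (le_trans (norm2B (L2Z _ (L2D L1 L2')) (Lrho2 tT))).
rewrite (norm2_i (L2D L1 L2')) [leRHS]mulrDr; apply: lerD; last first.
  exact: (scaled_le (R_ge0 2 t) (rho2_le tT)).2.
apply: (le_trans (norm2D L1 L2')); rewrite mulrDr; apply: lerD.
  apply: (le_trans (dbeta_mul tT (Lrho0 tT))).
  exact: (scaled_le (R_ge0 0 t) (rho0_le tT)).1.
apply: (le_trans (beta_mul tT (Lrho1 tT))).
exact: (scaled_le (R_ge0 1 t) (rho1_le tT)).1.
Qed.

Let Q t := R_ 0 t ^+ 2 + R_ 1 t ^+ 2 + R_ 2 t ^+ 2.
Let k t := A * Num.sqrt (Q t).
Let nb2 t := A ^+ 2 * (R_ 0 t ^+ 2 + R_ 1 t ^+ 2).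
Let A0 : 0 <= A. Proof. by rewrite mulr_ge0// mulr_ge0. Qed.
Let Q0 t : 0 <= Q t. Proof. by rewrite !addr_ge0 ?sqr_ge0. Qed.

Let cR j : (j <= 2)%N -> {within `[0, T], continuous (fun t => R_ j t ^+ 2)}.
Proof. exact: (sob_iter_cont cu). Qed.
Let cR01 : {within `[0, T], continuous (fun t => R_ 0 t ^+ 2 + R_ 1 t ^+ 2)}.
Proof. exact: (within_add (cR (leq0n 2)) (cR (leqnSn 1))). Qed.
Let cQ : {within `[0, T], continuous Q}.
Proof. exact: (within_add cR01 (cR (leqnn 2))). Qed.
Let ck : {within `[0, T], continuous k}.
Proof.
apply: (within_mul (@within_cst _ A _)); apply: (within_comp _ cQ); exact: sqrt_continuous.
Qed.
Let cnb : {within `[0, T], continuous nb2}.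
Proof. exact: (within_mul (@within_cst _ (A ^+ 2) _) cR01). Qed.

Let kF t : 0 <= t <= T ->
  [/\ norm2 (F t) <= k t, norm2 (dF t) <= k t & norm2 (F t) ^+ 2 <= nb2 t].
Proof.
move=> tT; have NB : 0 <= N * B by rewrite mulr_ge0.
have kE : N * B * (R_ 0 t + R_ 1 t + R_ 2 t) <= k t.
  rewrite /k /A [2 * _]mulrC -[leRHS]mulrA; apply: (ler_wpM2l NB); exact: sum3_le_sqrt.
split.
- apply: le_trans kE; apply: (le_trans (F_le tT)); apply: (ler_wpM2l NB).
  by rewrite lerDl.
- exact: le_trans (dF_le tT) kE.
- exact: sum2_sqr_le NB (norm2_ge0 _) (F_le tT).
Qed.

(* Both uh 0 and W0 0 are elliptic projections of the initial value. *)
Let th0 : norm2 (wderiv (th 0)) = 0.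
Proof.
have z0 : 0 <= (0 : R) <= T by rewrite lexx ltW.
have Hu := D_H1 (leq0n 2) z0.
have uE x : 0 < x < 1 -> u 0 x = u0 x by move=> /andP[x0 x1]; apply: u_init; rewrite !ltW.
have wE : wderiv u0 = wderiv (u 0).
  apply: esym; apply: (wderiv_ext (H1_L2 Hu) (eq_L2 uE (H1_L2 Hu))); exact: eqD_ae.
have Eh : elliptic_proj V (D 0 0) (uh 0).
  have [Vh hE] := uh_init; split; first exact: Vh.
  by move=> phi Vp; rewrite (hE _ Vp); with_strategy transparent [Bform] (rewrite /Bform wE).
have /(elliptic_projP fe _ Hu)[_ hE] := Eh.
have /(elliptic_projP fe _ Hu)[_ wE'] := E0 z0.
have : eip (th 0) (th 0) = 0.
  rewrite (eipBl (VH (Vuh z0)) (VH (V0 z0)) (VH (Vth z0))) (hE _ (Vth z0)) (wE' _ (Vth z0)).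
  exact: subrr.
by rewrite eipE -norm2_sqr => /eqP; rewrite sqrf_eq0 => /eqP.
Qed.

Let EC := energy_const T (20 * N ^+ 10).
Let Gam t := prim (GammaN T r u) t.

Let th_le t : 0 <= t <= T -> norm2 (th t) ^+ 2 <= EC * A ^+ 2 * Gam t.
Proof.
move=> tT.
have cN s : 0 <= s <= T -> [/\ al s * a s = 1, `|a s| <= N, `|al s| <= N & `|dal s| <= N].
  by move=> /coeffs[b1 b2 b3 b4]; split=> //; apply: le_trans MN.
have bN s : 0 <= s <= T ->
    [/\ - N <= mu s <= 0, 0 < S s, S s <= N, (S s)^-1 <= N & normc (G s) <= N].
  move=> /bcoeffs[/andP[b1 b1'] b2 b3 b4 b5]; split=> //; try exact: le_trans MN.
  by rewrite b1' andbT; apply: le_trans b1; rewrite lerN2.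
have beN s x : 0 <= s <= T -> 0 <= x <= 1 -> normc (beta s x) <= N.
  by move=> sT /(beta_le sT)[b _ _]; exact: le_trans MN.
have main := error_energy T_gt0 fe N1 cN bN (fun s sT => Ck_cont01 beta_smooth sT) beN al_der al_cont
  Vth Vdth LF LdF th_der wth_der F_der eqn (fun s sT => projected_product sT (VH (Vth sT)))
  kF ck cnb th0 tT.
apply: (le_trans main); rewrite -/EC -mulrA; apply: ler_wpM2l.
  by apply: energy_const_ge0 => //; rewrite mulr_ge0// exprn_ge0.
have [_ cpQ _] := prim_props T_gt0 cQ.
have p1 : prim nb2 t = A ^+ 2 * prim (fun s => R_ 0 s ^+ 2 + R_ 1 s ^+ 2) t.
  exact: prim_scale cR01 tT.
have ck2 : {within `[0, T], continuous (fun s => k s ^+ 2)} by exact: (within_mul ck ck).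
have [_ cpk _] := prim_props T_gt0 ck2.
have kE s : k s ^+ 2 = A ^+ 2 * Q s by rewrite /k exprMn sqr_sqrtr.
have p2 : prim (prim (fun s => k s ^+ 2)) t <= A ^+ 2 * prim (prim Q) t.
  rewrite -(prim_scale _ cpQ tT); apply: (prim_le cpk _ _ tT).
    exact: (within_mul (@within_cst _ (A ^+ 2) _) cpQ).
  move=> s sT; rewrite -(prim_scale _ cQ sT) (_ : (fun s => k s ^+ 2) = (fun s => A ^+ 2 * Q s))//.
  by apply/funext.
have [_ g1] := data_le_Gamma T_gt0 cu tT.
have p3 := ler_wpM2l (sqr_ge0 A) g1.
apply: le_trans p3; rewrite mulrDr; apply: lerD p2; by rewrite p1.
Qed.

Lemma mesh_error_of_projections t : 0 <= t <= T ->
  norm2 (fun x => uh t x - u t x) + h * sob_norm 1 (fun x => uh t x - u t x) <=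
  ((1 + hs + J) * (Num.sqrt EC * (4 * N * K ^+ 2)) + (1 + hs) * (2 * K ^+ 2) + K) * h ^+ r.+1 *
  Num.sqrt (sob_norm r.+1 (u t) ^+ 2 + Gam t).
Proof.
move=> tT; have Hth := VH (Vth tT); have Hu := D_H1 (leq0n 2) tT.
have Hr : Hs0 1 (rho0 t) := H1B (VH (V0 tT)) Hu.
have sE : (fun x => uh t x - u t x) = (fun x => th t x + rho0 t x).
  by apply/funext => x; rewrite /th /rho0; ring.
have [er1 er2] := elliptic_error (D_Hs0 (leq0n 2) tT) (E0 tT).
have [G0 _] := data_le_Gamma T_gt0 cu tT.
have hh : 0 <= h <= hs by rewrite ltW.
have H0 : 0 <= h ^+ r.+1 by rewrite exprn_ge0// ltW.
have EC0 : 0 <= EC by apply: energy_const_ge0 => //; rewrite mulr_ge0// exprn_ge0.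
have c0 : 0 <= 2 * K ^+ 2 by rewrite mulr_ge0 ?sqr_ge0.
have A10 : 0 <= 4 * N * K ^+ 2 by rewrite mulr_ge0 ?sqr_ge0// mulr_ge0.
have inv : h * norm2 (wderiv (th t)) <= J * norm2 (th t).
  have := ler_wpM2l (ltW h_gt0) (inverse (Vth tT)).
  by rewrite !mulrA [h * J]mulrC mulfK// gt_eqF.
have thb : norm2 (th t) ^+ 2 <= EC * (4 * N * K ^+ 2 * h ^+ r.+1) ^+ 2 * Gam t.
  have -> : 4 * N * K ^+ 2 * h ^+ r.+1 = A by rewrite /A /B; ring.
  exact: th_le.
rewrite sE; apply: (total_error_arith hh J0 K0 c0 H0 EC0 A10 (norm2_ge0 (th t)) (R_ge0 0 t) G0
  (norm2D (H1_L2 Hth) (H1_L2 Hr)) (norm2_wderivD Hth Hr) (sob_norm1_le _) inv er2 er1 thb).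
Qed.

End projected_solution.

Lemma mesh_error t : 0 <= t <= T ->
  norm2 (fun x => uh t x - u t x) + h * sob_norm 1 (fun x => uh t x - u t x) <=
  ((1 + hs + J) * (Num.sqrt (energy_const T (20 * N ^+ 10)) * (4 * N * K ^+ 2))
    + (1 + hs) * (2 * K ^+ 2) + K) * h ^+ r.+1 *
  Num.sqrt (sob_norm r.+1 (u t) ^+ 2 + prim (GammaN T r u) t).
Proof.
have [W0 E0] := elliptic_curve (fun t => D_H1 (leq0n 2) (t := t)).
have [W1 E1] := elliptic_curve (fun t => D_H1 (leqnSn 1) (t := t)).
have [W2 E2] := elliptic_curve (fun t => D_H1 (leqnn 2) (t := t)).
exact: (mesh_error_of_projections E0 E1 E2).
Qed.

End one_mesh.

Theorem theorem2p5 (R : realType) (r : nat) (T hstar : R)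
    (Sh : R -> set (R -> R[i]))
    (a : R -> R) (beta f : R -> R -> R[i]) (u0 : R -> R[i])
    (mu S : R -> R) (G : R -> R[i])
    (u : R -> R -> R[i]) (uh : R -> R -> R -> R[i])
    (r_gt0 : (0 < r)%N) (T_gt0 : 0 < T) (hstar_gt0 : 0 < hstar)
    (Sh_space : forall h : R, 0 < h <= hstar -> fe_space r h (Sh h))
    (Sh_approx : approx_property hstar r Sh)
    (Sh_inverse : inverse_inequality hstar Sh)
    (a_smooth : C1_on 0 T a)
    (a_neq0 : forall t : R, 0 <= t <= T -> a t != 0)
    (beta_smooth : Ck_rect T 1 beta)
    (f_smooth : Ck_rect T 0 f)
    (mu_smooth : {within `[0, T], continuous mu})
    (S_smooth : {within `[0, T], continuous S})
    (G_smooth : continuous_on (`[0, T]%classic : set R) G)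
    (u_solution : unique_solution_N T r a beta f u0 mu S G u)
    (uh_semidiscrete : forall h : R, 0 < h <= hstar ->
       semidiscrete T a beta f u0 mu S G (Sh h) (uh h))
    (mu_le0 : forall t : R, 0 <= t <= T -> mu t <= 0)
    (S_gt0 : forall t : R, 0 <= t <= T -> 0 < S t) :
  exists K : R, forall t h : R, 0 <= t <= T -> 0 < h <= hstar ->
    norm2 (fun x => uh h t x - u t x)
      + h * sob_norm 1 (fun x => uh h t x - u t x)
    <= K * h ^+ r.+1 *
       Num.sqrt (sob_norm r.+1 (u t) ^+ 2
                 + \int[@lebesgue_measure R]_(tau in `[0, t]) GammaN T r u tau).

Proof.
have [K K0 appr] := approx_property_uniform Sh_space Sh_approx.
have [J0 inv] := Sh_inverse; pose J := `|J0|.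
have [[cu pde u_0 u_1 u_init] _] := u_solution.
have [al [dal [M [M1 coeffs bcoeffs beta_le [al_der al_cont]]]]] :=
  coefficient_bounds T_gt0 a_smooth a_neq0 beta_smooth mu_smooth S_smooth G_smooth mu_le0 S_gt0.
have f_cont t : 0 <= t <= T -> cont01 (f t) by move=> tT; exact: Ck_cont01 f_smooth tT.
pose N := M * (2 * (1 + 4 * K * J)).
exists ((1 + hstar + J) * (Num.sqrt (energy_const T (20 * N ^+ 10)) * (4 * N * K ^+ 2))
    + (1 + hstar) * (2 * K ^+ 2) + K) => t h tT hh.
have /andP[h_gt0 h_le] := hh; have fe := Sh_space _ hh.
have inverse phi : Sh h phi -> norm2 (wderiv phi) <= J * h^-1 * norm2 phi.
  move=> Vp; apply: (le_trans (inv h hh phi Vp)).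
  apply: (ler_wpM2r (norm2_ge0 _)); apply: ler_wpM2r; first by rewrite invr_ge0 ltW.
  exact: ler_norm.
have [duh [uh_C1 uh_init uh_eq]] := uh_semidiscrete _ hh.
exact: (mesh_error T_gt0 r_gt0 fe h_gt0 h_le K0 (normr_ge0 _) (appr _ hh) inverse M1 coeffs bcoeffs
  beta_smooth beta_le al_der al_cont f_cont cu pde u_0 u_1 u_init uh_C1 uh_init uh_eq tT).
Qed.
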